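(* Two Kähler tube domains can be locally holomorphically isometric but have non-isometric dual (statistical mirror) metrics. Specifically, let $\mathbb{M}_{\mathrm{NegTri}},\mathbb{W}_{\mathrm{NegTri}}$ be the mirror pair of the negative trinomial family and $\mathbb{M}_{\mathrm{Normal}},\mathbb{W}_{\mathrm{Normal}}$ the mirror pair of the univariate normal family (both defined in the context). Then $\mathbb{M}_{\mathrm{NegTri}}$ and $\mathbb{W}_{\mathrm{Normal}}$ both have constant negative holomorphic sectional curvature and are locally holomorphically isometric. On the other hand, their duals $\mathbb{W}_{\mathrm{NegTri}}$ and $\mathbb{M}_{\mathrm{Normal}}$ are distinct as Kähler manifolds and are not locally isometric: $\mathbb{M}_{\mathrm{Normal}}$ has constant scalar curvature whereas $\mathbb{W}_{\mathrm{NegTri}}$ does not. The same holds after quotienting: if the fibers of $\mathbb{M}_{\mathrm{NegTri}}$ and $\mathbb{W}_{\mathrm{Normal}}$ are quotiented by a pair of co-compact lattices, the resulting spaces are locally biholomorphically isometric, while $\mathbb{W}_{\mathrm{NegTri}}$ and $\mathbb{M}_{\mathrm{Normal}}$ remain distinct when quotiented by the dual co-compact lattices.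
   Context: For a domain $U\subset\mathbb{R}^2$, $TU=\{x+\sqrt{-1}\,y: x\in U,\ y\in\mathbb{R}^2\}\subset\mathbb{C}^2$; its fibers are the copies of $\mathbb{R}^2$ given by the $y$-directions. A smooth convex potential $\Psi:U\to\mathbb{R}$ with positive definite Hessian induces on $TU$ the Kähler form $\frac{\sqrt{-1}}{2}\sum_{i,j}\frac{\partial^2\Psi}{\partial x^i\partial x^j}\,dz^i\wedge d\bar z^j$. The dual (statistical mirror) of $(TU,\Psi)$ is the tube domain over the domain $U^\ast$ of the Legendre dual $\Psi^\ast(u)=\sup_{x\in U}(\langle x,u\rangle-\Psi(x))$, with the Kähler form induced by $\Psi^\ast$. Normal family: $\mathbb{M}_{\mathrm{Normal}}$ is the tube domain over $\{(x^1,x^2): x^2<0\}$ with potential $-\frac{(x^1)^2}{4x^2}-\frac12\log\big(-\frac{x^2}{\pi}\big)$. Its dual $\mathbb{W}_{\mathrm{Normal}}$ is the tube domain over $\{(u_1,u_2): u_1^2<u_2\}$ with potential, up to an additive constant (which does not affect the metric), $-\frac12\log(u_2-u_1^2)$. Negative trinomial family: $\mathbb{M}_{\mathrm{NegTri}}$ is the tube domain over $\{(\theta^1,\theta^2): e^{\theta^1}+e^{\theta^2}<1\}$ with potential $-\log(1-e^{\theta^1}-e^{\theta^2})$. Its dual $\mathbb{W}_{\mathrm{NegTri}}$ is the tube domain over $\{(\eta_1,\eta_2):\eta_1,\eta_2>0\}$ with potential $\eta_1\log\eta_1+\eta_2\log\eta_2-(1+\eta_1+\eta_2)\log(1+\e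ta_1+\eta_2)$.
   Formalization: The local holomorphic isometry (also after quotienting) is between M_NegTri and W_Normal with its metric doubled: with the stated potentials their holomorphic sectional curvatures are −1 and −2, so the unscaled claim is false. Non-isometry of the duals is proved for every rescaling. *)

(* Defs.v *)
From HB Require Import structures.
From mathcomp Require Import all_boot all_order all_algebra.
From mathcomp Require Import all_classical all_reals all_analysis.
From mathcomp Require Import complex.

Set Implicit Arguments.
Unset Strict Implicit.
Unset Printing Implicit Defensive.

Import Order.TTheory GRing.Theory Num.Theory.
Import numFieldNormedType.Exports.

Local Open Scope classical_set_scope.
Local Open Scope ring_scope.

Definition partial (R : realType) (n : nat) (k : 'I_n) (f : 'rV[R]_n -> R)
    (x : 'rV[R]_n) : R :=
  'D_(delta_mx ord0 k) f x.

Fixpoint Cn_on (R : realType) (n m : nat) (A : set 'rV[R]_n)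
    (f : 'rV[R]_n -> R) : Prop :=
  match m with
  | 0 => forall x, A x -> {for x, continuous f}
  | m'.+1 => (forall x, A x -> differentiable f x) /\
             (forall k, Cn_on m' A (partial k f))
  end.

(* Only meant for an open set [A]. *)
Definition smooth_on (R : realType) (n : nat) (A : set 'rV[R]_n)
    (f : 'rV[R]_n -> R) : Prop :=
  forall m, Cn_on m A f.

Definition smooth_map_on (R : realType) (n p : nat) (A : set 'rV[R]_n)
    (f : 'rV[R]_n -> 'rV[R]_p) : Prop :=
  forall k, smooth_on A (fun z => f z ord0 k).

Definition hessian (R : realType) (n : nat) (f : 'rV[R]_n -> R)
    (x : 'rV[R]_n) : 'M[R]_n :=
  \matrix_(i, j) partial i (partial j f) x.

Definition dot (R : realType) (n : nat) (x u : 'rV[R]_n) : R :=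
  \sum_(i < n) x ord0 i * u ord0 i.

(* The Levi-Civita symbol Gamma^k_{ij}. *)
Definition christoffel (R : realType) (n : nat) (g : 'rV[R]_n -> 'M[R]_n)
    (i j k : 'I_n) (x : 'rV[R]_n) : R :=
  2^-1 * \sum_(l < n) invmx (g x) k l *
    (partial i (fun y => g y j l) x + partial j (fun y => g y i l) x
     - partial l (fun y => g y i j) x).

(* The [l]-th component of R(d_i, d_j) d_k, for
   R(X, Y) Z = D_X D_Y Z - D_Y D_X Z - D_[X, Y] Z. *)
Definition riemann (R : realType) (n : nat) (g : 'rV[R]_n -> 'M[R]_n)
    (i j k l : 'I_n) (x : 'rV[R]_n) : R :=
  partial i (christoffel g j k l) x - partial j (christoffel g i k l) x
  + \sum_(m < n) (christoffel g i m l x * christoffel g j k m x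
                  - christoffel g j m l x * christoffel g i k m x).

Definition metric_at (R : realType) (n : nat) (g : 'rV[R]_n -> 'M[R]_n)
    (x u v : 'rV[R]_n) : R :=
  (u *m g x *m v^T) ord0 ord0.

Definition curvature_op (R : realType) (n : nat) (g : 'rV[R]_n -> 'M[R]_n)
    (x u v w : 'rV[R]_n) : 'rV[R]_n :=
  \row_l \sum_(i < n) \sum_(j < n) \sum_(k < n)
    u ord0 i * v ord0 j * w ord0 k * riemann g i j k l x.

Definition sectional_curvature (R : realType) (n : nat)
    (g : 'rV[R]_n -> 'M[R]_n) (x u v : 'rV[R]_n) : R :=
  metric_at g x (curvature_op g x u v v) u /
  (metric_at g x u u * metric_at g x v v - metric_at g x u v ^+ 2).

Definition ricci (R : realType) (n : nat) (g : 'rV[R]_n -> 'M[R]_n)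
    (j k : 'I_n) (x : 'rV[R]_n) : R :=
  \sum_(i < n) riemann g i j k i x.

Definition scalar_curvature (R : realType) (n : nat)
    (g : 'rV[R]_n -> 'M[R]_n) (x : 'rV[R]_n) : R :=
  \sum_(j < n) \sum_(k < n) invmx (g x) j k * ricci g j k x.

Notation "''C2[' R ]" := 'rV[R]_(2 + 2) (format "''C2[' R ]").

Definition re2 (R : realType) (z : 'C2[R]) : 'rV[R]_2 := lsubmx z.
Definition im2 (R : realType) (z : 'C2[R]) : 'rV[R]_2 := rsubmx z.

(* Elements of 'rV_(2 + 2) encode z = x + i y in C^2 as the row (x, y). *)
Definition cplxJ (R : realType) (v : 'C2[R]) : 'C2[R] :=
  row_mx (- im2 v) (re2 v).

Definition dz (R : realType) (i : 'I_2) (v : 'C2[R]) : R[i] :=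
  Complex (re2 v ord0 i) (im2 v ord0 i).

Definition holomorphic_on (R : realType) (A : set 'C2[R])
    (f : 'C2[R] -> 'C2[R]) : Prop :=
  forall z, A z -> differentiable f z /\
    forall v, 'd f z (cplxJ v) = cplxJ ('d f z v).

Definition holomorphic_sectional_curvature (R : realType)
    (g : 'C2[R] -> 'M[R]_(2 + 2)) (z v : 'C2[R]) : R :=
  sectional_curvature g z v (cplxJ v).

(* [base] is the domain U; [potential] is only relevant on U. *)
Record tube (R : realType) := Tube {
  base : set 'rV[R]_2;
  potential : 'rV[R]_2 -> R }.

Definition is_kahler_tube (R : realType) (T : tube R) : Prop :=
  [/\ open (base T), base T !=set0, connected (base T),
      smooth_on (base T) (potential T)
    & forall x, base T x -> forall v : 'rV[R]_2, v != 0 ->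
        0 < (v *m hessian (potential T) x *m v^T) ord0 ord0].

Definition tube_domain (R : realType) (T : tube R) : set 'C2[R] :=
  [set z | base T (re2 z)].

(* (i / 2) * sum_{i,j} Psi_{ij} dz^i /\ dzbar^j evaluated on (u, v). *)
Definition kahler_form (R : realType) (T : tube R) (z u v : 'C2[R]) : R[i] :=
  Complex 0 2^-1 * \sum_(i < 2) \sum_(j < 2)
    Complex (hessian (potential T) (re2 z) i j) 0 *
    (dz i u * conjc (dz j v) - dz i v * conjc (dz j u)).

(* g(u, v) = omega(u, J v); here omega is real-valued. *)
Definition tube_metric (R : realType) (T : tube R) (z : 'C2[R]) :
    'M[R]_(2 + 2) :=
  \matrix_(a, b) complex.Re (kahler_form T z (delta_mx ord0 a)
                               (cplxJ (delta_mx ord0 b))).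

Definition legendre_values (R : realType) (T : tube R) (u : 'rV[R]_2) : set R :=
  [set dot x u - potential T x | x in base T].

(* The domain of the Legendre dual is the interior of the set on which the
   supremum is finite.  The dual potential matters only up to a constant. *)
Definition statistical_mirror (R : realType) (M W : tube R) : Prop :=
  base W = interior [set u | has_sup (legendre_values M u)] /\
  exists c : R, forall u, base W u ->
    potential W u = sup (legendre_values M u) + c.

(* A Kahler surface presented as the image of a domain [kdom] of C^2 under a
   covering projection [kproj]: the restrictions of [kproj] to the open sets on
   which it is injective are its holomorphic parametrizations, and [kmetric]
   is the metric in all of them. *)
Record kahler_surface (R : realType) := KahlerSurface {
  kdom : set 'C2[R];
  kmetric : 'C2[R] -> 'M[R]_(2 + 2);
  kpoint : Type;
  kproj : 'C2[R] -> kpoint }.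

Definition kpoints (R : realType) (X : kahler_surface R) : set (kpoint X) :=
  [set kproj X z | z in kdom X].
Arguments kpoints {R} X _.

Definition tube_surface (R : realType) (T : tube R) : kahler_surface R :=
  KahlerSurface (tube_domain T) (tube_metric T) id.

(* The class of [z] modulo translations of the fiber coordinate by [L]. *)
Definition fiber_coset (R : realType) (L : set 'rV[R]_2) (z : 'C2[R]) :
    set 'C2[R] :=
  [set w | re2 w = re2 z /\ L (im2 w - im2 z)].

Definition tube_quotient (R : realType) (T : tube R) (L : set 'rV[R]_2) :
    kahler_surface R :=
  KahlerSurface (tube_domain T) (tube_metric T) (fiber_coset L).

Definition rescale (R : realType) (c : R) (X : kahler_surface R) :
    kahler_surface R :=
  KahlerSurface (kdom X) (fun z => c *: kmetric X z) (kproj X).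

Definition cocompact_lattice (R : realType) (L : set 'rV[R]_2) : Prop :=
  exists2 B : 'M[R]_2, B \in unitmx &
    L = [set (map_mx intr a *m B : 'rV[R]_2) | a in [set: 'rV[int]_2]].

Definition dual_lattice (R : realType) (L : set 'rV[R]_2) : set 'rV[R]_2 :=
  [set v | forall y, L y -> exists m : int, dot v y = m%:~R].

(* Near [p], the map [F] is read in parametrizations as the diffeomorphism
   [f] from [A] onto [B], with inverse [f']. *)
Definition local_diffeo (R : realType) (X Y : kahler_surface R)
    (F : kpoint X -> kpoint Y) (p : kpoint X)
    (A B : set 'C2[R]) (f f' : 'C2[R] -> 'C2[R]) : Prop :=
  [/\ [/\ open A, A `<=` kdom X & {in A &, injective (kproj X)}],
      [/\ open B, B `<=` kdom Y & {in B &, injective (kproj Y)}],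
      [/\ smooth_map_on A f & smooth_map_on B f'],
      (forall z, A z -> B (f z) /\ f' (f z) = z) /\
      (forall w, B w -> A (f' w) /\ f (f' w) = w)
    & (exists2 z, A z & kproj X z = p) /\
      (forall z, A z -> F (kproj X z) = kproj Y (f z))].

(* f^* h = g on [A]; with row vectors, df(v) = v *m 'J f z. *)
Definition isometric_on (R : realType) (g h : 'C2[R] -> 'M[R]_(2 + 2))
    (A : set 'C2[R]) (f : 'C2[R] -> 'C2[R]) : Prop :=
  forall z, A z -> jacobian f z *m h (f z) *m (jacobian f z)^T = g z.

Definition local_isometry_at (R : realType) (X Y : kahler_surface R)
    (F : kpoint X -> kpoint Y) (p : kpoint X) : Prop :=
  exists A B f f', local_diffeo F p A B f f' /\
    isometric_on (kmetric X) (kmetric Y) A f.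

Definition local_hol_isometry_at (R : realType) (X Y : kahler_surface R)
    (F : kpoint X -> kpoint Y) (p : kpoint X) : Prop :=
  exists A B f f', [/\ local_diffeo F p A B f f', holomorphic_on A f &
    isometric_on (kmetric X) (kmetric Y) A f].

Definition locally_isometric_at (R : realType) (X Y : kahler_surface R)
    (p : kpoint X) (q : kpoint Y) : Prop :=
  exists F : kpoint X -> kpoint Y, F p = q /\ local_isometry_at F p.

Definition locally_hol_isometric_at (R : realType) (X Y : kahler_surface R)
    (p : kpoint X) (q : kpoint Y) : Prop :=
  exists F : kpoint X -> kpoint Y, F p = q /\ local_hol_isometry_at F p.

(* Stronger than asking that every point have a neighborhood isometric to an
   open set of the other surface: the base points [p], [q] are arbitrary. *)
Definition locally_hol_isometric (R : realType) (X Y : kahler_surface R) :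
    Prop :=
  forall (p : kpoint X) (q : kpoint Y),
    kpoints X p -> kpoints Y q -> locally_hol_isometric_at p q.

(* No nonempty open subset of [X] is isometric to an open subset of [Y]. *)
Definition nowhere_locally_isometric (R : realType) (X Y : kahler_surface R) :
    Prop :=
  forall (p : kpoint X) (q : kpoint Y),
    kpoints X p -> kpoints Y q -> ~ locally_isometric_at p q.

Definition kahler_isomorphic (R : realType) (X Y : kahler_surface R) : Prop :=
  exists F : kpoint X -> kpoint Y, set_bij (kpoints X) (kpoints Y) F /\
    forall p, kpoints X p -> local_hol_isometry_at F p.

Definition constant_negative_hsc (R : realType) (X : kahler_surface R) : Prop :=
  exists2 k : R, k < 0 & forall z, kdom X z -> forall v, v != 0 ->
    holomorphic_sectional_curvature (kmetric X) z v = k.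

Definition constant_scalar_curvature (R : realType) (X : kahler_surface R) :
    Prop :=
  exists s : R, forall z, kdom X z -> scalar_curvature (kmetric X) z = s.

Definition crd1 (R : realType) (x : 'rV[R]_2) : R := x ord0 ord0.
Definition crd2 (R : realType) (x : 'rV[R]_2) : R := x ord0 ord_max.

Definition MNormal (R : realType) : tube R :=
  Tube [set x | crd2 x < 0]
    (fun x => - (crd1 x ^+ 2 / (4 * crd2 x)) - 2^-1 * ln (- (crd2 x / pi))).

Definition WNormal (R : realType) : tube R :=
  Tube [set u | crd1 u ^+ 2 < crd2 u]
    (fun u => - (2^-1 * ln (crd2 u - crd1 u ^+ 2))).

Definition MNegTri (R : realType) : tube R :=
  Tube [set t | expR (crd1 t) + expR (crd2 t) < 1]
    (fun t => - ln (1 - expR (crd1 t) - expR (crd2 t))).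

Definition WNegTri (R : realType) : tube R :=
  Tube [set e | 0 < crd1 e /\ 0 < crd2 e]
    (fun e => crd1 e * ln (crd1 e) + crd2 e * ln (crd2 e)
              - (1 + crd1 e + crd2 e) * ln (1 + crd1 e + crd2 e)).

(* Main.v *)
From HB Require Import structures.
Require Import Defs.
From mathcomp Require Import all_boot all_order all_algebra.
From mathcomp Require Import all_classical all_reals all_analysis.
From mathcomp Require Import complex ring lra.
Set Implicit Arguments.
Unset Strict Implicit.
Unset Printing Implicit Defensive.
Import Order.TTheory GRing.Theory Num.Theory.
Import numFieldNormedType.Exports.
Local Open Scope classical_set_scope.
Local Open Scope ring_scope.

(** Both tubes on the first side are models of the complex hyperbolic plane.
    The exponentials [Z_j = exp (z_j / 2)] map the tube of the negative trinomial
    family to the unit ball, its potential becoming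
    [- log (1 - |Z_0|^2 - |Z_1|^2)], and the tube over the parabola is the Siegel
    domain, the image of the ball by a Cayley transform.  The composite, followed
    by an affine automorphism of the Siegel domain, pulls twice the metric of the
    second tube back to that of the first ([ball_map_isometric]); the factor two
    equates the holomorphic sectional curvatures [-1] and [-2].  The affine
    automorphisms are transitive ([ball_map_transitive]), so that any point goes
    to any other, and a branch of the logarithm gives the local inverse.

    On the dual side the scalar curvature tells the metrics apart.  It equals
    [-6] on the normal tube ([scalar_curvature_MNormal]), whereas on the dual of
    the negative trinomial tube it is
    [- (3 + 1 / x_0 + 1 / x_1 - 1 / (1 + x_0 + x_1))], which is constant on no
    nonempty open set ([scalar_curvature_WNegTri_nonconstant]).  A local isometry
    preserves the scalar curvature ([scalar_curvature_isometry]) and a rescaling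
    divides it by a constant, so that no open sets are isometric, not even after
    rescaling ([no_local_isometry]).  The same holds for the quotients, which have
    the same parametrizations: a lattice is discrete, hence the projection is
    injective near every point ([tube_quotient_locally_injective]).

    The curvatures come from the uniqueness of the Levi-Civita connection
    ([connection_unique]), which identifies in turn the pull-back of a connection
    by an isometry, the connection of a rescaled metric, and that of a tube; the
    latter is made of the matrices [2^-1 (d_i H) H^-1], where [H] is the Hessian
    of the potential.  The scalar curvature of a tube then depends on the traces
    of these matrices only ([scalar_curvature_tube]), and constancy of the
    holomorphic sectional curvature becomes an identity between the derivatives of
    [H] ([constant_holomorphic_curvature]).  The Legendre transforms are computed
    by Gibbs' inequality and by completing a square. *)

(** * Gradients and smooth functions *)

(** The difference vanishes near [x], hence has differential zero there. *)
Lemma near_eq_differentiable (R : realType) (V W : normedModType R)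
    (f g : V -> W) (x : V) :
  (\near x, f x = g x) -> differentiable f x -> differentiable g x.
Proof.
move=> fg df.
have h0 : \near x, (g - f) x = 0.
  near=> y; have -> : (g - f) y = g y - f y by [].
  by rewrite (near fg y) ?subrr.
have dh : (g - f) \o shift x = cst ((g - f) x) + (0 : V -> W) +o_ 0 id.
  apply/eqaddoP => _/posnumP[e]; near=> y.
  have -> : ((g - f) \o shift x - (cst ((g - f) x) + (0 : V -> W))) y
    = (g - f) (y + x) - ((g - f) x + 0) by [].
  rewrite (nbhs_singleton h0) addr0 subr0.
  have -> : (g - f) (y + x) = 0.
    near: y.
    by have := h0; rewrite [X in X -> _](near_shift 0 x) subr0.
  by rewrite normr0 mulr_ge0.
have dg0 : differentiable (g - f) x.
  apply/diff_locallyP; rewrite (@diff_unique _ _ _ _ (\0 : {linear V -> W}))//.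
    by split=> //; exact: cst_continuous.
  exact: cst_continuous.
by have := differentiableD dg0 df; rewrite subrK.
Unshelve. all: by end_near. Qed.

Lemma differentiable_rV (R : realType) (V : normedModType R) (p : nat)
    (f : V -> 'rV[R]_p) (x : V) :
  (forall k, differentiable (fun y => f y ord0 k) x) -> differentiable f x.
Proof.
move=> df; rewrite (_ : f = \sum_(k < p) (fun y => f y ord0 k *: delta_mx ord0 k)).
  by apply: differentiable_sum => k; exact: differentiableZl.
apply/funext => y; rewrite fct_sumE; apply/rowP => k.
rewrite summxE (bigD1 k)//= !mxE !eqxx mulr1 big1 ?addr0// => j jk.
by rewrite !mxE (eq_sym k) (negbTE jk) mulr0.
Qed.

Section Gradients.
Variables (R : realType) (n : nat).
Implicit Types (f g : 'rV[R]_n -> R) (x : 'rV[R]_n) (d e : 'I_n -> R).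

(** Differentiability and partial derivatives travel together, so that one
    calculus rule per operation serves both. *)
Definition has_gradient f x d :=
  differentiable f x /\ forall k, partial k f x = d k.

Lemma has_gradient_ext f x d e :
  (forall k, d k = e k) -> has_gradient f x d -> has_gradient f x e.
Proof. by move=> de [df fd]; split=> // k; rewrite fd. Qed.

Lemma near_eq_partial f g x k :
  (\near x, f x = g x) -> partial k f x = partial k g x.
Proof. exact: near_eq_derive. Qed.

Lemma gradient_self f x :
  differentiable f x -> has_gradient f x (fun k => partial k f x).
Proof. by []. Qed.

Lemma gradient_cst (a : R) x : has_gradient (fun=> a) x (fun=> 0).
Proof.
by split=> [|k]; [exact: differentiable_cst | rewrite /partial derive_cst].
Qed.

Lemma gradient_coord j x :
  has_gradient (fun y => y ord0 j) x (fun k => (k == j)%:R).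
Proof.
split=> [|k]; first exact: differentiable_coord.
have := @derive_mx R _ 1 n id x (delta_mx ord0 k) (@derivable_id _ _ _ _).
rewrite derive_id => /matrixP/(_ ord0 j); rewrite !mxE eqxx /= eq_sym => ->.
by [].
Qed.

Lemma gradientD f g x d e : has_gradient f x d -> has_gradient g x e ->
  has_gradient (fun y => f y + g y) x (fun k => d k + e k).
Proof.
move=> [df fd] [dg ge]; split=> [|k]; first exact: differentiableD.
by rewrite -fd -ge; apply: deriveD; exact: diff_derivable.
Qed.

Lemma gradientN f x d : has_gradient f x d ->
  has_gradient (fun y => - f y) x (fun k => - d k).
Proof.
move=> [df fd]; split=> [|k]; first exact: differentiableN.
by rewrite -fd; apply: deriveN; exact: diff_derivable.
Qed.

Lemma gradientM f g x d e : has_gradient f x d -> has_gradient g x e ->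
  has_gradient (fun y => f y * g y) x (fun k => d k * g x + f x * e k).
Proof.
move=> [df fd] [dg ge]; split=> [|k]; first exact: differentiableM.
rewrite -fd -ge addrC /partial [LHS]deriveM//; try exact: diff_derivable.
by congr (_ + _); rewrite mulrC.
Qed.

Lemma gradient_sum (I : finType) (F : I -> 'rV[R]_n -> R) x (D : I -> 'I_n -> R) :
  (forall i, has_gradient (F i) x (D i)) ->
  has_gradient (fun y => \sum_i F i y) x (fun k => \sum_i D i k).
Proof.
move=> FD.
apply: (@has_gradient_ext _ _ (fun k => \sum_(i <- index_enum I) D i k)) => //.
elim: (index_enum I) => [|i s IHs].
  have -> : (fun y => \sum_(j <- [::]) F j y) = fun=> 0.
    by apply/funext => y; rewrite big_nil.
  by apply: has_gradient_ext (gradient_cst 0 x) => k; rewrite big_nil.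
have -> : (fun y => \sum_(j <- i :: s) F j y)
    = fun y => F i y + \sum_(j <- s) F j y.
  by apply/funext => y; rewrite big_cons.
by apply: has_gradient_ext (gradientD (FD i) IHs) => k; rewrite big_cons.
Qed.

Lemma gradient_comp1 (phi : R -> R) (a : R) f x d :
  is_derive (f x) 1 phi a -> has_gradient f x d ->
  has_gradient (fun y => phi (f y)) x (fun k => a * d k).
Proof.
move=> [dphi <-] [df fd].
have Dphi : differentiable phi (f x) by apply/derivable1_diffP.
have dc : differentiable (phi \o f) x by exact: differentiable_comp.
split=> // k; rewrite -fd /partial [LHS](deriveE _ dc) diff_comp//= deriveE//.
by rewrite diff1E// derive1E scale1r [in RHS](deriveE _ df) mulrC.
Qed.

Lemma gradientX f x d m : has_gradient f x d ->
  has_gradient (fun y => f y ^+ m) x (fun k => m%:R * f x ^+ m.-1 * d k).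
Proof.
move=> fd; elim: m => [|m IHm].
  have -> : (fun y => f y ^+ 0) = fun=> 1 by [].
  by apply: has_gradient_ext (gradient_cst 1 x) => k; rewrite !mul0r.
have -> : (fun y => f y ^+ m.+1) = fun y => f y * f y ^+ m.
  by apply/funext => y; rewrite exprS.
apply: has_gradient_ext (gradientM fd IHm) => k /=.
case: m {IHm} => [|m]; first by rewrite mulr0n !mul0r mulr0 addr0 expr0 !mulr1 mul1r.
by rewrite -[m.+2]addn1 natrD /= exprS; ring.
Qed.

Lemma gradientV f x d : f x != 0 -> has_gradient f x d ->
  has_gradient (fun y => (f y)^-1) x (fun k => - (f x)^-1 ^+ 2 * d k).
Proof.
move=> fx0; apply: gradient_comp1.
have dV : differentiable (GRing.inv : R -> R) (f x) by exact: differentiable_Rinv.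
apply: DeriveDef; first exact/derivable1_diffP.
by rewrite deriveE// diff_Rinv//= /GRing.scale /= mulr1 exprVn.
Qed.

Lemma gradient_expR f x d : has_gradient f x d ->
  has_gradient (fun y => expR (f y)) x (fun k => expR (f x) * d k).
Proof. by apply: gradient_comp1; exact: is_derive_expR. Qed.

Lemma gradient_ln f x d : 0 < f x -> has_gradient f x d ->
  has_gradient (fun y => ln (f y)) x (fun k => (f x)^-1 * d k).
Proof. by move=> fx0; apply: gradient_comp1; exact: is_derive1_ln. Qed.

Lemma gradient_cos f x d : has_gradient f x d ->
  has_gradient (fun y => cos (f y)) x (fun k => - sin (f x) * d k).
Proof. by apply: gradient_comp1; exact: is_derive_cos. Qed.

Lemma gradient_sin f x d : has_gradient f x d ->
  has_gradient (fun y => sin (f y)) x (fun k => cos (f x) * d k).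
Proof. by apply: gradient_comp1; exact: is_derive_sin. Qed.

Lemma gradient_atan f x d : has_gradient f x d ->
  has_gradient (fun y => atan (f y)) x (fun k => (1 + f x ^+ 2)^-1 * d k).
Proof. by apply: gradient_comp1; exact: is_derive1_atan. Qed.

End Gradients.

Lemma gradient_comp (R : realType) (n p : nat) (f : 'rV[R]_p -> R)
    (g : 'rV[R]_n -> 'rV[R]_p) (x : 'rV[R]_n) d (e : 'I_p -> 'I_n -> R) :
  has_gradient f (g x) d ->
  (forall j, has_gradient (fun y => g y ord0 j) x (e j)) ->
  has_gradient (fun y => f (g y)) x (fun k => \sum_j d j * e j k).
Proof.
move=> [df fd] ge.
have dg : differentiable g x by apply: differentiable_rV => j; case: (ge j).
have dfg : differentiable (f \o g) x by exact: differentiable_comp.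
split=> // k; rewrite /partial [LHS](deriveE _ dfg) diff_comp//=.
have -> : 'd g x (delta_mx ord0 k) = \row_j e j k.
  rewrite -(deriveE _ dg) derive_mx; last exact: diff_derivable.
  by apply/rowP => j; rewrite !mxE; case: (ge j) => _ <-.
rewrite [X in 'd f _ X]row_sum_delta linear_sum; apply: eq_bigr => j _.
by rewrite linearZ /= -(deriveE _ df) -fd mxE mulrC.
Qed.

Section Smoothness.
Variables (R : realType) (n : nat).
Implicit Types (f g : 'rV[R]_n -> R) (A B : set 'rV[R]_n).

Lemma Cn_on_sub m A B f : A `<=` B -> Cn_on m B f -> Cn_on m A f.
Proof.
move=> AB; elim: m f => [|m IHm] f /=; first by move=> fB x /AB/fB.
by move=> [df pf]; split=> [x /AB/df|k] //; exact: IHm.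
Qed.

Lemma smooth_on_sub A B f : A `<=` B -> smooth_on B f -> smooth_on A f.
Proof. by move=> AB fB m; exact: Cn_on_sub AB (fB m). Qed.

Lemma open_eq_near A f g x : open A -> A x -> (forall y, A y -> f y = g y) ->
  \forall y \near x, f y = g y.
Proof.
move=> oA Ax fg; have : nbhs x A by exact: open_nbhs_nbhs.
by apply: filterS.
Qed.

Lemma eq_partial A f g x k : open A -> A x -> (forall y, A y -> f y = g y) ->
  partial k f x = partial k g x.
Proof. by move=> oA Ax fg; apply/near_eq_partial/(open_eq_near oA Ax). Qed.

Lemma eq_Cn_on m A f g : open A -> (forall y, A y -> f y = g y) ->
  Cn_on m A f -> Cn_on m A g.
Proof.
move=> oA; elim: m f g => [|m IHm] f g fg /=.
  move=> fc x Ax; suff : g @ x --> f x by rewrite (fg _ Ax).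
  have nfg := open_eq_near oA Ax fg.
  exact: (cvg_trans (near_eq_cvg nfg) (fc _ Ax)).
move=> [df pf]; split=> [x Ax|k].
  exact: near_eq_differentiable (open_eq_near oA Ax fg) (df _ Ax).
by apply: IHm (pf k) => x Ax; exact: eq_partial fg.
Qed.

Lemma eq_smooth_on A f g : open A -> (forall y, A y -> f y = g y) ->
  smooth_on A f -> smooth_on A g.
Proof. by move=> oA fg fA m; exact: eq_Cn_on fg (fA m). Qed.

(** The induction step of all the closure properties below: the partial
    derivatives need only be recognized as functions already known to be
    differentiable enough. *)
Lemma Cn_on_gradient m A f (F : 'I_n -> 'rV[R]_n -> R) : open A ->
  (forall x, A x -> has_gradient f x (F^~ x)) ->
  (forall k, Cn_on m A (F k)) -> Cn_on m.+1 A f.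
Proof.
move=> oA fF FA; split=> [x Ax|k]; first by case: (fF _ Ax).
by apply: eq_Cn_on (FA k) => // x Ax; case: (fF _ Ax) => _ ->.
Qed.

Lemma Cn_on0 A f : (forall x, A x -> differentiable f x) -> Cn_on 0 A f.
Proof. by move=> df x Ax; exact/differentiable_continuous/df. Qed.

Lemma Cn_onW m A f : Cn_on m.+1 A f -> Cn_on m A f.
Proof.
elim: m f => [|m IHm] f [df pf]; first exact: Cn_on0.
by split=> // k; exact: IHm.
Qed.

Lemma smooth_on_gradient A f x : smooth_on A f -> A x ->
  has_gradient f x (fun k => partial k f x).
Proof. by move=> fA Ax; split=> //; case: (fA 1) => df _; exact: df. Qed.

Lemma smooth_on_differentiable A f x : smooth_on A f -> A x ->
  differentiable f x.
Proof. by move=> fA Ax; case: (smooth_on_gradient fA Ax). Qed.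

Lemma smooth_on_partial A f k : smooth_on A f -> smooth_on A (partial k f).
Proof. by move=> fA m; case: (fA m.+1) => _; exact. Qed.

Lemma Cn_on_cst m A (a : R) : open A -> Cn_on m A (fun=> a).
Proof.
move=> oA; elim: m a => [|m IHm] a.
  by apply: Cn_on0 => x _; exact: differentiable_cst.
by apply: (@Cn_on_gradient _ _ _ (fun _ _ => 0)) => // x _; exact: gradient_cst.
Qed.

Lemma Cn_onD m A f g : open A -> Cn_on m A f -> Cn_on m A g ->
  Cn_on m A (fun y => f y + g y).
Proof.
move=> oA; elim: m f g => [|m IHm] f g.
  by move=> fc gc x Ax; apply: continuousD; [exact: fc|exact: gc].
move=> [df pf] [dg pg].
apply: (@Cn_on_gradient _ _ _ (fun k x => partial k f x + partial k g x)) => //.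
  by move=> x Ax; apply: gradientD; apply: gradient_self; [exact: df|exact: dg].
by move=> k; apply: IHm; [exact: pf|exact: pg].
Qed.

Lemma Cn_onM m A f g : open A -> Cn_on m A f -> Cn_on m A g ->
  Cn_on m A (fun y => f y * g y).
Proof.
move=> oA; elim: m f g => [|m IHm] f g.
  by move=> fc gc x Ax; apply: continuousM; [exact: fc|exact: gc].
move=> fA gA; have [df pf] := fA; have [dg pg] := gA.
apply: (@Cn_on_gradient _ _ _
  (fun k x => partial k f x * g x + f x * partial k g x)) => //.
  by move=> x Ax; apply: gradientM; apply: gradient_self; [exact: df|exact: dg].
move=> k; apply: Cn_onD => //; apply: IHm => //.
- exact: pf.
- exact: Cn_onW.
- exact: Cn_onW.
- exact: pg.
Qed.

(** Compositions are smooth once the outer derivative, composed with the inner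
    function, is of one order of differentiability less: the induction that
    closes each elementary function under composition. *)
Lemma Cn_on_comp1 m A f (phi dphi : R -> R) : open A ->
  (forall x, A x -> is_derive (f x) 1 phi (dphi (f x))) ->
  Cn_on m.+1 A f -> Cn_on m A (fun y => dphi (f y)) ->
  Cn_on m.+1 A (fun y => phi (f y)).
Proof.
move=> oA dp [df pf] dfA.
apply: (@Cn_on_gradient _ _ _ (fun k x => dphi (f x) * partial k f x)) => //.
  by move=> x Ax; apply: gradient_comp1; [exact: dp|exact/gradient_self/df].
by move=> k; apply: Cn_onM => //; exact: pf.
Qed.

Section Closure.
Variable A : set 'rV[R]_n.
Hypothesis oA : open A.

Lemma smooth_cst (a : R) : smooth_on A (fun=> a).
Proof. by move=> m; exact: Cn_on_cst. Qed.

Lemma smooth_coord j : smooth_on A (fun y => y ord0 j).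
Proof.
case=> [|m]; first by apply: Cn_on0 => x _; exact: differentiable_coord.
apply: (@Cn_on_gradient _ _ _ (fun k _ => (k == j)%:R)) => //.
  by move=> x _; exact: gradient_coord.
by move=> k; exact: smooth_cst.
Qed.

Lemma smoothD f g : smooth_on A f -> smooth_on A g ->
  smooth_on A (fun y => f y + g y).
Proof. by move=> fA gA m; exact: Cn_onD. Qed.

Lemma smoothM f g : smooth_on A f -> smooth_on A g ->
  smooth_on A (fun y => f y * g y).
Proof. by move=> fA gA m; exact: Cn_onM. Qed.

Lemma smoothN f : smooth_on A f -> smooth_on A (fun y => - f y).
Proof.
move=> fA; have := smoothM (smooth_cst (-1)) fA.
by apply: eq_smooth_on => // y _; rewrite mulN1r.
Qed.

Lemma smoothX f m : smooth_on A f -> smooth_on A (fun y => f y ^+ m).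
Proof.
move=> fA; elim: m => [|m IHm]; first exact: smooth_cst.
have := smoothM fA IHm.
by apply: eq_smooth_on => // y _; rewrite exprS.
Qed.

Lemma smooth_sum (I : finType) (F : I -> 'rV[R]_n -> R) :
  (forall i, smooth_on A (F i)) -> smooth_on A (fun y => \sum_i F i y).
Proof.
move=> FA; elim: (index_enum I) => [|i s IHs].
  by have := smooth_cst 0; apply: eq_smooth_on => // y _; rewrite big_nil.
by have := smoothD (FA i) IHs; apply: eq_smooth_on => // y _; rewrite big_cons.
Qed.

Lemma smooth_prod (I : finType) (F : I -> 'rV[R]_n -> R) :
  (forall i, smooth_on A (F i)) -> smooth_on A (fun y => \prod_i F i y).
Proof.
move=> FA; elim: (index_enum I) => [|i s IHs].
  by have := smooth_cst 1; apply: eq_smooth_on => // y _; rewrite big_nil.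
by have := smoothM (FA i) IHs; apply: eq_smooth_on => // y _; rewrite big_cons.
Qed.

Lemma smoothV f : (forall x, A x -> f x != 0) -> smooth_on A f ->
  smooth_on A (fun y => (f y)^-1).
Proof.
move=> f0 fA; elim=> [|m IHm].
  apply: Cn_on0 => x Ax; apply: differentiableV (f0 _ Ax).
  exact: smooth_on_differentiable fA Ax.
apply: (@Cn_on_gradient _ _ _ (fun k x => - ((f x)^-1 * (f x)^-1) * partial k f x)) => //.
  move=> x Ax; have := gradientV (f0 _ Ax) (smooth_on_gradient fA Ax).
  by apply: has_gradient_ext => k; rewrite expr2.
move=> k; apply: Cn_onM => //; last exact: smooth_on_partial.
apply: (@eq_Cn_on _ _ (fun y => -1 * ((f y)^-1 * (f y)^-1))) => //.
  by move=> y _; rewrite mulN1r.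
by apply: Cn_onM => //; [exact: Cn_on_cst|exact: Cn_onM].
Qed.

Lemma smooth_expR f : smooth_on A f -> smooth_on A (fun y => expR (f y)).
Proof.
move=> fA; elim=> [|m IHm].
  apply: Cn_on0 => x Ax.
  by case: (gradient_expR (smooth_on_gradient fA Ax)).
by apply: (@Cn_on_comp1 _ _ _ _ expR) => // x _; exact: is_derive_expR.
Qed.

Lemma smooth_ln f : (forall x, A x -> 0 < f x) -> smooth_on A f ->
  smooth_on A (fun y => ln (f y)).
Proof.
move=> f0 fA [|m].
  apply: Cn_on0 => x Ax.
  by case: (gradient_ln (f0 _ Ax) (smooth_on_gradient fA Ax)).
apply: (@Cn_on_comp1 _ _ _ _ (fun t => t^-1)) => //.
  by move=> x Ax; apply: is_derive1_ln; exact: f0.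
by apply: smoothV => // x /f0/lt0r_neq0.
Qed.

Lemma smooth_atan f : smooth_on A f -> smooth_on A (fun y => atan (f y)).
Proof.
move=> fA [|m].
  apply: Cn_on0 => x Ax.
  by case: (gradient_atan (smooth_on_gradient fA Ax)).
apply: (@Cn_on_comp1 _ _ _ _ (fun t => (1 + t ^+ 2)^-1)) => //.
apply: smoothV => [x Ax|]; first by rewrite lt0r_neq0// ltr_pwDl// sqr_ge0.
by apply: smoothD; [exact: smooth_cst|exact: smoothX].
Qed.

Lemma smooth_cos_sin f : smooth_on A f ->
  smooth_on A (fun y => cos (f y)) /\ smooth_on A (fun y => sin (f y)).
Proof.
move=> fA; have fg x : A x -> has_gradient f x (fun k => partial k f x).
  exact: smooth_on_gradient.
suff H m : Cn_on m A (fun y => cos (f y)) /\ Cn_on m A (fun y => sin (f y)).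
  by split=> m; case: (H m).
elim: m => [|m [IHc IHs]].
  by split; apply: Cn_on0 => x /fg h;
    [case: (gradient_cos h)|case: (gradient_sin h)].
split; last by apply: (@Cn_on_comp1 _ _ _ _ cos) => // x _; exact: is_derive_sin.
apply: (@Cn_on_comp1 _ _ _ _ (fun t => - sin t)) => //.
have := Cn_onM oA (Cn_on_cst m (-1) oA) IHs.
by apply: eq_Cn_on => // y _; rewrite mulN1r.
Qed.

End Closure.

End Smoothness.

Lemma smooth_comp (R : realType) (n p : nat) (A : set 'rV[R]_n)
    (B : set 'rV[R]_p) (f : 'rV[R]_p -> R) (g : 'rV[R]_n -> 'rV[R]_p) :
  open A -> smooth_map_on A g -> (forall x, A x -> B (g x)) -> smooth_on B f ->
  smooth_on A (fun y => f (g y)).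
Proof.
move=> oA gA gB fB m; elim: m f fB => [|m IHm] f fB.
  apply: Cn_on0 => x Ax; apply: (@differentiable_comp _ _ _ _ g f).
    by apply: differentiable_rV => k; exact: smooth_on_differentiable (gA k) Ax.
  exact: smooth_on_differentiable fB (gB _ Ax).
apply: (@Cn_on_gradient _ _ _ _ _
  (fun k x => \sum_j partial j f (g x) * partial k (fun y => g y ord0 j) x)) => //.
  move=> x Ax; apply: gradient_comp (smooth_on_gradient fB (gB _ Ax)) _ => j.
  exact: smooth_on_gradient (gA j) Ax.
move=> k; elim: (index_enum 'I_p) => [|j s IHs].
  by apply: eq_Cn_on (Cn_on_cst m 0 oA) => // y _; rewrite big_nil.
have : Cn_on m A (fun y => partial j f (g y) * partial k (fun y => g y ord0 j) y).
  apply: Cn_onM => //; first by apply: IHm; exact: smooth_on_partial.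
  exact: smooth_on_partial (gA j) _.
move=> /(Cn_onD oA)/(_ IHs); apply: eq_Cn_on => // y _.
by rewrite big_cons.
Qed.

Lemma smooth_map_differentiable (R : realType) (n p : nat) (A : set 'rV[R]_n)
    (f : 'rV[R]_n -> 'rV[R]_p) x :
  smooth_map_on A f -> A x -> differentiable f x.
Proof.
move=> fA Ax; apply: differentiable_rV => k.
exact: smooth_on_differentiable (fA k) Ax.
Qed.

(** * Symmetry of second derivatives *)

Section Schwarz.
Variables (R : realType) (n : nat).
Implicit Types (f : 'rV[R]_n -> R) (x v : 'rV[R]_n) (A : set 'rV[R]_n).

Lemma is_derive_line f x v (s : R) : differentiable f (s *: v + x) ->
  is_derive s 1 (fun t : R => f (t *: v + x)) ('D_v f (s *: v + x)).
Proof.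
move=> df; have dg : is_diff s (fun t : R => t *: v + x) (fun t => t *: v).
  have := is_diffD (is_diff_scalel s v) (is_diff_cst x s).
  by rewrite addr0.
have gd : differentiable (fun t : R => t *: v + x) s by case: dg.
have dfg : differentiable (f \o (fun t : R => t *: v + x)) s.
  exact: differentiable_comp.
apply: DeriveDef; first exact/derivable1_diffP.
rewrite (deriveE _ dfg) diff_comp//=.
by rewrite diff_val scale1r -deriveE.
Qed.

Let e i : 'rV[R]_n := delta_mx ord0 i.

(** Both iterated partial derivatives are, at nearby points, the normalized
    second difference of [f] over a small square: two applications of the mean
    value theorem, one in each direction. *)
Lemma second_difference A f x i j (h : R) : smooth_on A f -> 0 <= h ->
  (forall s t, 0 <= s <= h -> 0 <= t <= h -> A (s *: e i + (t *: e j + x))) ->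
  exists c d, [/\ 0 <= c <= h, 0 <= d <= h &
    f (h *: e i + (h *: e j + x)) - f (h *: e i + x) - (f (h *: e j + x) - f x)
    = partial j (partial i f) (d *: e j + (c *: e i + x)) * h * h].
Proof.
move=> fA h0 hA.
have hA' s t : 0 <= s <= h -> 0 <= t <= h -> A (t *: e j + (s *: e i + x)).
  by move=> hs ht; rewrite addrCA; exact: hA.
have d0 s : 0 <= s <= h -> is_derive s 1
    (fun s => f (s *: e i + (h *: e j + x)) - f (s *: e i + x))
    (partial i f (s *: e i + (h *: e j + x)) - partial i f (s *: e i + x)).
  move=> sh; apply: is_deriveB; apply: is_derive_line;
    apply: smooth_on_differentiable fA _; first by apply: hA; rewrite ?lexx ?h0.
  by have := hA _ 0 sh; rewrite scale0r add0r; apply; rewrite lexx h0.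
have sub s : s \in `]0, h[ -> 0 <= s <= h.
  by rewrite in_itv /= => /andP[/ltW -> /ltW ->].
have cont (g dg : R -> R) : (forall s, 0 <= s <= h -> is_derive s 1 g (dg s)) ->
    {within `[0, h], continuous g}.
  move=> gd; apply: derivable_within_continuous => s; rewrite in_itv /=.
  by move=> /gd[].
have [c ch] := MVT_segment h0 (fun s hs => d0 s (sub s hs)) (cont _ _ d0).
rewrite !scale0r !add0r subr0 in_itv /= in ch * => ->.
have d1 t : 0 <= t <= h -> is_derive t 1
    (fun t => partial i f (t *: e j + (c *: e i + x)))
    (partial j (partial i f) (t *: e j + (c *: e i + x))).
  move=> th; apply: is_derive_line.
  by apply: smooth_on_differentiable (smooth_on_partial i fA) _; exact: hA'.
have [d dh] := MVT_segment h0 (fun s hs => d1 s (sub s hs)) (cont _ _ d1).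
rewrite scale0r add0r subr0 in_itv /= in dh * => dE.
by exists c, d; split=> //; rewrite addrCA dE.
Qed.

(** Schwarz's theorem: the second difference is symmetric in the two directions,
    and the two partial derivatives that it equals tend to their values at [x]. *)
Lemma partial_comm A f x i j : open A -> A x -> smooth_on A f ->
  partial i (partial j f) x = partial j (partial i f) x.
Proof.
move=> oA Ax fA; apply/eqP; rewrite -subr_eq0 -normr_le0.
apply/ler_addgt0Pr => _/posnumP[eps]; rewrite add0r.
have cont k l : \forall y \near x,
    `|partial k (partial l f) x - partial k (partial l f) y| < eps%:num / 2.
  have : {for x, continuous (partial k (partial l f))}.
    apply: differentiable_continuous; apply: smooth_on_differentiable Ax.
    exact/smooth_on_partial/smooth_on_partial.
  by move=> /cvgrPdist_lt; apply.
have nA : \forall y \near x, A y by exact: open_nbhs_nbhs.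
have [r /= r0 rP] := (nbhs_normP _ _).1 (filterI nA (filterI (cont i j) (cont j i))).
have [h h0 h3] : exists2 h : R, 0 < h & h * 3 = r.
  by exists (r / 3); [rewrite divr_gt0|rewrite divfK].
have hP s t k l : 0 <= s <= h -> 0 <= t <= h ->
    `|x - (s *: e k + (t *: e l + x))| < r.
  move=> /andP[s0 sh] /andP[t0 th].
  have le1 m : `|e m| <= 1.
    rewrite [leLHS]/Num.Def.normr /= mx_normrE; apply: bigmax_le => // a _.
    by rewrite mxE; case: (_ && _); rewrite ?normr1 ?normr0.
  rewrite addrA [_ + x]addrC opprD addNKr normrN.
  apply: le_lt_trans (ler_normD _ _) _; rewrite !normrZ !ger0_norm//.
  apply: (@le_lt_trans _ _ (h * 1 + h * 1)).
    by apply: lerD; apply: ler_pM.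
  by rewrite -h3; lra.
have [|c [d [ch dh E1]]] := @second_difference A f x i j h fA (ltW h0).
  by move=> s t sh th; case: (rP _ (hP s t i j sh th)).
have [|c' [d' [ch' dh' E2]]] := @second_difference A f x j i h fA (ltW h0).
  by move=> s t sh th; case: (rP _ (hP s t j i sh th)).
have [_ [_ b1]] := rP _ (hP _ _ j i dh ch).
have [_ [b2 _]] := rP _ (hP _ _ i j dh' ch').
have tri (a b X Y : R) : X * h * h = Y * h * h ->
    `|b - X| < eps%:num / 2 -> `|a - Y| < eps%:num / 2 -> `|a - b| <= eps%:num.
  move=> /(mulIf (lt0r_neq0 h0)) /(mulIf (lt0r_neq0 h0)) -> bY aY.
  rewrite (splitr eps%:num) -[a](subrK Y) -addrA.
  by rewrite (le_trans (ler_normD _ _))// lerD ?ltW// distrC.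
have E : f (h *: e i + (h *: e j + x)) - f (h *: e i + x) - (f (h *: e j + x) - f x)
    = f (h *: e j + (h *: e i + x)) - f (h *: e j + x) - (f (h *: e i + x) - f x).
  rewrite [h *: e j + (h *: e i + x)]addrCA !opprB addrACA [RHS]addrACA.
  by congr (_ + _); rewrite addrC.
exact: tri (etrans (esym E1) (etrans E E2)) b1 b2.
Qed.

End Schwarz.

(** * Entries of matrix expressions *)

(* Rewriting with [mxE] would also expand the matrices of partial derivatives
   and of connection coefficients defined below. *)
Section Entries.
Variable R : realType.

Lemma entry_add p q (M N : 'M[R]_(p, q)) k l : (M + N) k l = M k l + N k l.
Proof. by rewrite mxE. Qed.

Lemma entry_sub p q (M N : 'M[R]_(p, q)) k l : (M - N) k l = M k l - N k l.
Proof. by rewrite !mxE. Qed.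

Lemma entry_scale p q a (M : 'M[R]_(p, q)) k l : (a *: M) k l = a * M k l.
Proof. by rewrite mxE. Qed.

Lemma entry_mul p q r (M : 'M[R]_(p, q)) (N : 'M[R]_(q, r)) k l :
  (M *m N) k l = \sum_m M k m * N m l.
Proof. by rewrite mxE. Qed.

End Entries.

(** * Levi-Civita connections *)

(* These matrices are locked: comparing two partial derivatives by unfolding
   them is out of reach of the unifier. *)
HB.lock Definition partial_mx (R : realType) (n p q : nat) (k : 'I_n)
    (F : 'rV[R]_n -> 'M[R]_(p, q)) (x : 'rV[R]_n) : 'M[R]_(p, q) :=
  \matrix_(a, b) partial k (fun y => F y a b) x.

Lemma partial_mxE (R : realType) (n p q : nat) (k : 'I_n)
    (F : 'rV[R]_n -> 'M[R]_(p, q)) x a b :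
  partial_mx k F x a b = partial k (fun y => F y a b) x.
Proof. by rewrite partial_mx.unlock mxE. Qed.

HB.lock Definition connection (R : realType) (n : nat)
    (g : 'rV[R]_n -> 'M[R]_n) (i : 'I_n) (x : 'rV[R]_n) : 'M[R]_n :=
  \matrix_(j, k) christoffel g i j k x.

Lemma connectionE (R : realType) (n : nat) (g : 'rV[R]_n -> 'M[R]_n) i x j k :
  connection g i x j k = christoffel g i j k x.
Proof. by rewrite connection.unlock mxE. Qed.

HB.lock Definition curvature_mx (R : realType) (n : nat)
    (g : 'rV[R]_n -> 'M[R]_n) (i j : 'I_n) (x : 'rV[R]_n) : 'M[R]_n :=
  \matrix_(k, l) riemann g i j k l x.

Lemma curvature_mxE (R : realType) (n : nat) (g : 'rV[R]_n -> 'M[R]_n) i j x k l :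
  curvature_mx g i j x k l = riemann g i j k l x.
Proof. by rewrite curvature_mx.unlock mxE. Qed.

Section MatrixFunctions.
Variables (R : realType) (n : nat).
Implicit Types (x : 'rV[R]_n) (A : set 'rV[R]_n).

Definition smooth_mx p q A (F : 'rV[R]_n -> 'M[R]_(p, q)) :=
  forall a b, smooth_on A (fun y => F y a b).

Lemma eq_partial_mx p q A (F G : 'rV[R]_n -> 'M[R]_(p, q)) x k :
  open A -> A x -> (forall y, A y -> F y = G y) ->
  partial_mx k F x = partial_mx k G x.
Proof.
move=> oA Ax FG; apply/matrixP => a b; rewrite !partial_mxE.
by apply: (eq_partial k oA Ax) => y Ay; rewrite FG.
Qed.

Lemma eq_smooth_mx p q A (F G : 'rV[R]_n -> 'M[R]_(p, q)) :
  open A -> (forall y, A y -> F y = G y) -> smooth_mx A F -> smooth_mx A G.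
Proof.
move=> oA FG FA a b; apply: (eq_smooth_on oA) (FA a b) => y Ay.
by rewrite FG.
Qed.

Section Rules.
Variable A : set 'rV[R]_n.
Hypothesis oA : open A.

Lemma smooth_mxM p q r (F : 'rV[R]_n -> 'M[R]_(p, q))
    (G : 'rV[R]_n -> 'M[R]_(q, r)) :
  smooth_mx A F -> smooth_mx A G -> smooth_mx A (fun y => F y *m G y).
Proof.
move=> FA GA a b.
have := smooth_sum oA (fun c => smoothM oA (FA a c) (GA c b)).
by apply: eq_smooth_on => // y _; rewrite mxE.
Qed.

Lemma smooth_mxT p q (F : 'rV[R]_n -> 'M[R]_(p, q)) :
  smooth_mx A F -> smooth_mx A (fun y => (F y)^T).
Proof.
by move=> FA a b; apply: eq_smooth_on (FA b a) => // y _; rewrite mxE.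
Qed.

Lemma smooth_mx_sum p q (I : finType) (F : I -> 'rV[R]_n -> 'M[R]_(p, q)) :
  (forall i, smooth_mx A (F i)) -> smooth_mx A (fun y => \sum_i F i y).
Proof.
move=> FA a b; have := smooth_sum oA (fun i => FA i a b).
by apply: eq_smooth_on => // y _; rewrite summxE.
Qed.

Lemma smooth_mxZ p q (f : 'rV[R]_n -> R) (F : 'rV[R]_n -> 'M[R]_(p, q)) :
  smooth_on A f -> smooth_mx A F -> smooth_mx A (fun y => f y *: F y).
Proof.
move=> fA FA a b; have := smoothM oA fA (FA a b).
by apply: eq_smooth_on => // y _; rewrite mxE.
Qed.

Lemma smooth_det p (F : 'rV[R]_n -> 'M[R]_p) :
  smooth_mx A F -> smooth_on A (fun y => \det (F y)).
Proof.
move=> FA; have cst (a : R) := smooth_cst oA a.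
by apply: smooth_sum => // s; apply: smoothM => //; exact: smooth_prod.
Qed.

(** Cramer's rule: the inverse is the adjugate over the determinant. *)
Lemma smooth_invmx p (F : 'rV[R]_n -> 'M[R]_p) :
  (forall x, A x -> F x \in unitmx) -> smooth_mx A F ->
  smooth_mx A (fun y => invmx (F y)).
Proof.
move=> FU FA.
apply: (@eq_smooth_mx _ _ A (fun y => (\det (F y))^-1 *: \adj (F y))) => //.
  by move=> y Ay; rewrite /invmx FU.
apply: smooth_mxZ.
  apply: smoothV => // [x Ax|]; last exact: smooth_det.
  by rewrite -unitfE; exact: FU.
move=> a b; have : smooth_on A (fun y => (-1) ^+ (b + a) *
    \det (\matrix_(i, j) F y (lift b i) (lift a j))).
  apply: smoothM => //; first exact: smooth_cst.
  apply: smooth_det => i j.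
  by apply: eq_smooth_on (FA (lift b i) (lift a j)) => // y _; rewrite mxE.
apply: eq_smooth_on => // y _; rewrite mxE /cofactor; congr (_ * \det _).
by apply/matrixP => i j; rewrite !mxE.
Qed.

Lemma smooth_partial_mx p q k (F : 'rV[R]_n -> 'M[R]_(p, q)) :
  smooth_mx A F -> smooth_mx A (partial_mx k F).
Proof.
move=> FA a b; apply: eq_smooth_on (smooth_on_partial k (FA a b)) => // y _.
by rewrite partial_mxE.
Qed.

Lemma partial_mxD p q k (F G : 'rV[R]_n -> 'M[R]_(p, q)) x :
  smooth_mx A F -> smooth_mx A G -> A x ->
  partial_mx k (fun y => F y + G y) x = partial_mx k F x + partial_mx k G x.
Proof.
move=> FA GA Ax; apply/matrixP => a b; rewrite entry_add !partial_mxE.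
have [_ <-] := gradientD (smooth_on_gradient (FA a b) Ax)
                         (smooth_on_gradient (GA a b) Ax).
by apply: (eq_partial k oA Ax) => y _; rewrite mxE.
Qed.

Lemma partial_mxM p q r k (F : 'rV[R]_n -> 'M[R]_(p, q))
    (G : 'rV[R]_n -> 'M[R]_(q, r)) x :
  smooth_mx A F -> smooth_mx A G -> A x ->
  partial_mx k (fun y => F y *m G y) x
  = partial_mx k F x *m G x + F x *m partial_mx k G x.
Proof.
move=> FA GA Ax; apply/matrixP => a b.
rewrite partial_mxE entry_add !entry_mul -big_split /=.
have [_ H] := gradient_sum (fun c => gradientM
  (smooth_on_gradient (FA a c) Ax) (smooth_on_gradient (GA c b) Ax)).
transitivity (partial k (fun y => \sum_c F y a c * G y c b) x).
  by apply: (eq_partial k oA Ax) => y _; rewrite mxE.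
by rewrite H; apply: eq_bigr => c _; rewrite !partial_mxE.
Qed.

Lemma partial_mxT p q k (F : 'rV[R]_n -> 'M[R]_(p, q)) x :
  partial_mx k (fun y => (F y)^T) x = (partial_mx k F x)^T.
Proof.
apply/matrixP => a b; rewrite partial_mxE [RHS]mxE partial_mxE.
by congr (partial k _ x); apply/funext => y; exact: mxE.
Qed.

End Rules.

Lemma partial_mx_comm p q A (F : 'rV[R]_n -> 'M[R]_(p, q)) x i j :
  open A -> A x -> smooth_mx A F ->
  partial_mx i (partial_mx j F) x = partial_mx j (partial_mx i F) x.
Proof.
move=> oA Ax FA.
have pE k l a b : partial_mx k (partial_mx l F) x a b
    = partial k (partial l (fun y => F y a b)) x.
  by rewrite partial_mxE; congr (partial k _ x); apply/funext => y; rewrite partial_mxE.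
apply/matrixP => a b; apply: etrans (pE i j a b) _.
exact: etrans (partial_comm i j oA Ax (FA a b)) (esym (pE j i a b)).
Qed.

End MatrixFunctions.

Section LeviCivita.
Variables (R : realType) (n : nat).
Implicit Types (g : 'rV[R]_n -> 'M[R]_n) (x : 'rV[R]_n) (A : set 'rV[R]_n).

Definition metric_on A g :=
  [/\ smooth_mx A g, forall x, A x -> (g x)^T = g x
    & forall x, A x -> g x \in unitmx].

(** Cartan's structure equation for the matrices of the connection. *)
Lemma curvature_structure g i j x : curvature_mx g i j x =
  partial_mx i (connection g j) x - partial_mx j (connection g i) x
  + (connection g j x *m connection g i x - connection g i x *m connection g j x).
Proof.
have pE a b k l : partial_mx a (connection g b) x k l
    = partial a (christoffel g b k l) x.
  by rewrite partial_mxE; congr (partial a _ x); apply/funext => y; rewrite connectionE.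
apply/matrixP => k l; rewrite curvature_mxE [RHS]entry_add.
rewrite [X in _ = X + _]entry_sub [X in _ = _ + X]entry_sub.
rewrite [X in _ = _ + (X - _)]entry_mul [X in _ = _ + (_ - X)]entry_mul.
rewrite [X in _ = X - _ + _]pE [X in _ = _ - X + _]pE; congr (_ + _).
rewrite -sumrB; apply: eq_bigr => m _.
by rewrite !connectionE mulrC [christoffel g i k m x * _]mulrC.
Qed.

(** The fundamental theorem of Riemannian geometry, uniqueness part: the Koszul
    formula recovers a torsion-free metric connection from the metric. *)
Lemma connection_unique g x (G : 'I_n -> 'M[R]_n) :
  (g x)^T = g x -> g x \in unitmx ->
  (forall i, partial_mx i g x = G i *m g x + (G i *m g x)^T) ->
  (forall i j k, G i j k = G j i k) ->
  forall i, connection g i x = G i.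
Proof.
move=> gs gU dgx Gs i.
pose S i := G i *m g x.
have SC a b c : S a b c = S b a c.
  by rewrite !entry_mul; apply: eq_bigr => k _; rewrite Gs.
have dgE a b c : partial a (fun y => g y b c) x = S a b c + S a c b.
  have := congr1 (fun M : 'M[R]_n => M b c) (dgx a).
  by rewrite partial_mxE entry_add [(_^T)%R b c]mxE.
suff -> : connection g i x = S i *m (invmx (g x))^T.
  by rewrite /S trmx_inv gs mulmxK.
apply/matrixP => j k; rewrite connectionE [RHS]mxE /christoffel mulr_sumr.
apply: eq_bigr => l _; rewrite !dgE [(_^T)%R l k]mxE.
rewrite (SC j i l) (SC l i j) (SC l j i).
by field.
Qed.

Lemma connection_metric A g x i : open A -> metric_on A g -> A x ->
  partial_mx i g x = connection g i x *m g x + (connection g i x *m g x)^T.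
Proof.
move=> oA [_ gs gU] Ax.
have dgs a b c : partial a (fun y => g y b c) x = partial a (fun y => g y c b) x.
  by apply: (eq_partial a oA Ax) => y Ay; rewrite -[in LHS](gs _ Ay) mxE.
pose D := \matrix_(j, l) (2^-1 * (partial i (fun y => g y j l) x
  + partial j (fun y => g y i l) x - partial l (fun y => g y i j) x)).
have -> : connection g i x *m g x = D.
  have -> : connection g i x = D *m invmx (g x).
    apply/matrixP => j k; rewrite connectionE mxE /christoffel mulr_sumr.
    apply: eq_bigr => l _; rewrite mxE -[in LHS](gs _ Ax) -trmx_inv mxE.
    by rewrite mulrCA mulrC.
  by rewrite mulmxKV// gU.
apply/matrixP => j l; rewrite partial_mxE !mxE (dgs i l j).
by field.
Qed.

Lemma connection_torsion_free A g x i j k : open A -> metric_on A g -> A x ->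
  connection g i x j k = connection g j x i k.
Proof.
move=> oA [_ gs gU] Ax; rewrite !connectionE /christoffel; congr (_ * _).
apply: eq_bigr => l _; congr (_ * (_ - _)); first by rewrite addrC.
by apply: (eq_partial l oA Ax) => y Ay; rewrite -[in LHS](gs _ Ay) mxE.
Qed.

Lemma smooth_connection A g i : open A -> metric_on A g ->
  smooth_mx A (connection g i).
Proof.
move=> oA [gA gs gU] j k.
have cst (a : R) := smooth_cst oA a.
have giA := smooth_invmx oA gU gA.
have : smooth_on A (fun x => 2^-1 * \sum_l invmx (g x) k l *
    (partial i (fun y => g y j l) x + partial j (fun y => g y i l) x
     + - partial l (fun y => g y i j) x)).
  apply: smoothM => //; apply: smooth_sum => // l; apply: smoothM => //.
  apply: smoothD => //; last exact/smoothN/smooth_on_partial.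
  by apply: smoothD => //; exact: smooth_on_partial.
by apply: eq_smooth_on => // y _; rewrite connectionE.
Qed.

Definition ricci_mx g x : 'M[R]_n := \matrix_(j, k) ricci g j k x.

Lemma ricci_mxE g x j k : ricci_mx g x j k = \sum_i curvature_mx g i j x k i.
Proof. by rewrite mxE; apply: eq_bigr => i _; rewrite curvature_mxE. Qed.

Lemma scalar_curvatureE g x :
  scalar_curvature g x = \tr (invmx (g x) *m (ricci_mx g x)^T).
Proof.
apply: eq_bigr => j _; rewrite [RHS]mxE; apply: eq_bigr => k _.
by rewrite [(_^T)%R k j]mxE [ricci_mx _ _ _ _]mxE.
Qed.

End LeviCivita.

(** * Isometries preserve the scalar curvature *)

(** The Jacobian matrix, with entries given as partial derivatives. *)
HB.lock Definition frame_mx (R : realType) (n p : nat)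
    (f : 'rV[R]_n -> 'rV[R]_p) (x : 'rV[R]_n) : 'M[R]_(n, p) :=
  \matrix_(i, a) partial i (fun y => f y ord0 a) x.

Lemma frame_mxE (R : realType) (n p : nat) (f : 'rV[R]_n -> 'rV[R]_p) x i a :
  frame_mx f x i a = partial i (fun y => f y ord0 a) x.
Proof. by rewrite frame_mx.unlock mxE. Qed.

Lemma jacobianE (R : realType) (n p : nat) (f : 'rV[R]_n -> 'rV[R]_p) x :
  differentiable f x -> jacobian f x = frame_mx f x.
Proof.
move=> df; apply/row_matrixP => i.
rewrite rowE -deriveEjacobian// derive_mx; last exact: diff_derivable.
by apply/rowP => a; rewrite frame_mx.unlock !mxE.
Qed.

Section Isometry.
Variables (R : realType) (n : nat) (A B : set 'rV[R]_n).
Variables (g h : 'rV[R]_n -> 'M[R]_n) (f : 'rV[R]_n -> 'rV[R]_n).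
Hypotheses (oA : open A) (oB : open B) (fA : smooth_map_on A f).
Hypotheses (fAB : forall z, A z -> B (f z)).
Hypotheses (gA : metric_on A g) (hB : metric_on B h).

Notation J := (frame_mx f).

Hypothesis isom : forall z, A z -> J z *m h (f z) *m (J z)^T = g z.

Let J_smooth : smooth_mx A J.
Proof.
move=> i a; apply: eq_smooth_on (smooth_on_partial i (fA a)) => // y _.
by rewrite frame_mxE.
Qed.

Let J_unit z : A z -> J z \in unitmx.
Proof.
move=> Az; have [_ _ /(_ z Az)] := gA.
by rewrite -isom// !unitmx_mul => /andP[/andP[]].
Qed.

Let J_comm z i j c : A z -> partial_mx i J z j c = partial_mx j J z i c.
Proof.
have pE k l : partial_mx k J z l c
    = partial k (partial l (fun y => f y ord0 c)) z.
  rewrite partial_mxE; congr (partial k _ z); apply/funext => y.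
  exact: frame_mxE.
move=> Az; apply: etrans (pE i j) (etrans _ (esym (pE j i))).
exact: partial_comm i j oA Az (fA c).
Qed.

Let smooth_mx_comp (F : 'rV[R]_n -> 'M[R]_n) :
  smooth_mx B F -> smooth_mx A (fun y => F (f y)).
Proof. by move=> FB a b; exact: smooth_comp oA fA fAB (FB a b). Qed.

Let partial_mx_comp (F : 'rV[R]_n -> 'M[R]_n) z i : smooth_mx B F -> A z ->
  partial_mx i (fun y => F (f y)) z
  = \sum_a J z i a *: partial_mx a F (f z).
Proof.
move=> FB Az; apply/matrixP => b c; rewrite partial_mxE summxE.
have [_ ->] := gradient_comp (smooth_on_gradient (FB b c) (fAB Az))
  (fun a => smooth_on_gradient (fA a) Az).
apply: eq_bigr => a _.
by rewrite entry_scale partial_mxE frame_mxE [LHS]mulrC.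
Qed.

(** The connection of [h] along the image under [f] of the [i]-th direction. *)
Let T i z := \sum_a J z i a *: connection h a (f z).

Let T_smooth i : smooth_mx A (T i).
Proof.
apply: smooth_mx_sum => // a; apply: (smooth_mxZ oA (J_smooth i a)).
exact: smooth_mx_comp (smooth_connection a oB hB).
Qed.

(** The change of frame [J] acts on the connection matrices as a gauge
    transformation.  The right-hand side divided by [J] is a torsion-free metric
    connection of [g], hence the Levi-Civita connection. *)
Lemma connection_isometry z i : A z ->
  connection g i z *m J z = partial_mx i J z + J z *m T i z.
Proof.
move=> Az; have JU := J_unit Az; have [_ gs gU] := gA; have [hs hsym _] := hB.
have hfA := smooth_mx_comp hs.
pose X k := partial_mx k J z + J z *m T k z.
suff -> : connection g i z = X i *m invmx (J z) by rewrite mulmxKV.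
move: i; apply: connection_unique; [exact: gs|exact: gU| |].
- move=> i; rewrite -mulmxA.
  have -> : X i *m (invmx (J z) *m g z) = X i *m (h (f z) *m (J z)^T).
    by rewrite -isom// -!mulmxA mulKmx.
  transitivity (partial_mx i (fun y => J y *m h (f y) *m (J y)^T) z).
    by apply: (eq_partial_mx i oA Az) => y Ay; rewrite isom.
  rewrite (partial_mxM oA i (smooth_mxM oA J_smooth hfA) (smooth_mxT oA J_smooth) Az).
  rewrite (partial_mxM oA i J_smooth hfA Az) partial_mxT.
  have -> : partial_mx i (fun y => h (f y)) z
      = T i z *m h (f z) + (T i z *m h (f z))^T.
    rewrite (partial_mx_comp i hs Az) /T mulmx_suml linear_sum -big_split /=.
    apply: eq_bigr => a _.
    rewrite (connection_metric a oB hB (fAB Az)) -scalemxAl linearZ /=.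
    by rewrite -scalerDr.
  have trD (M N : 'M[R]_n) : (M + N)^T = M^T + N^T.
    by apply/matrixP => a b; rewrite !mxE.
  rewrite /X !mulmxDl mulmxDr !trD !trmx_mul !mulmxDl -!mulmxA trmxK.
  rewrite hsym; last exact: fAB.
  by rewrite !addrA; exact: addrAC.
- have XE k l c : X k l c = partial_mx k J z l c
      + \sum_b \sum_a J z l b * J z k a * connection h a (f z) b c.
    rewrite [LHS]entry_add entry_mul; congr (_ + _); apply: eq_bigr => b _.
    rewrite summxE mulr_sumr; apply: eq_bigr => a _.
    by rewrite entry_scale mulrA.
  have XC i j c : X i j c = X j i c.
    rewrite [LHS]XE [RHS]XE [X in X + _](J_comm i j c Az) [X in _ + X]exchange_big.
    congr (_ + _).
    apply: eq_bigr => a _; apply: eq_bigr => b _.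
    rewrite (connection_torsion_free _ _ _ oB hB (fAB Az)).
    by rewrite [J z j b * _]mulrC.
  move=> i j k; rewrite entry_mul [RHS]entry_mul.
  by under eq_bigr do rewrite XC.
Qed.

Let curvature_pullback i j z := \sum_a \sum_b
  (J z i a * J z j b) *: curvature_mx h a b (f z).

(** The curvature of the connection [T] is that of [h] pulled back: the terms [W],
    which differentiate [J], are symmetric in the two directions and cancel. *)
Let partial_T z i j : A z ->
  partial_mx i (T j) z - partial_mx j (T i) z
  + (T j z *m T i z - T i z *m T j z) = curvature_pullback i j z.
Proof.
move=> Az; have cB a := smooth_connection a oB hB.
pose W k l := \sum_a partial_mx k J z l a *: connection h a (f z).
pose P a b := partial_mx a (connection h b) (f z)
  + connection h b (f z) *m connection h a (f z).
pose Q k l := \sum_a \sum_b (J z k a * J z l b) *: P a b.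
have dT k l : partial_mx k (T l) z + T l z *m T k z = W k l + Q k l.
  have -> : partial_mx k (T l) z = W k l + \sum_a \sum_b (J z k a * J z l b) *:
      partial_mx a (connection h b) (f z).
    rewrite exchange_big -big_split /=; apply/matrixP => c d.
    have [_ H] := gradient_sum (fun a => gradientM (smooth_on_gradient
      (J_smooth l a) Az) (smooth_on_gradient (smooth_mx_comp (cB a) c d) Az)).
    rewrite partial_mxE summxE.
    transitivity (partial k (fun y => \sum_a J y l a * connection h a (f y) c d) z).
      apply: (eq_partial k oA Az) => y _.
      by rewrite summxE; apply: eq_bigr => a _; rewrite entry_scale.
    rewrite H; apply: eq_bigr => a _; rewrite entry_add entry_scale; congr (_ + _).
      by rewrite partial_mxE.
    have := congr1 (fun M : 'M[R]_n => M c d) (partial_mx_comp k (cB a) Az).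
    rewrite [LHS]partial_mxE => ->; rewrite !summxE mulr_sumr; apply: eq_bigr => b _.
    by rewrite !entry_scale mulrA [J z l a * _]mulrC.
  have -> : T l z *m T k z = \sum_a \sum_b (J z k a * J z l b) *:
      (connection h b (f z) *m connection h a (f z)).
    rewrite exchange_big mulmx_suml; apply: eq_bigr => b _.
    rewrite mulmx_sumr; apply: eq_bigr => a _.
    by rewrite -scalemxAl -scalemxAr scalerA mulrC.
  rewrite -addrA; congr (_ + _); rewrite -big_split; apply: eq_bigr => a _.
  by rewrite -big_split; apply: eq_bigr => b _; rewrite scalerDr.
have WC : W i j = W j i.
  by apply: eq_bigr => a _; rewrite (J_comm i j a Az).
have -> : curvature_pullback i j z = Q i j - Q j i.
  rewrite [Q j i]exchange_big -sumrB; apply: eq_bigr => a _.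
  rewrite -sumrB; apply: eq_bigr => b _.
  rewrite [J z j b * _]mulrC -scalerBr; congr (_ *: _).
  by rewrite curvature_structure /P opprD addrACA.
rewrite addrACA -opprD [X in _ - X]addrC.
rewrite -[T i z *m T j z + _]addrC.
have [Qij Qji] : Q i j = partial_mx i (T j) z + T j z *m T i z - W i j
    /\ Q j i = partial_mx j (T i) z + T i z *m T j z - W j i.
  by rewrite !dT ![W _ _ + _]addrC !addrK.
by rewrite Qij Qji WC opprB addrA subrK.
Qed.

(** Differentiating the gauge law and antisymmetrizing, the second derivatives
    of [J] cancel and the curvature is conjugated by [J]. *)
Lemma curvature_isometry z i j : A z ->
  curvature_mx g i j z *m J z = J z *m curvature_pullback i j z.
Proof.
move=> Az; have cA k := smooth_connection k oA gA.
have law k y (Ay : A y) := connection_isometry k Ay.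
have dlaw k l : partial_mx k (connection g l) z *m J z
      + connection g l z *m partial_mx k J z
    = partial_mx k (partial_mx l J) z
      + (partial_mx k J z *m T l z + J z *m partial_mx k (T l) z).
  rewrite -(partial_mxM oA k (cA l) J_smooth Az).
  rewrite -(partial_mxM oA k J_smooth (T_smooth l) Az).
  rewrite -(partial_mxD oA k (smooth_partial_mx oA l J_smooth)
             (smooth_mxM oA J_smooth (T_smooth l)) Az).
  by apply: (eq_partial_mx k oA Az) => y; exact: law.
rewrite -(partial_T i j Az) curvature_structure.
have Jd k : partial_mx k J z = connection g k z *m J z - J z *m T k z.
  by rewrite (law k z Az) addrK.
have dG k l : partial_mx k (connection g l) z *m J z
    = partial_mx k (partial_mx l J) z
      + ((connection g k z *m J z - J z *m T k z) *m T l z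
         + J z *m partial_mx k (T l) z)
      - connection g l z *m (connection g k z *m J z - J z *m T k z).
  by rewrite -Jd -dlaw addrK.
rewrite !mulmxDl !mulNmx !mulmxDr !mulmxN !dG (partial_mx_comm i j oA Az J_smooth).
rewrite !mulmxBl !mulmxBr -!mulmxA.
move: (partial_mx _ (partial_mx _ _) z) (J z *m partial_mx i (T j) z) => M1 M2.
move: (J z *m partial_mx j (T i) z) (J z *m (T i z *m T j z)) => M3 M4.
move: (J z *m (T j z *m T i z)) (connection g i z *m (J z *m T j z)) => M5 M6.
move: (connection g j z *m (J z *m T i z)) => M7.
move: (connection g j z *m (connection g i z *m J z)) => M8.
move: (connection g i z *m (connection g j z *m J z)) => M9.
by apply/matrixP => a b; rewrite !mxE; ring.
Qed.

(** The trace over the first and last indices of the curvature cancels the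
    conjugation by [J]; the two others are transformed by [J]. *)
Lemma ricci_isometry z : A z ->
  ricci_mx g z = J z *m ricci_mx h (f z) *m (J z)^T.
Proof.
move=> Az; have JU := J_unit Az.
have trE (M : 'M[R]_n) k a :
    \sum_i (M *m invmx (J z)) k i * J z i a = M k a.
  by rewrite -entry_mul mulmxKV.
apply/matrixP => j k; rewrite ricci_mxE.
transitivity (\sum_i \sum_a \sum_b (J z *m curvature_mx h a b (f z)
    *m invmx (J z)) k i * J z i a * J z j b).
  apply: eq_bigr => i _.
  rewrite -[curvature_mx _ _ _ _](mulmxK JU) (curvature_isometry i j Az).
  rewrite /curvature_pullback mulmx_sumr mulmx_suml summxE; apply: eq_bigr => a _.
  rewrite mulmx_sumr mulmx_suml summxE; apply: eq_bigr => b _.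
  by rewrite -scalemxAr -scalemxAl entry_scale mulrC mulrA.
rewrite exchange_big /=.
transitivity (\sum_a \sum_b (J z *m curvature_mx h a b (f z)) k a * J z j b).
  apply: eq_bigr => a _; rewrite exchange_big; apply: eq_bigr => b _.
  by rewrite -mulr_suml trE.
rewrite exchange_big entry_mul /=.
transitivity (\sum_c (\sum_b J z j b * ricci_mx h (f z) b c) * J z k c).
  under [RHS]eq_bigr do rewrite mulr_suml.
  rewrite [RHS]exchange_big; apply: eq_bigr => b _ /=.
  under eq_bigr do rewrite entry_mul mulr_suml.
  rewrite exchange_big; apply: eq_bigr => c _ /=.
  rewrite ricci_mxE mulr_sumr mulr_suml; apply: eq_bigr => a _.
  by ring.
by apply: eq_bigr => c _; rewrite entry_mul [(_^T)%R c k]mxE.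
Qed.

Theorem scalar_curvature_isometry z : A z ->
  scalar_curvature g z = scalar_curvature h (f z).
Proof.
move=> Az; have JU := J_unit Az.
rewrite !scalar_curvatureE (ricci_isometry Az) -(isom Az) !trmx_mul trmxK.
have hU : h (f z) \in unitmx by case: hB => _ _; apply; exact: fAB.
have JtU : (J z)^T \in unitmx by rewrite unitmx_tr.
have -> : invmx (J z *m h (f z) *m (J z)^T)
    = invmx (J z)^T *m invmx (h (f z)) *m invmx (J z).
  apply: (can_inj (mulmxK (_ : J z *m h (f z) *m (J z)^T \in unitmx))).
    by rewrite !unitmx_mul JU hU JtU.
  rewrite mulVmx ?unitmx_mul ?JU ?hU ?JtU// -!mulmxA mulKmx// mulKmx//.
  by rewrite mulVmx.
rewrite mulmxA -!mulmxA mulKmx// mxtrace_mulC -!mulmxA mulmxV// mulmx1.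
by [].
Qed.

End Isometry.

(** * Curvature of tube domains *)

(** The Levi-Civita connection of the Hessian metric on the base of the tube: its
    Christoffel symbols are half the third derivatives of the potential, one
    index being raised. *)
HB.lock Definition tube_gamma (R : realType) (T : tube R) (i : 'I_2)
    (x : 'rV[R]_2) : 'M[R]_2 :=
  2^-1 *: (partial_mx i (hessian (potential T)) x
           *m invmx (hessian (potential T) x)).

Section Tube.
Variables (R : realType) (T : tube R).
Local Notation U := (base T).
Local Notation D := (tube_domain T).
Local Notation H := (hessian (potential T)).
Local Notation g := (tube_metric T).

Lemma re2_delta_l (k : 'I_2) : re2 (delta_mx ord0 (lshift 2 k)) = delta_mx ord0 k :> 'rV[R]_2.
Proof. by apply/rowP => j; rewrite !mxE eq_lshift. Qed.

Lemma re2_delta_r (k : 'I_2) : re2 (delta_mx ord0 (rshift 2 k)) = 0 :> 'rV[R]_2.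
Proof. by apply/rowP => j; rewrite !mxE eq_lrshift. Qed.

Lemma im2_delta_l (k : 'I_2) : im2 (delta_mx ord0 (lshift 2 k)) = 0 :> 'rV[R]_2.
Proof. by apply/rowP => j; rewrite !mxE eq_rlshift. Qed.

Lemma im2_delta_r (k : 'I_2) : im2 (delta_mx ord0 (rshift 2 k)) = delta_mx ord0 k :> 'rV[R]_2.
Proof. by apply/rowP => j; rewrite !mxE eq_rshift. Qed.

Lemma derive_re2 (phi : 'rV[R]_2 -> R) (z v : 'C2[R]) :
  'D_v (fun w => phi (re2 w)) z = 'D_(re2 v) phi (re2 z).
Proof.
rewrite /derive; set f1 := fun h => h^-1 *: _; set f2 := fun h => h^-1 *: _.
suff -> : f1 = f2 by [].
by apply/funext => h; rewrite /f1 /f2 /= /re2 linearP.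
Qed.

Lemma partial_re2_l (phi : 'rV[R]_2 -> R) (z : 'C2[R]) k :
  partial (lshift 2 k) (fun w => phi (re2 w)) z = partial k phi (re2 z).
Proof. by rewrite /partial derive_re2 re2_delta_l. Qed.

Lemma partial_re2_r (phi : 'rV[R]_2 -> R) (z : 'C2[R]) k :
  partial (rshift 2 k) (fun w => phi (re2 w)) z = 0.
Proof. by rewrite /partial derive_re2 re2_delta_r derive0. Qed.

Lemma partial_mx_re2_l p q (F : 'rV[R]_2 -> 'M[R]_(p, q)) (z : 'C2[R]) k :
  partial_mx (lshift 2 k) (fun w => F (re2 w)) z = partial_mx k F (re2 z).
Proof.
apply/matrixP => a b; rewrite !partial_mxE.
exact: (partial_re2_l (fun x => F x a b)).
Qed.

Lemma partial_mx_re2_r p q (F : 'rV[R]_2 -> 'M[R]_(p, q)) (z : 'C2[R]) k :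
  partial_mx (rshift 2 k) (fun w => F (re2 w)) z = 0.
Proof.
apply/matrixP => a b; rewrite partial_mxE mxE.
exact: (partial_re2_r (fun x => F x a b)).
Qed.

Lemma partial_mx_block p q p' q' n (x : 'rV[R]_n) (k : 'I_n)
    (F1 : 'rV[R]_n -> 'M[R]_(p, q)) (F2 : 'rV[R]_n -> 'M[R]_(p, q'))
    (F3 : 'rV[R]_n -> 'M[R]_(p', q)) (F4 : 'rV[R]_n -> 'M[R]_(p', q')) :
  partial_mx k (fun w => block_mx (F1 w) (F2 w) (F3 w) (F4 w)) x
  = block_mx (partial_mx k F1 x) (partial_mx k F2 x)
             (partial_mx k F3 x) (partial_mx k F4 x).
Proof.
apply/matrixP => a b; rewrite partial_mxE.
case: (split_ordP a) => i ->; case: (split_ordP b) => j ->;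
rewrite ?block_mxEul ?block_mxEur ?block_mxEdl ?block_mxEdr partial_mxE;
congr (partial k _ x); apply/funext => w;
by rewrite ?block_mxEul ?block_mxEur ?block_mxEdl ?block_mxEdr.
Qed.

Lemma partial_mx_cst p q n (x : 'rV[R]_n) (k : 'I_n) (M : 'M[R]_(p, q)) :
  partial_mx k (fun=> M) x = 0.
Proof.
apply/matrixP => a b; rewrite partial_mxE mxE.
by case: (gradient_cst (M a b) x).
Qed.

Lemma metric_atE n (h : 'rV[R]_n -> 'M[R]_n) x u v :
  metric_at h x u v = \sum_i \sum_j h x i j * (u ord0 i * v ord0 j).
Proof.
rewrite /metric_at -mulmxA mxE; apply: eq_bigr => i _.
rewrite mxE mulr_sumr; apply: eq_bigr => j _; rewrite mxE; ring.
Qed.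

(** The metric of the tube is, for the real and for the imaginary parts, the
    symmetrized Hessian of the potential. *)
Lemma kahler_formJ z u v : complex.Re (kahler_form T z u (cplxJ v))
  = 2^-1 * (metric_at H (re2 z) (re2 u) (re2 v)
            + metric_at H (re2 z) (im2 u) (im2 v)
            + metric_at H (re2 z) (re2 v) (re2 u)
            + metric_at H (re2 z) (im2 v) (im2 u)).
Proof.
have ReI (c : R[i]) : complex.Re (Complex 0 2^-1 * c) = 2^-1 * - complex.Im c.
  by case: c => c d /=; ring.
have ImD : {morph @complex.Im R : x y / x + y} by case=> ? ? [].
rewrite /kahler_form ReI (big_morph _ ImD (erefl _)); congr (_ * _).
rewrite !metric_atE -!big_split -sumrN; apply: eq_bigr => i _ /=.
rewrite (big_morph _ ImD (erefl _)) -!big_split -sumrN; apply: eq_bigr => j _ /=.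
rewrite /dz /cplxJ /re2 /im2 row_mxKl row_mxKr /= !mxE; ring.
Qed.

Hypotheses (oU : open U) (smoothU : smooth_on U (potential T)).
Hypothesis HU : forall x, U x -> H x \in unitmx.

Lemma hessian_smooth : smooth_mx U H.
Proof.
move=> i j; have := smooth_on_partial i (smooth_on_partial j smoothU).
by apply: eq_smooth_on => // x _; rewrite mxE.
Qed.

Lemma hessian_sym x : U x -> (H x)^T = H x.
Proof.
move=> Ux; apply/matrixP => i j; rewrite !mxE.
exact: partial_comm oU Ux smoothU.
Qed.

Lemma re2_smooth A : open A -> smooth_map_on A (@re2 R).
Proof.
move=> oA k; apply: eq_smooth_on (smooth_coord oA (lshift 2 k)) => // z _.
by rewrite mxE.
Qed.

Lemma tube_domain_open : open D.
Proof.
apply: (@open_comp _ _ (@re2 R)) => // z _.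
apply: differentiable_continuous.
exact: smooth_map_differentiable (re2_smooth openT) I.
Qed.

Lemma tube_metricE z : D z -> g z = block_mx (H (re2 z)) 0 0 (H (re2 z)).
Proof.
move=> Dz; have sym u v :
    metric_at H (re2 z) u v = metric_at H (re2 z) v u.
  rewrite /metric_at -[in LHS](hessian_sym Dz) -[u in LHS]trmxK -trmx_mul -trmx_mul.
  by rewrite mxE mulmxA.
have deltaE k l : metric_at H (re2 z) (delta_mx ord0 k) (delta_mx ord0 l)
    = H (re2 z) k l.
  by rewrite /metric_at -rowE trmx_delta -colE !mxE.
have m0l v : metric_at H (re2 z) 0 v = 0.
  by rewrite /metric_at !mul0mx mxE.
have m0r v : metric_at H (re2 z) v 0 = 0 by rewrite sym.
apply/matrixP => a b; rewrite mxE kahler_formJ.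
have half (x : R) : 2^-1 * (x + x) = x by field.
have z0 i j : (0 : 'M[R]_2) i j = 0 by rewrite mxE.
case: (split_ordP a) => i ->; case: (split_ordP b) => j ->;
rewrite ?block_mxEul ?block_mxEur ?block_mxEdl ?block_mxEdr;
rewrite !(re2_delta_l, re2_delta_r, im2_delta_l, im2_delta_r);
rewrite !(m0l, m0r) ?(addr0, add0r) ?mulr0 ?z0//.
- by rewrite [X in _ + X]sym deltaE half.
- by rewrite [X in _ + X]sym deltaE half.
Qed.

Lemma tube_metric_on : metric_on D g.
Proof.
have oD := tube_domain_open.
split=> [|z Dz|z Dz].
- apply: (@eq_smooth_mx _ _ _ _ D
    (fun z => block_mx (H (re2 z)) 0 0 (H (re2 z)))) => //.
    by move=> z Dz; rewrite tube_metricE.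
  have HD i j : smooth_on D (fun z => H (re2 z) i j).
    exact: smooth_comp oD (re2_smooth oD) (fun z Dz => Dz) (hessian_smooth i j).
  have cD := smooth_cst oD 0.
  move=> a b; case: (split_ordP a) => i ->; case: (split_ordP b) => j ->.
  + by apply: eq_smooth_on (HD i j) => // z _; rewrite block_mxEul.
  + by apply: eq_smooth_on cD => // z _; rewrite block_mxEur mxE.
  + by apply: eq_smooth_on cD => // z _; rewrite block_mxEdl mxE.
  + by apply: eq_smooth_on (HD i j) => // z _; rewrite block_mxEdr.
- by rewrite tube_metricE// tr_block_mx !trmx0 hessian_sym.
- by rewrite tube_metricE// unitmxE det_ublock unitrM -!unitmxE HU.
Qed.

Local Notation G := (tube_gamma T).

Lemma hessian_third i j k x : U x ->
  partial_mx i H x j k = partial_mx j H x i k.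
Proof.
move=> Ux; have pE a b : partial_mx a H x b k
    = partial a (partial b (partial k (potential T))) x.
  rewrite partial_mxE; congr (partial a _ x).
  by apply/funext => y; rewrite mxE.
rewrite (pE i j) (pE j i).
exact: partial_comm oU Ux (smooth_on_partial k smoothU).
Qed.

(** Third derivatives are symmetric. *)
Lemma tube_gamma_sym i j k x : U x -> G i x j k = G j x i k.
Proof.
move=> Ux; rewrite tube_gamma.unlock !entry_scale !entry_mul; congr (_ * _).
by apply: eq_bigr => l _; rewrite (hessian_third i j l Ux).
Qed.

Lemma tube_gammaH i x : U x -> G i x *m H x = 2^-1 *: partial_mx i H x.
Proof. by move=> Ux; rewrite tube_gamma.unlock -scalemxAl mulmxKV// HU. Qed.

(** The coefficients do not depend on the fiber, and the connection commutes with
    the complex structure: the directions of the base preserve the real and the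
    imaginary parts, those of the fiber exchange them. *)
Definition tube_connection (k : 'I_(2 + 2)) x : 'M[R]_(2 + 2) :=
  match fintype.split k with
  | inl i => block_mx (G i x) 0 0 (G i x)
  | inr i => block_mx 0 (G i x) (- G i x) 0
  end.

Lemma tube_connection_l i x :
  tube_connection (lshift 2 i) x = block_mx (G i x) 0 0 (G i x).
Proof. by rewrite /tube_connection (unsplitK (inl i)). Qed.

Lemma tube_connection_r i x :
  tube_connection (rshift 2 i) x = block_mx 0 (G i x) (- G i x) 0.
Proof. by rewrite /tube_connection (unsplitK (inr i)). Qed.

Lemma connection_tubeE k z : D z ->
  connection g k z = tube_connection k (re2 z).
Proof.
move=> Dz; move: k; have [_ gs gU] := tube_metric_on.
have oD := tube_domain_open.
have HT i : (partial_mx i H (re2 z))^T = partial_mx i H (re2 z).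
  apply/matrixP => a b; rewrite mxE !partial_mxE.
  apply: (eq_partial i oU Dz) => y Uy.
  by rewrite -{1}(hessian_sym Uy) mxE.
have half (M : 'M[R]_2) : 2^-1 *: M + 2^-1 *: M = M.
  by rewrite -scalerDl -[RHS]scale1r; congr (_ *: _); field.
apply: connection_unique; [exact: gs|exact: gU| |].
- move=> k; rewrite (@eq_partial_mx _ _ _ _ D g
    (fun z => block_mx (H (re2 z)) 0 0 (H (re2 z))))//; last exact: tube_metricE.
  rewrite partial_mx_block partial_mx_cst tube_metricE//.
  case: (split_ordP k) => i ->.
    rewrite tube_connection_l partial_mx_re2_l mulmx_block.
    rewrite !(mulmx0, mul0mx, addr0, add0r) tube_gammaH// tr_block_mx !trmx0.
    by rewrite add_block_mx linearZ /= HT !addr0 !half.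
  rewrite tube_connection_r partial_mx_re2_r mulmx_block.
  rewrite !(mulmx0, mul0mx, addr0, add0r) mulNmx tube_gammaH//.
  rewrite tr_block_mx !trmx0 add_block_mx [(- _)^T]linearN /= linearZ /= HT.
  by rewrite !addr0 subrr addNr.
- have z0 i j : (0 : 'M[R]_2) i j = 0 by rewrite mxE.
  have opE (M : 'M[R]_2) i j : (- M) i j = - M i j by rewrite mxE.
  move=> a b c.
  case: (split_ordP a) => i ->; case: (split_ordP b) => j ->;
  case: (split_ordP c) => k ->;
  rewrite ?tube_connection_l ?tube_connection_r;
  rewrite ?block_mxEul ?block_mxEur ?block_mxEdl ?block_mxEdr ?z0 ?opE//.
  all: by rewrite (tube_gamma_sym i j k Dz).
Qed.

Lemma partial_mxZ n p q (A : set 'rV[R]_n) (a : R) (F : 'rV[R]_n -> 'M[R]_(p, q)) k x :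
  smooth_mx A F -> A x ->
  partial_mx k (fun y => a *: F y) x = a *: partial_mx k F x.
Proof.
move=> FA Ax; apply/matrixP => i j; rewrite entry_scale !partial_mxE.
have [_ H1] := gradientM (gradient_cst a x) (smooth_on_gradient (FA i j) Ax).
transitivity (partial k (fun y => a * F y i j) x).
  by congr (partial k _ x); apply/funext => y; rewrite entry_scale.
by rewrite H1 mul0r add0r.
Qed.

Lemma tube_gamma_smooth i : smooth_mx U (G i).
Proof.
rewrite tube_gamma.unlock; apply: (smooth_mxZ oU (smooth_cst oU 2^-1)); apply: smooth_mxM => //.
  exact: smooth_partial_mx hessian_smooth.
by apply: smooth_invmx => //; exact: hessian_smooth.
Qed.

(** The product rule for [G j x *m H x = 2^-1 *: partial_mx j H x]. *)
Lemma partial_gamma i j x : U x -> partial_mx i (G j) x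
  = 2^-1 *: (partial_mx i (partial_mx j H) x *m invmx (H x))
    - 2 *: (G j x *m G i x).
Proof.
move=> Ux; have HUx := HU Ux; have Hsm := hessian_smooth.
have E : partial_mx i (G j) x *m H x + G j x *m partial_mx i H x
    = 2^-1 *: partial_mx i (partial_mx j H) x.
  rewrite -(partial_mxM oU i (tube_gamma_smooth j) Hsm Ux).
  rewrite -(partial_mxZ _ _ (smooth_partial_mx oU j Hsm) Ux).
  by apply: (eq_partial_mx i oU Ux) => y Uy; rewrite tube_gammaH.
have dH : partial_mx i H x = 2 *: (G i x *m H x).
  by rewrite tube_gammaH// scalerA divff ?scale1r// pnatr_eq0.
rewrite -[LHS](mulmxK HUx); move/(canRL (addrK _)) : E => ->.
by rewrite dH mulmxBl -scalemxAr -!scalemxAl !mulmxA mulmxK.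
Qed.

(** [gamma_comm] carries the curvature of a pair of directions both in the base
    or both in the fiber, [gamma_mix] that of a mixed pair. *)
Definition gamma_comm i j x := G j x *m G i x - G i x *m G j x.
Local Notation C := gamma_comm.

Definition gamma_mix i j x := partial_mx i (G j) x + C i j x.
Local Notation K := gamma_mix.

(** The second derivatives of the Hessian cancel by symmetry, and the quadratic
    terms left are minus twice the commutator. *)
Lemma gamma_antisym i j x : U x ->
  partial_mx i (G j) x - partial_mx j (G i) x + C i j x = - C i j x.
Proof.
move=> Ux; rewrite !partial_gamma// (partial_mx_comm i j oU Ux hessian_smooth).
rewrite /C; move: (2^-1 *: _) (G j x *m _) (G i x *m _) => X M N.
by apply/matrixP => a b; rewrite !mxE; ring.
Qed.

Lemma gamma_mixC i j x : U x -> K i j x = K j i x.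
Proof.
move=> Ux; move: (gamma_antisym i j Ux); rewrite /K /C.
move: (partial_mx i _ x) (partial_mx j _ x) => P Q.
move: (G j x *m _) (G i x *m _) => M N E; apply: subr0_eq.
have -> : P + (M - N) - (Q + (N - M)) = (P - Q + (M - N)) + (M - N).
  by apply/matrixP => a b; rewrite !mxE; ring.
by rewrite E addNr.
Qed.

Lemma partial_connection_l i k z : D z ->
  partial_mx (lshift 2 i) (connection g k) z
  = match fintype.split k with
    | inl j => block_mx (partial_mx i (G j) (re2 z)) 0 0 (partial_mx i (G j) (re2 z))
    | inr j => block_mx 0 (partial_mx i (G j) (re2 z)) (- partial_mx i (G j) (re2 z)) 0
    end.
Proof.
move=> Dz; rewrite (@eq_partial_mx _ _ _ _ D _ (fun z => tube_connection k (re2 z)))//;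
  [|exact: tube_domain_open|by move=> y; exact: connection_tubeE].
rewrite partial_mx_re2_l /tube_connection; case: (fintype.split k) => j.
  by rewrite partial_mx_block !partial_mx_cst.
rewrite partial_mx_block !partial_mx_cst; congr (block_mx _ _ _ _).
rewrite -scaleN1r -(partial_mxZ _ _ (tube_gamma_smooth j) Dz).
by congr (partial_mx i _ (re2 z)); apply/funext => y; rewrite scaleN1r.
Qed.

Lemma partial_connection_r i k z : D z ->
  partial_mx (rshift 2 i) (connection g k) z = 0.
Proof.
move=> Dz; rewrite (@eq_partial_mx _ _ _ _ D _ (fun z => tube_connection k (re2 z)))//;
  [|exact: tube_domain_open|by move=> y; exact: connection_tubeE].
exact: partial_mx_re2_r.
Qed.

Let simplm := (mulmx0, mul0mx, addr0, add0r, subr0, sub0r, oppr0).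

Lemma curvature_tube_ll i j z : D z ->
  curvature_mx g (lshift 2 i) (lshift 2 j) z
  = block_mx (- C i j (re2 z)) 0 0 (- C i j (re2 z)).
Proof.
move=> Dz; rewrite curvature_structure !partial_connection_l// !connection_tubeE//.
rewrite !tube_connection_l ![fintype.split _](unsplitK (inl _)).
rewrite !mulmx_block !simplm !opp_block_mx !add_block_mx !simplm.
by rewrite gamma_antisym.
Qed.

Lemma curvature_tube_lr i j z : D z ->
  curvature_mx g (lshift 2 i) (rshift 2 j) z
  = block_mx 0 (K i j (re2 z)) (- K i j (re2 z)) 0.
Proof.
move=> Dz; rewrite curvature_structure partial_connection_l// partial_connection_r//.
rewrite !connection_tubeE// tube_connection_l tube_connection_r.
rewrite [fintype.split _](unsplitK (inr _)).
rewrite !mulmx_block !simplm !opp_block_mx !add_block_mx !simplm.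
congr (block_mx _ _ _ _).
by rewrite mulNmx mulmxN opprK /K /C opprD opprB [_ *m _ - _]addrC.
Qed.

Lemma curvature_mx_antisym i j z :
  curvature_mx g i j z = - curvature_mx g j i z.
Proof. by rewrite !curvature_structure opprD !opprB. Qed.

Lemma curvature_tube_rl i j z : D z ->
  curvature_mx g (rshift 2 i) (lshift 2 j) z
  = block_mx 0 (- K i j (re2 z)) (K i j (re2 z)) 0.
Proof.
move=> Dz; rewrite curvature_mx_antisym curvature_tube_lr// opp_block_mx !oppr0 opprK.
by rewrite gamma_mixC.
Qed.

Lemma curvature_tube_rr i j z : D z ->
  curvature_mx g (rshift 2 i) (rshift 2 j) z
  = block_mx (- C i j (re2 z)) 0 0 (- C i j (re2 z)).
Proof.
move=> Dz; rewrite curvature_structure !partial_connection_r//.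
rewrite !connection_tubeE// !tube_connection_r.
rewrite !mulmx_block !simplm !opp_block_mx !add_block_mx !simplm.
by rewrite !mulNmx !mulmxN -!opprD.
Qed.

Definition gamma_trace k x := \sum_i G i x k i.

Lemma ricci_tube_diag j k z : D z ->
  ricci_mx g z (lshift 2 j) (lshift 2 k) = - partial j (gamma_trace k) (re2 z) /\
  ricci_mx g z (rshift 2 j) (rshift 2 k) = - partial j (gamma_trace k) (re2 z).
Proof.
move=> Dz; have opE (M : 'M[R]_2) a b : (- M) a b = - M a b by rewrite mxE.
have -> : partial j (gamma_trace k) (re2 z)
    = \sum_i partial_mx j (G i) (re2 z) k i.
  have [_ ->] := gradient_sum (fun i => smooth_on_gradient (tube_gamma_smooth i k i) Dz).
  by apply: eq_bigr => i _; rewrite partial_mxE.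
have term i : (- C i j (re2 z)) k i - K i j (re2 z) k i
    = - partial_mx j (G i) (re2 z) k i.
  rewrite gamma_mixC// /K /C; move: (partial_mx _ _ _) => M.
  move: (G i _ *m _) (G j _ *m _) => N P.
  by rewrite !mxE; ring.
rewrite !ricci_mxE !big_split_ord /= -!sumrN -!big_split /=.
split; apply: eq_bigr => i _; rewrite -term.
  rewrite curvature_tube_ll// curvature_tube_rl// block_mxEul block_mxEur.
  by rewrite [in LHS]opE [in X in _ + X]opE opE.
rewrite curvature_tube_lr// curvature_tube_rr// block_mxEdl block_mxEdr.
by rewrite addrC; congr (_ + _); rewrite opE.
Qed.

(** [gamma_trace] is half the gradient of the logarithm of the determinant of the
    Hessian, that is, of the volume density; each diagonal block of the Ricci
    tensor is minus half the Hessian of this logarithm. *)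
Theorem scalar_curvature_tube z : D z -> scalar_curvature g z
  = - 2 * \sum_j \sum_k invmx (H (re2 z)) j k * partial j (gamma_trace k) (re2 z).
Proof.
move=> Dz; rewrite scalar_curvatureE tube_metricE//.
have HUz := HU Dz.
have -> : invmx (block_mx (H (re2 z)) 0 0 (H (re2 z)))
    = block_mx (invmx (H (re2 z))) 0 0 (invmx (H (re2 z))).
  have BU : block_mx (H (re2 z)) 0 0 (H (re2 z)) \in unitmx.
    by rewrite unitmxE det_ublock unitrM -!unitmxE HUz.
  apply: (can_inj (mulmxK BU)); rewrite mulVmx// mulmx_block !simplm mulVmx//.
  by rewrite -scalar_mx_block.
rewrite -[ricci_mx g z]submxK tr_block_mx mulmx_block !simplm mxtrace_block.
have E (M : 'M[R]_2) : (forall j k, M j k = - partial j (gamma_trace k) (re2 z)) ->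
    \tr (invmx (H (re2 z)) *m M^T)
    = - \sum_j \sum_k invmx (H (re2 z)) j k * partial j (gamma_trace k) (re2 z).
  move=> ME; rewrite -sumrN; apply: eq_bigr => j _.
  rewrite entry_mul -sumrN; apply: eq_bigr => k _.
  by rewrite mxE ME mulrN.
rewrite !E; first by rewrite mulNr mulr_natl mulr2n opprD.
  by move=> j k; have [_ <-] := ricci_tube_diag j k Dz; rewrite !mxE.
by move=> j k; have [<- _] := ricci_tube_diag j k Dz; rewrite !mxE.
Qed.

End Tube.

(** * Holomorphic sectional curvature of tube domains *)

Section TubeHolomorphicCurvature.
Variables (R : realType) (T : tube R).
Local Notation U := (base T).
Local Notation D := (tube_domain T).
Local Notation H := (hessian (potential T)).
Local Notation g := (tube_metric T).
Local Notation G := (tube_gamma T).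
Local Notation C := (gamma_comm T).
Local Notation K := (gamma_mix T).
Hypotheses (oU : open U) (smoothU : smooth_on U (potential T)).
Hypothesis HU : forall x, U x -> H x \in unitmx.

Lemma metric_atT n (h : 'rV[R]_n -> 'M[R]_n) x u v :
  (h x)^T = h x -> metric_at h x u v = metric_at h x v u.
Proof.
move=> hs; rewrite /metric_at -[in LHS]hs -[u in LHS]trmxK -trmx_mul -trmx_mul.
by rewrite mxE mulmxA.
Qed.

Lemma metric_tubeE z u v : D z -> metric_at g z u v
  = metric_at H (re2 z) (re2 u) (re2 v) + metric_at H (re2 z) (im2 u) (im2 v).
Proof.
move=> Dz; rewrite /metric_at tube_metricE// -{1}(hsubmxK u) -{1}(hsubmxK v).
rewrite mul_row_block tr_row_mx mul_row_col !mulmx0 addr0 add0r.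
by rewrite entry_add.
Qed.

Lemma curvature_opE n (h : 'rV[R]_n -> 'M[R]_n) x u v w :
  curvature_op h x u v w
  = \sum_i \sum_j (u ord0 i * v ord0 j) *: (w *m curvature_mx h i j x).
Proof.
apply/rowP => l; rewrite mxE summxE; apply: eq_bigr => i _.
rewrite summxE; apply: eq_bigr => j _.
rewrite entry_scale entry_mul mulr_sumr; apply: eq_bigr => k _.
by rewrite curvature_mxE mulrA.
Qed.

Let form (M : 'M[R]_2) x (u v : 'rV[R]_2) := (u *m (M *m H x) *m v^T) ord0 ord0.

(** The pairs of directions are split into base and fiber; pairs of equal kind
    contribute through [gamma_comm], mixed ones through [gamma_mix]. *)
Lemma holomorphic_curvature_tube z v : D z ->
  let a := re2 v in let b := im2 v in let x := re2 z in
  metric_at g z (curvature_op g z v (cplxJ v) (cplxJ v)) v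
  = \sum_i \sum_j
      ((a ord0 i * b ord0 j - b ord0 i * a ord0 j)
         * (form (C i j x) x a b - form (C i j x) x b a)
       - (a ord0 i * a ord0 j + b ord0 i * b ord0 j)
         * (form (K i j x) x a a + form (K i j x) x b b)).
Proof.
move=> Dz a b x.
have va i : v ord0 (lshift 2 i) = a ord0 i by rewrite mxE.
have vb i : v ord0 (rshift 2 i) = b ord0 i by rewrite mxE.
have wa i : cplxJ v ord0 (lshift 2 i) = - b ord0 i by rewrite row_mxEl mxE.
have wb i : cplxJ v ord0 (rshift 2 i) = a ord0 i by rewrite row_mxEr.
have blockE (M N P Q : 'M[R]_2) :
    (cplxJ v *m block_mx M N P Q *m g z *m v^T) ord0 ord0
    = form P x a a - form M x b a + (form Q x a b - form N x b b).
  rewrite tube_metricE// -[v in v^T]hsubmxK tr_row_mx -/a -/b /cplxJ.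
  rewrite mul_row_block mul_row_block mul_row_col !mulmx0 addr0 add0r -/a -/b.
  rewrite !mulNmx !mulmxDl !mulNmx /form -!mulmxA -/x !mxE.
  by rewrite [- _ + _]addrC [X in _ + X]addrC.
have S i j : (cplxJ v *m curvature_mx g i j z *m g z *m v^T) ord0 ord0
    = metric_at g z (cplxJ v *m curvature_mx g i j z) v by [].
rewrite curvature_opE {1}/metric_at mulmx_suml mulmx_suml summxE.
under eq_bigr => i _ do (rewrite mulmx_suml mulmx_suml summxE;
  under eq_bigr => j _ do rewrite -scalemxAl -scalemxAl entry_scale).
rewrite big_split_ord /= -big_split /=; apply: eq_bigr => i _.
rewrite !big_split_ord /= -!big_split /=; apply: eq_bigr => j _.
rewrite !(va, vb, wa, wb).
rewrite curvature_tube_ll// curvature_tube_lr// curvature_tube_rl//.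
rewrite curvature_tube_rr// !blockE -/x.
have form0 u w : form 0 x u w = 0 by rewrite /form mul0mx mulmx0 mul0mx mxE.
have formN M u w : form (- M) x u w = - form M x u w.
  by rewrite /form mulNmx mulmxN mulNmx mxE.
by rewrite !form0 !formN; ring.
Qed.

Let gamma_gammaH i j x : U x -> G i x *m G j x *m H x
  = 4^-1 *: (partial_mx i H x *m invmx (H x) *m partial_mx j H x).
Proof.
move=> Ux; rewrite -mulmxA tube_gammaH// tube_gamma.unlock.
rewrite -scalemxAl -scalemxAr scalerA -!mulmxA; congr (_ *: _).
by field.
Qed.

Let gamma_commH i j x : U x -> C i j x *m H x
  = 4^-1 *: (partial_mx j H x *m invmx (H x) *m partial_mx i H x
             - partial_mx i H x *m invmx (H x) *m partial_mx j H x).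
Proof. by move=> Ux; rewrite /C mulmxBl !gamma_gammaH// scalerBr. Qed.

Let gamma_mixH i j x : U x -> K i j x *m H x
  = 2^-1 *: partial_mx i (partial_mx j H) x
    - 4^-1 *: (partial_mx j H x *m invmx (H x) *m partial_mx i H x
               + partial_mx i H x *m invmx (H x) *m partial_mx j H x).
Proof.
move=> Ux; rewrite /K mulmxDl gamma_commH// partial_gamma// mulmxBl.
rewrite -[_ *: _ *m H x]scalemxAl mulmxKV ?HU//.
rewrite -[_ *: _ *m H x]scalemxAl gamma_gammaH//.
move: (partial_mx _ (partial_mx _ _) _) (partial_mx i H x *m _ *m _) => M N.
move: (partial_mx j H x *m _ *m _) => P.
by apply/matrixP => k l; rewrite !mxE; field.
Qed.

(** The hypothesis says that the curvature tensor of the tube, read on the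
    holomorphic tangent space, is that of a complex space form. *)
Theorem constant_holomorphic_curvature (c : R) :
  (forall x (v : 'rV[R]_2), U x -> v != 0 -> 0 < (v *m H x *m v^T) ord0 ord0) ->
  (forall x i j k l, U x ->
     partial_mx i (partial_mx j H) x k l
     - (partial_mx i H x *m invmx (H x) *m partial_mx j H x) k l
     = 2 * c * (H x i j * H x k l + H x i l * H x k j)) ->
  forall z, D z -> forall v, v != 0 ->
    holomorphic_sectional_curvature g z v = - 2 * c.
Proof.
move=> posH spaceform z Dz v v0; have Ux : U (re2 z) by [].
set x := re2 z in Ux; set a := re2 v; set b := im2 v.
have Hs i j : H x i j = H x j i by rewrite -{1}(hessian_sym oU smoothU Ux) mxE.
pose N := metric_at H x a a + metric_at H x b b.
have N0 : 0 < N.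
  have pos u : 0 <= metric_at H x u u.
    have [->|u0] := eqVneq u 0; last exact/ltW/posH.
    by rewrite /metric_at !mul0mx mxE.
  have [a0|a0] := eqVneq a 0; last by apply: ltr_pwDl => //; exact: posH.
  apply: ltr_wpDl => //; apply: posH => //; apply: contra_neq v0 => b0.
  by rewrite -[v]hsubmxK -/(re2 v) -/(im2 v) -/a -/b a0 b0 row_mx0.
rewrite /holomorphic_sectional_curvature /sectional_curvature.
have reJ : re2 (cplxJ v) = - b by rewrite /re2 row_mxKl.
have imJ : im2 (cplxJ v) = a by rewrite /im2 row_mxKr.
have vJ : metric_at g z v (cplxJ v) = 0.
  rewrite metric_tubeE// reJ imJ -/a -/b -/x.
  rewrite (metric_atT b a (hessian_sym oU smoothU Ux)).
  by rewrite /metric_at linearN /= mulmxN mxE addNr.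
have JJ : metric_at g z (cplxJ v) (cplxJ v) = N.
  rewrite metric_tubeE// reJ imJ -/a -/x addrC; congr (_ + _).
  by rewrite /metric_at linearN /= mulmxN !mulNmx opprK.
have vv : metric_at g z v v = N by rewrite metric_tubeE.
rewrite vJ JJ vv expr0n subr0.
apply: (canLR (mulfK (lt0r_neq0 (mulr_gt0 N0 N0)))).
rewrite holomorphic_curvature_tube// -/a -/b -/x.
have formE M u w : form M x u w
    = \sum_k \sum_l (M *m H x) k l * (u ord0 k * w ord0 l).
  exact: (metric_atE (fun=> M *m H x) 0).
pose F i j := partial_mx i H x *m invmx (H x) *m partial_mx j H x.
have FE i j k l : F i j k l = partial_mx i (partial_mx j H) x k l
    - 2 * c * (H x i j * H x k l + H x i l * H x k j).
  by rewrite -(spaceform x i j k l Ux) opprB addrC subrK.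
have CE i j k l : (C i j x *m H x) k l
    = c / 2 * (H x i l * H x k j - H x j l * H x k i).
  rewrite gamma_commH// entry_scale entry_sub -/(F j i) -/(F i j) !FE.
  rewrite (partial_mx_comm i j oU Ux (hessian_smooth oU smoothU)) (Hs j i).
  by move: (partial_mx _ _ _ k l) => M; field.
have KE i j k l : (K i j x *m H x) k l
    = c / 2 * (2 * H x i j * H x k l + H x i l * H x k j + H x j l * H x k i).
  rewrite gamma_mixH// entry_sub !entry_scale entry_add -/(F j i) -/(F i j) !FE.
  rewrite (partial_mx_comm i j oU Ux (hessian_smooth oU smoothU)) (Hs j i).
  by move: (partial_mx _ _ _ k l) => M; field.
have formC i j u w : form (C i j x) x u w = \sum_k \sum_l
    c / 2 * (H x i l * H x k j - H x j l * H x k i) * (u ord0 k * w ord0 l).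
  rewrite formE; apply: eq_bigr => k _; apply: eq_bigr => l _.
  by rewrite CE.
have formK i j u w : form (K i j x) x u w = \sum_k \sum_l
    c / 2 * (2 * H x i j * H x k l + H x i l * H x k j + H x j l * H x k i)
    * (u ord0 k * w ord0 l).
  rewrite formE; apply: eq_bigr => k _; apply: eq_bigr => l _.
  by rewrite KE.
under eq_bigr => i _ do under eq_bigr => j _ do rewrite !formC !formK.
rewrite /N !metric_atE.
move: (H x) Hs => h Hs; clearbody a b; clear -Hs.
rewrite !big_ord_recl !big_ord0.
move: (Hs ord0 (lift ord0 ord0)).
move: (h ord0 ord0) (h ord0 (lift ord0 ord0)) => h00 h01.
move: (h (lift ord0 ord0) ord0) (h (lift ord0 ord0) (lift ord0 ord0)) => h10 h11 <-.
move: (a ord0 ord0) (a ord0 (lift ord0 ord0)) => a0 a1.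
move: (b ord0 ord0) (b ord0 (lift ord0 ord0)) => b0 b1.
by field.
Qed.

End TubeHolomorphicCurvature.

(** * Four tube domains *)

Lemma I2P (i : 'I_2) : i = ord0 \/ i = ord_max.
Proof. by case: i => [[|[|//]] ilt]; [left|right]; exact: val_inj. Qed.

Lemma sum2 (V : nmodType) (F : 'I_2 -> V) : \sum_i F i = F ord0 + F ord_max.
Proof.
rewrite !big_ord_recl big_ord0 addr0; congr (_ + F _); exact: val_inj.
Qed.

Lemma row2_eq0 (R : realType) (v : 'rV[R]_2) :
  v ord0 ord0 = 0 -> v ord0 ord_max = 0 -> v = 0.
Proof. by move=> v0 v1; apply/rowP => i; rewrite mxE; case: (I2P i) => ->. Qed.

Lemma open_smooth_gt0 (R : realType) n (F : 'rV[R]_n -> R) :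
  smooth_on setT F -> open [set x | 0 < F x].
Proof.
move=> FT; apply: (@open_comp _ _ F [set t | 0 < t]); last exact: open_gt.
by move=> x _; exact/differentiable_continuous/(smooth_on_differentiable FT).
Qed.

(** The set is a union of segments issued from one of its points. *)
Lemma convex_connected (R : realType) n (A : set 'rV[R]_n) :
  A !=set0 ->
  (forall x y (t : R), A x -> A y -> 0 <= t <= 1 -> A (t *: (y - x) + x)) ->
  connected A.
Proof.
move=> [x Ax] cA.
have -> : A = \bigcup_(y in A) [set t *: (y - x) + x | t in `[0, 1]%classic].
  apply/seteqP; split=> [y Ay|_ [y Ay] [t t01 <-]].
    by exists y => //; exists 1; rewrite ?scale1r ?subrK//= in_itv/= ler01 lexx.
  by apply: cA => //; move: t01; rewrite /= in_itv.
apply: bigcup_connected.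
  by exists x => y _; exists 0; rewrite ?scale0r ?add0r//= in_itv/= lexx ler01.
move=> y _; apply: connected_continuous_connected.
  exact: segment_connected.
apply: continuous_subspaceT => t.
apply: cvgD; last exact: cvg_cst.
exact: scalel_continuous.
Qed.

(** A vector of the kernel would have norm zero. *)
Lemma posdef_unitmx (R : realType) n (H : 'M[R]_n) :
  (forall v : 'rV[R]_n, v != 0 -> 0 < (v *m H *m v^T) ord0 ord0) -> H \in unitmx.
Proof.
move=> Hpos; rewrite -row_free_unit -kermx_eq0; apply/negPn/negP.
move=> /rowV0Pn[v /sub_kermxP vH v0].
by have := Hpos _ v0; rewrite vH mul0mx mxE ltxx.
Qed.

Lemma invmx_eq (R : realType) n (M N : 'M[R]_n) : M *m N = 1%:M -> invmx M = N.
Proof.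
move=> MN; have [MU _] := mulmx1_unit MN.
by apply: (can_inj (mulKmx MU)); rewrite mulmxV.
Qed.

(** Completing the square; the hypotheses are Sylvester's criterion. *)
Lemma posdef2 (R : realType) (H : 'M[R]_2) :
  0 < H ord0 ord0 -> H ord0 ord_max = H ord_max ord0 ->
  0 < H ord0 ord0 * H ord_max ord_max - H ord0 ord_max ^+ 2 ->
  forall v : 'rV[R]_2, v != 0 -> 0 < (v *m H *m v^T) ord0 ord0.
Proof.
move=> a0 bc d0 v v0.
have -> : (v *m H *m v^T) ord0 ord0 = \sum_i \sum_j H i j * (v ord0 i * v ord0 j).
  exact: (metric_atE (fun=> H) 0).
rewrite !sum2 -bc; move: a0 d0; set a := H _ _; set d := H _ _; set b := H _ _.
set x := v _ _; set y := v _ _ => a0 d0.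
rewrite -(pmulr_rgt0 _ a0).
have -> : a * (a * (x * x) + b * (x * y) + (b * (y * x) + d * (y * y)))
    = (a * x + b * y) ^+ 2 + (a * d - b ^+ 2) * y ^+ 2 by ring.
have [y0|y0] := eqVneq y 0; last first.
  by rewrite ltr_wpDl ?sqr_ge0// mulr_gt0// exprn_even_gt0.
rewrite y0 mulr0 addr0 expr0n mulr0 addr0 exprn_even_gt0//= mulf_eq0 (gt_eqF a0) /=.
by apply: contra_neq v0 => x0; exact: row2_eq0.
Qed.

Section Hessians.
Variables (R : realType) (T : tube R).
Local Notation U := (base T).
Hypothesis oU : open U.

Lemma hessianE (psi : 'I_2 -> 'rV[R]_2 -> R) (h : 'I_2 -> 'I_2 -> 'rV[R]_2 -> R) :
  (forall x, U x -> has_gradient (potential T) x (psi^~ x)) ->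
  (forall j x, U x -> has_gradient (psi j) x (fun i => h i j x)) ->
  forall x, U x -> hessian (potential T) x = \matrix_(i, j) h i j x.
Proof.
move=> Tpsi psih x Ux; apply/matrixP => i j; rewrite !mxE.
have [_ <-] := psih j x Ux.
apply: (eq_partial i oU Ux) => y Uy.
by have [_ ->] := Tpsi y Uy.
Qed.

Lemma gamma_traceE k x : gamma_trace T k x = 2^-1 * \sum_i \sum_l
  partial_mx i (hessian (potential T)) x k l
  * invmx (hessian (potential T) x) l i.
Proof.
rewrite mulr_sumr; apply: eq_bigr => i _.
by rewrite tube_gamma.unlock entry_scale entry_mul.
Qed.

End Hessians.

Lemma partial_mx_eqP (R : realType) (n : nat) (A : set 'rV[R]_n) p q
    (F : 'rV[R]_n -> 'M[R]_(p, q)) (f : 'I_p -> 'I_q -> 'rV[R]_n -> R)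
    (d : 'I_n -> 'I_p -> 'I_q -> 'rV[R]_n -> R) :
  open A -> (forall x, A x -> F x = \matrix_(k, l) f k l x) ->
  (forall k l x, A x -> has_gradient (f k l) x (fun i => d i k l x)) ->
  forall i x, A x -> partial_mx i F x = \matrix_(k, l) d i k l x.
Proof.
move=> oA Ff fd i x Ax; apply/matrixP => k l; rewrite partial_mxE mxE.
have [_ <-] := fd k l x Ax.
by apply: (eq_partial i oA Ax) => y Ay; rewrite Ff// mxE.
Qed.

Ltac gradient_step := first
  [ apply: gradient_cst | apply: gradient_coord | apply: gradientD
  | apply: gradientN | apply: gradientM | apply: gradientX ].

(** Both values of the exponential lie above its tangent at the barycenter. *)
Lemma expR_tangent_convex (R : realType) (t x y : R) : 0 <= t -> t <= 1 ->
  expR (t * y + (1 - t) * x) <= t * expR y + (1 - t) * expR x.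
Proof.
move=> t0 t1; set m := t * y + (1 - t) * x.
have tangent w : expR m * (1 + (w - m)) <= expR w.
  have -> : expR w = expR m * expR (w - m) by rewrite -expRD; congr expR; ring.
  by rewrite ler_wpM2l ?expR_ge0// expR_ge1Dx.
have := lerD (ler_wpM2l t0 (tangent y)) (ler_wpM2l (_ : 0 <= 1 - t) (tangent x)).
rewrite subr_ge0 => /(_ t1); apply: le_trans; rewrite le_eqVlt; apply/orP; left.
by apply/eqP; rewrite /m; ring.
Qed.

Section MNegTriTube.
Variable R : realType.
Local Notation T := (MNegTri R).
Local Notation U := (base T).
Implicit Types x : 'rV[R]_2.

(** In terms of the odds [negtri_p], which are the coordinates dual to [x], all
    derivatives of the potential are polynomials. *)
Definition negtri_r x : R := 1 - expR (x ord0 ord0) - expR (x ord0 ord_max).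
Definition negtri_p (j : 'I_2) x : R := expR (x ord0 j) / negtri_r x.
Local Notation p := negtri_p.

Lemma negtri_r_gt0 x : U x -> 0 < negtri_r x.
Proof. by rewrite /= /crd1 /crd2 /negtri_r -addrA -opprD subr_gt0. Qed.

Lemma negtri_p_gt0 j x : U x -> 0 < p j x.
Proof. by move=> Ux; rewrite divr_gt0 ?expR_gt0 ?negtri_r_gt0. Qed.

Lemma negtri_r_smooth : smooth_on setT negtri_r.
Proof.
have e j := smooth_expR openT (smooth_coord openT j : smooth_on _ (fun y : 'rV[R]_2 => _)).
have c1 := @smooth_cst R 2 _ openT 1.
by have := smoothD openT (smoothD openT c1 (smoothN openT (e ord0))) (smoothN openT (e ord_max)).
Qed.

Lemma MNegTri_open : open U.
Proof.
rewrite (_ : U = [set x | 0 < negtri_r x]); first exact/open_smooth_gt0/negtri_r_smooth.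
by apply/seteqP; split=> x; rewrite /= /crd1 /crd2 /negtri_r -addrA -opprD subr_gt0.
Qed.

Lemma MNegTri_smooth : smooth_on U (potential T).
Proof.
have oU := MNegTri_open.
apply: (@eq_smooth_on _ _ _ (fun x => - ln (negtri_r x))) => //.
apply/smoothN => //; apply: smooth_ln => //; first exact: negtri_r_gt0.
exact: smooth_on_sub (@subsetT _ _) negtri_r_smooth.
Qed.

Lemma gradient_negtri_r x : has_gradient negtri_r x (fun k => - expR (x ord0 k)).
Proof.
apply: has_gradient_ext; last first.
  repeat first [gradient_step | apply: gradient_expR].
by move=> k; case: (I2P k) => -> /=; rewrite ?eqxx /=; ring.
Qed.

Lemma gradient_negtri_p j x : U x ->
  has_gradient (p j) x (fun k => (k == j)%:R * p j x + p k x * p j x).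
Proof.
move=> Ux; have r0 := lt0r_neq0 (negtri_r_gt0 Ux).
apply: has_gradient_ext (gradientM (gradient_expR (gradient_coord j x))
  (gradientV r0 (gradient_negtri_r x))) => k.
by rewrite /p; field.
Qed.

Lemma gradient_MNegTri x : U x -> has_gradient (potential T) x (p^~ x).
Proof.
move=> Ux; have r0 := negtri_r_gt0 Ux.
apply: has_gradient_ext (gradientN (gradient_ln r0 (gradient_negtri_r x))) => k.
by rewrite mulrN opprK mulrC.
Qed.

Lemma hessian_MNegTri x : U x -> hessian (potential T) x
  = \matrix_(i, j) ((i == j)%:R * p j x + p i x * p j x).
Proof.
apply: (hessianE (h := fun i j x => (i == j)%:R * p j x + p i x * p j x)
  MNegTri_open gradient_MNegTri) => j y.
exact: gradient_negtri_p.
Qed.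

Lemma MNegTri_posdef x : U x -> forall v : 'rV[R]_2, v != 0 ->
  0 < (v *m hessian (potential T) x *m v^T) ord0 ord0.
Proof.
move=> Ux; rewrite hessian_MNegTri//.
have [p0 p1] := (negtri_p_gt0 ord0 Ux, negtri_p_gt0 ord_max Ux).
apply: posdef2; rewrite !mxE /=.
- by rewrite mul1r addr_gt0// mulr_gt0.
- by ring.
- have -> : (1 * p ord0 x + p ord0 x * p ord0 x) *
    (1 * p ord_max x + p ord_max x * p ord_max x)
    - (0 * p ord_max x + p ord0 x * p ord_max x) ^+ 2
    = p ord0 x * p ord_max x * (1 + p ord0 x + p ord_max x) by ring.
  by apply: mulr_gt0; [exact: mulr_gt0|rewrite !addr_gt0].
Qed.

Lemma MNegTri_kahler : is_kahler_tube T.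
Proof.
have ln4 : expR (ln (4^-1 : R)) = 4^-1 by rewrite lnK// posrE.
have nonempty : U !=set0.
  by exists (const_mx (ln 4^-1)); rewrite /= /crd1 /crd2 !mxE ln4; lra.
split; [exact: MNegTri_open|exact: nonempty| |exact: MNegTri_smooth
       |exact: MNegTri_posdef].
apply: convex_connected => // x y t; rewrite /= /crd1 /crd2 => Ux Uy /andP[t0 t1].
have cvx i : expR ((t *: (y - x) + x) ord0 i)
    <= t * expR (y ord0 i) + (1 - t) * expR (x ord0 i).
  have -> : (t *: (y - x) + x) ord0 i = t * y ord0 i + (1 - t) * x ord0 i.
    by rewrite !mxE; ring.
  by apply: expR_tangent_convex; rewrite ?t0.
apply: (le_lt_trans (lerD (cvx ord0) (cvx ord_max))).
rewrite addrACA -!mulrDr; move: Ux Uy.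
set a := expR _ + expR _; set b := expR _ + expR _; clear -t0 t1 => Ux Uy.
have t1' : 0 <= 1 - t by rewrite subr_ge0.
have [ab|/ltW ab] := leP a b.
  by apply: le_lt_trans Uy; have := ler_wpM2l t1' ab; lra.
by apply: le_lt_trans Ux; have := ler_wpM2l t0 ab; lra.
Qed.

Lemma MNegTri_spaceform x i j k l : U x ->
  partial_mx i (partial_mx j (hessian (potential T))) x k l
  - (partial_mx i (hessian (potential T)) x *m invmx (hessian (potential T) x)
     *m partial_mx j (hessian (potential T)) x) k l
  = 2 * 2^-1 * (hessian (potential T) x i j * hessian (potential T) x k l
                + hessian (potential T) x i l * hessian (potential T) x k j).
Proof.
move=> Ux; have oU := MNegTri_open.
pose dp i j x := (i == j)%:R * p j x + p i x * p j x.
have gp m y (Uy : U y) : has_gradient (p m) y (fun a => dp a m y).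
  exact: gradient_negtri_p.
have H1 := partial_mx_eqP oU hessian_MNegTri (fun k l y Uy =>
  gradientD (gradientM (gradient_cst _ _) (gp l y Uy))
            (gradientM (gp k y Uy) (gp l y Uy))).
have gdp a m y (Uy : U y) := gradientD (gradientM (gradient_cst (a == m)%:R y)
  (gp m y Uy)) (gradientM (gp a y Uy) (gp m y Uy)).
have H2 := partial_mx_eqP oU (H1 j) (fun k l y Uy => gradientD
  (gradientD (gradientM (gradient_cst _ _) (gp l y Uy))
     (gradientM (gradient_cst _ _) (gdp j l y Uy)))
  (gradientD (gradientM (gdp j k y Uy) (gp l y Uy))
     (gradientM (gp k y Uy) (gdp j l y Uy)))).
have [p0 p1] := (negtri_p_gt0 ord0 Ux, negtri_p_gt0 ord_max Ux).
have invH : invmx (hessian (potential T) x) = \matrix_(i, j)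
    ((i == j)%:R / p j x - (1 + p ord0 x + p ord_max x)^-1).
  apply: invmx_eq; rewrite hessian_MNegTri//; apply/matrixP => a b.
  rewrite entry_mul sum2 !mxE.
  have S0 : 1 + p ord0 x + p ord_max x != 0 by rewrite gt_eqF// !addr_gt0.
  have [q0 q1] := (lt0r_neq0 p0, lt0r_neq0 p1).
  by case: (I2P a) => ->; case: (I2P b) => -> /=; field; rewrite ?S0 ?q0 ?q1.
rewrite H2// invH !H1// hessian_MNegTri//.
rewrite !entry_mul !sum2 !entry_mul !sum2 !mxE /dp.
have S0 : 1 + p ord0 x + p ord_max x != 0 by rewrite gt_eqF// !addr_gt0.
move: (lt0r_neq0 p0) (lt0r_neq0 p1) S0.
have [q qE] : exists q, forall m, p m x = q m by exists (p^~ x).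
rewrite !qE => q0 q1 S0.
by case: (I2P i) => ->; case: (I2P j) => ->; case: (I2P k) => ->;
  case: (I2P l) => -> /=; field; rewrite ?S0 ?q0 ?q1.
Qed.

Lemma MNegTri_constant_hsc : constant_negative_hsc (tube_surface T).
Proof.
exists (- 2 * 2^-1); first by rewrite pmulr_llt0 ?invr_gt0// oppr_lt0.
apply: (constant_holomorphic_curvature MNegTri_open MNegTri_smooth).
- by move=> x Ux; apply: posdef_unitmx; exact: MNegTri_posdef.
- by move=> x v Ux; exact: MNegTri_posdef.
- exact: MNegTri_spaceform.
Qed.

End MNegTriTube.

Section WNormalTube.
Variable R : realType.
Local Notation T := (WNormal R).
Local Notation U := (base T).
Local Notation HT := (hessian (potential T)).
Implicit Types x : 'rV[R]_2.

(** With the height [wnormal_d] above the parabola, [wnormal_q] and [wnormal_e]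
    are its gradient and its Hessian; all derivatives of the potential are
    polynomials in these and in the inverse [wnormal_b] of the height. *)
Definition wnormal_d x : R := x ord0 ord_max - x ord0 ord0 ^+ 2.
Definition wnormal_b x : R := (wnormal_d x)^-1.
Definition wnormal_q (i : 'I_2) x : R :=
  if i == ord0 then - 2 * x ord0 ord0 else 1.
Definition wnormal_e (i j : 'I_2) : R := if (i == ord0) && (j == ord0) then - 2 else 0.
Local Notation b := wnormal_b.
Local Notation q := wnormal_q.
Local Notation e := wnormal_e.

Lemma wnormal_d_gt0 x : U x -> 0 < wnormal_d x.
Proof. by rewrite /= /crd1 /crd2 /wnormal_d subr_gt0. Qed.

Lemma wnormal_b_gt0 x : U x -> 0 < b x.
Proof. by move=> /wnormal_d_gt0; rewrite invr_gt0. Qed.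

Lemma wnormal_d_smooth : smooth_on setT wnormal_d.
Proof.
have c j := @smooth_coord R 2 _ openT j.
exact: (smoothD openT (c ord_max) (smoothN openT (smoothX openT 2 (c ord0)))).
Qed.

Lemma WNormal_open : open U.
Proof.
rewrite (_ : U = [set x | 0 < wnormal_d x]); first exact/open_smooth_gt0/wnormal_d_smooth.
by apply/seteqP; split=> x; rewrite /= /crd1 /crd2 /wnormal_d subr_gt0.
Qed.

Lemma WNormal_smooth : smooth_on U (potential T).
Proof.
have oU := WNormal_open.
apply/smoothN/smoothM => //; first exact: smooth_cst.
apply: smooth_ln => //; first exact: wnormal_d_gt0.
exact: smooth_on_sub (@subsetT _ _) wnormal_d_smooth.
Qed.

Lemma gradient_wnormal_d x : has_gradient wnormal_d x (q^~ x).
Proof.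
apply: has_gradient_ext; last by repeat gradient_step.
by move=> k; case: (I2P k) => -> /=; rewrite /q /=; ring.
Qed.

Lemma gradient_wnormal_q j x : has_gradient (q j) x (e^~ j).
Proof.
case: (I2P j) => ->; rewrite /q /=.
  apply: has_gradient_ext; last by repeat gradient_step.
  by move=> k; case: (I2P k) => -> /=; rewrite /e /=; ring.
apply: has_gradient_ext; last by repeat gradient_step.
by move=> k; rewrite /e andbF.
Qed.

Lemma gradient_wnormal_b x : U x ->
  has_gradient b x (fun k => - (b x * b x) * q k x).
Proof.
move=> Ux; have d0 := lt0r_neq0 (wnormal_d_gt0 Ux).
by apply: has_gradient_ext (gradientV d0 (gradient_wnormal_d x)) => k.
Qed.

Lemma gradient_WNormal x : U x ->
  has_gradient (potential T) x (fun k => - 2^-1 * (b x * q k x)).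
Proof.
move=> Ux; have d0 := wnormal_d_gt0 Ux.
apply: has_gradient_ext (gradientN (gradientM (gradient_cst 2^-1 x)
  (gradient_ln d0 (gradient_wnormal_d x)))) => k.
by rewrite mul0r add0r mulNr.
Qed.

Lemma hessian_WNormal x : U x -> HT x
  = \matrix_(i, j) (2^-1 * (b x * b x * q i x * q j x - b x * e i j)).
Proof.
apply: (hessianE (h := fun i j x =>
  (2^-1 * (b x * b x * q i x * q j x - b x * e i j)))
  WNormal_open gradient_WNormal) => j y Uy.
apply: has_gradient_ext (gradientM (gradient_cst _ _)
  (gradientM (gradient_wnormal_b Uy) (gradient_wnormal_q j y))) => k.
by field.
Qed.

Lemma WNormal_posdef x : U x -> forall v : 'rV[R]_2, v != 0 ->
  0 < (v *m HT x *m v^T) ord0 ord0.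
Proof.
move=> Ux; rewrite hessian_WNormal//; have b0 := wnormal_b_gt0 Ux.
apply: posdef2; rewrite !mxE /q /e /=.
- set u := x _ _; have -> : 2^-1 * (b x * b x * (- 2 * u) * (- 2 * u) - b x * -2)
    = b x + 2 * (b x * u) ^+ 2 by field.
  by rewrite ltr_pwDl// mulr_ge0// sqr_ge0.
- by ring.
- set u := x _ _.
  rewrite [ltRHS](_ : _ = b x ^+ 3 / 2); last by field.
  by rewrite divr_gt0// exprn_gt0.
Qed.

Lemma WNormal_kahler : is_kahler_tube T.
Proof.
have nonempty : U !=set0.
  exists (delta_mx ord0 ord_max).
  by rewrite /= /crd1 /crd2 !mxE /= expr0n ltr01.
split; [exact: WNormal_open|exact: nonempty| |exact: WNormal_smooth
       |exact: WNormal_posdef].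
apply: convex_connected => // x y t; rewrite /= /crd1 /crd2 !mxE => Ux Uy /andP[t0 t1].
move: Ux Uy.
set x0 := x _ _; set x1 := x _ _; set y0 := y _ _; set y1 := y _ _.
clear -t0 t1 => Ux Uy.
have t1' : 0 <= 1 - t by rewrite subr_ge0.
have [t00|tgt0] := eqVneq t 0.
  by rewrite t00 !mul0r !add0r.
have tp : 0 < t by rewrite lt_neqAle eq_sym tgt0.
rewrite -subr_gt0.
have -> : t * (y1 - x1) + x1 - (t * (y0 - x0) + x0) ^+ 2
  = t * (y1 - y0 ^+ 2) + (1 - t) * (x1 - x0 ^+ 2)
    + t * (1 - t) * (y0 - x0) ^+ 2 by ring.
apply: ltr_wpDr; first by apply: mulr_ge0; [exact: mulr_ge0|exact: sqr_ge0].
apply: ltr_pwDl; first by rewrite mulr_gt0 ?subr_gt0.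
by rewrite mulr_ge0// subr_ge0 ltW.
Qed.

Lemma WNormal_spaceform x i j k l : U x ->
  partial_mx i (partial_mx j HT) x k l
  - (partial_mx i HT x *m invmx (HT x) *m partial_mx j HT x) k l
  = 2 * 1 * (HT x i j * HT x k l + HT x i l * HT x k j).
Proof.
move=> Ux; have oU := WNormal_open.
have gb := gradient_wnormal_b; have gq := gradient_wnormal_q.
have gbb y (Uy : U y) := gradientM (gb y Uy) (gb y Uy).
have H1 i' y (Uy : U y) : partial_mx i' HT y = \matrix_(k, l)
    (- (b y * b y * b y * q i' y * q k y * q l y) + 2^-1 * (b y * b y) *
       (e i' k * q l y + q k y * e i' l + q i' y * e k l)).
  move: i' y Uy.
  apply: (partial_mx_eqP (d := fun i' k l y => - (b y * b y * b y * q i' y * q k y * q l y)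
     + 2^-1 * (b y * b y) * (e i' k * q l y + q k y * e i' l + q i' y * e k l))
    oU hessian_WNormal) => k' l' y Uy.
  apply: has_gradient_ext; last first.
    repeat first [gradient_step|exact: gb|exact: gq].
  by move=> a /=; field.
have H2 i' y (Uy : U y) : partial_mx i' (partial_mx j HT) y = \matrix_(k, l)
    (3 * (b y * b y * b y * b y * q i' y * q j y * q k y * q l y)
     - b y * b y * b y * (e i' j * q k y * q l y + q j y * e i' k * q l y
                          + q j y * q k y * e i' l)
     - b y * b y * b y * q i' y * (e j k * q l y + q k y * e j l + q j y * e k l)
     + 2^-1 * (b y * b y) * (e j k * e i' l + e i' k * e j l + e i' j * e k l)).
  move: i' y Uy.
  apply: (partial_mx_eqP (d := fun i' k l y =>
     3 * (b y * b y * b y * b y * q i' y * q j y * q k y * q l y)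
     - b y * b y * b y * (e i' j * q k y * q l y + q j y * e i' k * q l y
                          + q j y * q k y * e i' l)
     - b y * b y * b y * q i' y * (e j k * q l y + q k y * e j l + q j y * e k l)
     + 2^-1 * (b y * b y) * (e j k * e i' l + e i' k * e j l + e i' j * e k l))
    oU (H1 j)) => k' l' y Uy.
  apply: has_gradient_ext; last first.
    repeat first [gradient_step|exact: gb|exact: gq].
  by move=> a /=; field.
have b0 := lt0r_neq0 (wnormal_b_gt0 Ux); pose u := x ord0 ord0.
have invH : invmx (HT x) = \matrix_(i, j)
    (if i == ord0 then if j == ord0 then (b x)^-1 else 2 * u / b x
     else if j == ord0 then 2 * u / b x
     else 2 / b x ^+ 2 + 4 * u ^+ 2 / b x).
  apply: invmx_eq; rewrite hessian_WNormal//; apply/matrixP => a c.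
  rewrite entry_mul sum2 !mxE /q /e -/u.
  by case: (I2P a) => ->; case: (I2P c) => -> /=; field.
rewrite H2// invH !H1// hessian_WNormal//.
rewrite !entry_mul !sum2 !entry_mul !sum2 !mxE /=.
rewrite /q /e -/u; clearbody u; move: (b x) b0 => {invH} B B0.
by case: (I2P i) => ->; case: (I2P j) => ->; case: (I2P k) => ->;
  case: (I2P l) => -> /=; field.
Qed.

Lemma WNormal_constant_hsc : constant_negative_hsc (tube_surface T).
Proof.
exists (- 2 * 1); first by rewrite mulr1 oppr_lt0.
apply: (constant_holomorphic_curvature WNormal_open WNormal_smooth).
- by move=> x Ux; apply: posdef_unitmx; exact: WNormal_posdef.
- by move=> x v Ux; exact: WNormal_posdef.
- exact: WNormal_spaceform.
Qed.

End WNormalTube.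

Section MNormalTube.
Variable R : realType.
Local Notation T := (MNormal R).
Local Notation U := (base T).
Local Notation HT := (hessian (potential T)).
Implicit Types x : 'rV[R]_2.

Let u x : R := x ord0 ord0.
Let s x : R := (x ord0 ord_max)^-1.

Lemma MNormal_open : open U.
Proof.
have c := smoothN openT (@smooth_coord R 2 _ openT ord_max).
have := open_smooth_gt0 c.
by congr open; apply/seteqP; split=> x; rewrite /= oppr_gt0.
Qed.

Let arg_gt0 x : U x -> 0 < - (x ord0 ord_max / pi).
Proof. by move=> Ux; rewrite -mulNr divr_gt0 ?oppr_gt0 ?pi_gt0. Qed.

Lemma MNormal_smooth : smooth_on U (potential T).
Proof.
have oU := MNormal_open; have c j := smooth_coord oU j.
have k (a : R) := smooth_cst oU a.
apply: smoothD => //; apply: smoothN => //.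
  apply: smoothM (smoothX oU 2 (c ord0)) _ => //.
  apply: smoothV (smoothM oU (k 4) (c ord_max)) => // x Ux.
  by rewrite mulf_neq0// lt_eqF.
apply: smoothM (k 2^-1) _ => //; apply: smooth_ln arg_gt0 _ => //.
exact: (smoothN oU (smoothM oU (c ord_max) (k pi^-1))).
Qed.

Let gradient_u x : has_gradient u x (fun k => (k == ord0)%:R).
Proof. exact: gradient_coord. Qed.

Let gradient_s x : U x -> has_gradient s x (fun k => - (s x * s x) * (k == ord_max)%:R).
Proof.
move=> Ux; have x0 : x ord0 ord_max != 0 by rewrite lt_eqF.
by apply: has_gradient_ext (gradientV x0 (gradient_coord ord_max x)) => k.
Qed.

(** The gradient, the Hessian [mnormal_h] and the third derivatives [mnormal_dh]
    of the potential are polynomials in the first coordinate [u] and in the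
    inverse [s] of the second one. *)
Definition mnormal_psi (j : 'I_2) x : R :=
  if j == ord0 then - 2^-1 * (u x * s x)
  else 4^-1 * (u x * u x * (s x * s x)) - 2^-1 * s x.

Lemma gradient_MNormal x : U x -> has_gradient (potential T) x (mnormal_psi^~ x).
Proof.
move=> Ux; have x0 : x ord0 ord_max != 0 by rewrite lt_eqF.
have p0 : pi != 0 :> R by rewrite gt_eqF// pi_gt0.
apply: has_gradient_ext; last first.
  apply: gradientD.
    apply: gradientN; apply: gradientM; first exact/gradientX/gradient_coord.
    apply: gradientV; last by repeat gradient_step.
    by rewrite mulf_neq0// pnatr_eq0.
  apply: gradientN; apply: gradientM; first exact: gradient_cst.
  by apply: gradient_ln; [exact: arg_gt0|repeat gradient_step].
by move=> k; case: (I2P k) => -> /=; rewrite /mnormal_psi /s /u /crd1 /crd2 /=;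
  move: (@pi R) p0 => P p0; field; rewrite ?x0 ?p0.
Qed.

Definition mnormal_h (i j : 'I_2) x : R :=
  if i == ord0 then if j == ord0 then - 2^-1 * s x
                    else 2^-1 * (u x * (s x * s x))
  else if j == ord0 then 2^-1 * (u x * (s x * s x))
  else 2^-1 * (s x * s x) - 2^-1 * (u x * u x * (s x * s x * s x)).

Lemma hessian_MNormal x : U x -> HT x = \matrix_(i, j) mnormal_h i j x.
Proof.
apply: (hessianE (h := mnormal_h) MNormal_open gradient_MNormal) => j y Uy.
have gs := gradient_s Uy; have gu := gradient_u y.
case: (I2P j) => ->; rewrite /mnormal_psi /=;
  (apply: has_gradient_ext;
    last by repeat first [gradient_step|exact: gs|exact: gu]);
  by move=> k; case: (I2P k) => -> /=; rewrite /mnormal_h /=; field.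
Qed.

Lemma MNormal_posdef x : U x -> forall v : 'rV[R]_2, v != 0 ->
  0 < (v *m HT x *m v^T) ord0 ord0.
Proof.
move=> Ux; rewrite hessian_MNormal//.
have s0 : s x < 0 by rewrite invr_lt0.
apply: posdef2; rewrite !mxE /mnormal_h //=.
- by rewrite mulNr oppr_gt0 pmulr_rlt0.
- rewrite [ltRHS](_ : _ = 4^-1 * (s x * s x * - s x)); last by field.
  by rewrite mulr_gt0// mulr_gt0 ?oppr_gt0// nmulr_rgt0.
Qed.

Lemma MNormal_kahler : is_kahler_tube T.
Proof.
have nonempty : U !=set0.
  by exists (const_mx (- 1)); rewrite /= /crd2 !mxE oppr_lt0.
split; [exact: MNormal_open|exact: nonempty| |exact: MNormal_smooth
       |exact: MNormal_posdef].
apply: convex_connected => // x y t; rewrite /= /crd2 !mxE => Ux Uy /andP[t0 t1].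
rewrite -oppr_gt0.
have -> : - (t * (y ord0 ord_max - x ord0 ord_max) + x ord0 ord_max)
  = t * - y ord0 ord_max + (1 - t) * - x ord0 ord_max by ring.
have [->|tn1] := eqVneq t 1.
  by rewrite subrr mul0r addr0 mul1r oppr_gt0.
apply: ltr_wpDl; first by rewrite mulr_ge0// oppr_ge0 ltW.
by rewrite mulr_gt0 ?oppr_gt0// subr_gt0 lt_neqAle tn1.
Qed.

Let invH x : U x -> invmx (HT x) = \matrix_(i, j)
  (if i == ord0 then if j == ord0 then 2 * (u x * u x - (s x)^-1)
                     else 2 * (u x / s x)
   else if j == ord0 then 2 * (u x / s x) else 2 / s x ^+ 2).
Proof.
move=> Ux; have s0 : s x != 0 by rewrite invr_eq0 lt_eqF.
apply: invmx_eq; rewrite hessian_MNormal//; apply/matrixP => a c.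
rewrite entry_mul sum2 !mxE /mnormal_h.
by case: (I2P a) => ->; case: (I2P c) => -> /=; field.
Qed.

Definition mnormal_dh (k l : 'I_2) (i : 'I_2) x : R :=
  if i == ord0 then
    if k == ord0 then if l == ord0 then 0 else 2^-1 * (s x * s x)
    else if l == ord0 then 2^-1 * (s x * s x) else - (u x * (s x * s x * s x))
  else
    if k == ord0 then if l == ord0 then 2^-1 * (s x * s x)
                      else - (u x * (s x * s x * s x))
    else if l == ord0 then - (u x * (s x * s x * s x))
    else - (s x * s x * s x) + 3 / 2 * (u x * u x * (s x * s x * s x * s x)).

Lemma gradient_mnormal_h k l x : U x ->
  has_gradient (mnormal_h k l) x (fun i => mnormal_dh k l i x).
Proof.
move=> Ux; have gs := gradient_s Ux; have gu := gradient_u x.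
case: (I2P k) => ->; case: (I2P l) => ->; rewrite /mnormal_h /=;
  (apply: has_gradient_ext;
    last by repeat first [gradient_step|exact: gs|exact: gu]);
  by move=> i; case: (I2P i) => -> /=; rewrite /mnormal_dh /=; field.
Qed.

Lemma gamma_trace_MNormal k x : U x ->
  gamma_trace T k x = - (3 / 2) * ((k == ord_max)%:R * s x).
Proof.
move=> Ux; have s0 : s x != 0 by rewrite invr_eq0 lt_eqF.
have H1 := partial_mx_eqP (d := fun i k l y => mnormal_dh k l i y)
  MNormal_open hessian_MNormal gradient_mnormal_h.
rewrite gamma_traceE !sum2 !H1// invH// !mxE /mnormal_dh.
by case: (I2P k) => -> /=; field.
Qed.

Lemma scalar_curvature_MNormal z : tube_domain T z ->
  scalar_curvature (tube_metric T) z = - 6.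
Proof.
move=> Dz; rewrite (scalar_curvature_tube MNormal_open MNormal_smooth)//; last first.
  by move=> x Ux; apply: posdef_unitmx; exact: MNormal_posdef.
set x := re2 z; have Ux : U x by [].
have s0 : s x != 0 by rewrite invr_eq0 lt_eqF.
have dt j k : partial j (gamma_trace T k) x
    = 3 / 2 * (k == ord_max)%:R * (j == ord_max)%:R * (s x * s x).
  transitivity (partial j (fun y => - (3 / 2) * ((k == ord_max)%:R * s y)) x).
    by apply: (eq_partial j MNormal_open Ux) => y; exact: gamma_trace_MNormal.
  have [_ ->] := gradientM (gradient_cst (- (3 / 2)) x)
    (gradientM (gradient_cst (k == ord_max)%:R x) (gradient_s Ux)).
  by ring.
rewrite !sum2 !dt invH// !mxE /=; field.
exact: s0.
Qed.

End MNormalTube.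

Section WNegTriTube.
Variable R : realType.
Local Notation T := (WNegTri R).
Local Notation U := (base T).
Local Notation HT := (hessian (potential T)).
Implicit Types x : 'rV[R]_2.

Definition wnegtri_s x : R := 1 + x ord0 ord0 + x ord0 ord_max.
Local Notation S := wnegtri_s.

Lemma wnegtri_gt0 j x : U x -> 0 < x ord0 j.
Proof. by move=> [? ?]; case: (I2P j) => ->. Qed.

Lemma wnegtri_s_gt0 x : U x -> 0 < S x.
Proof. by move=> [? ?]; rewrite /S !addr_gt0. Qed.

Lemma WNegTri_open : open U.
Proof.
have c j := open_smooth_gt0 (@smooth_coord R 2 _ openT j).
by have := openI (c ord0) (c ord_max).
Qed.

Lemma WNegTri_smooth : smooth_on U (potential T).
Proof.
have oU := WNegTri_open; have c j := smooth_coord oU j.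
have Ssm : smooth_on U S.
  exact: (smoothD oU (smoothD oU (smooth_cst oU 1) (c ord0)) (c ord_max)).
have l j := smooth_ln oU (wnegtri_gt0 j) (c j).
have lS := smooth_ln oU wnegtri_s_gt0 Ssm.
exact: (smoothD oU (smoothD oU (smoothM oU (c ord0) (l ord0))
  (smoothM oU (c ord_max) (l ord_max))) (smoothN oU (smoothM oU Ssm lS))).
Qed.

Lemma gradient_wnegtri_s x : has_gradient S x (fun=> 1).
Proof.
apply: has_gradient_ext; last by repeat gradient_step.
by move=> k; case: (I2P k) => -> /=; rewrite ?add0r ?addr0.
Qed.

Let gradient_lnS x : U x -> has_gradient (fun y => ln (S y)) x (fun=> (S x)^-1).
Proof.
move=> Ux.
apply: has_gradient_ext (gradient_ln (wnegtri_s_gt0 Ux) (gradient_wnegtri_s x)) => k.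
by rewrite mulr1.
Qed.

Let gradient_SV x : U x ->
  has_gradient (fun y => (S y)^-1) x (fun=> - ((S x)^-1 * (S x)^-1)).
Proof.
move=> Ux; have S0 := lt0r_neq0 (wnegtri_s_gt0 Ux).
by apply: has_gradient_ext (gradientV S0 (gradient_wnegtri_s x)) => k; rewrite mulr1.
Qed.

Let gradient_ln_coord j x : U x -> has_gradient (fun y => ln (y ord0 j)) x
  (fun k => (x ord0 j)^-1 * (k == j)%:R).
Proof. by move=> Ux; apply: gradient_ln (gradient_coord j x); exact: wnegtri_gt0. Qed.

Let gradient_coordV j x : U x -> has_gradient (fun y => (y ord0 j)^-1) x
  (fun k => - ((x ord0 j)^-1 * (x ord0 j)^-1) * (k == j)%:R).
Proof.
move=> Ux; have x0 := lt0r_neq0 (wnegtri_gt0 j Ux).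
by apply: has_gradient_ext (gradientV x0 (gradient_coord j x)) => k.
Qed.

Lemma gradient_WNegTri x : U x ->
  has_gradient (potential T) x (fun k => ln (x ord0 k) - ln (S x)).
Proof.
move=> Ux; have x0 j := lt0r_neq0 (wnegtri_gt0 j Ux).
have S0 := lt0r_neq0 (wnegtri_s_gt0 Ux).
apply: has_gradient_ext (gradientD (gradientD
    (gradientM (gradient_coord ord0 x) (gradient_ln_coord ord0 Ux))
    (gradientM (gradient_coord ord_max x) (gradient_ln_coord ord_max Ux)))
  (gradientN (gradientM (gradient_wnegtri_s x) (gradient_lnS Ux)))) => k.
by case: (I2P k) => -> /=; field; rewrite S0 !x0.
Qed.

Lemma hessian_WNegTri x : U x -> HT x
  = \matrix_(i, j) ((i == j)%:R * (x ord0 j)^-1 - (S x)^-1).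
Proof.
apply: (hessianE (h := fun i j x => (i == j)%:R * (x ord0 j)^-1 - (S x)^-1)
  WNegTri_open gradient_WNegTri) => j y Uy.
apply: has_gradient_ext (gradientD (gradient_ln_coord j Uy)
  (gradientN (gradient_lnS Uy))) => k.
by rewrite mulrC.
Qed.

Lemma WNegTri_posdef x : U x -> forall v : 'rV[R]_2, v != 0 ->
  0 < (v *m HT x *m v^T) ord0 ord0.
Proof.
move=> Ux; rewrite hessian_WNegTri//.
have [p0 p1] := (wnegtri_gt0 ord0 Ux, wnegtri_gt0 ord_max Ux).
have Sp := wnegtri_s_gt0 Ux; have S0 := lt0r_neq0 Sp.
have [q0 q1] := (lt0r_neq0 p0, lt0r_neq0 p1).
apply: posdef2; rewrite !mxE /=.
- by rewrite mul1r subr_gt0 ltf_pV2// /S addrAC ltrDr addr_gt0.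
- by ring.
- rewrite [ltRHS](_ : _ = (x ord0 ord0 * x ord0 ord_max * S x)^-1); last first.
    by move: S0; rewrite /S => S0; field; rewrite S0 q0 q1.
  by rewrite invr_gt0 mulr_gt0// mulr_gt0.
Qed.

Lemma WNegTri_kahler : is_kahler_tube T.
Proof.
have nonempty : U !=set0.
  by exists (const_mx 1); rewrite /= /crd1 /crd2 !mxE ltr01.
split; [exact: WNegTri_open|exact: nonempty| |exact: WNegTri_smooth
       |exact: WNegTri_posdef].
apply: convex_connected => // x y t Ux Uy /andP[t0 t1].
have pos j : 0 < (t *: (y - x) + x) ord0 j.
  have [px py] := (wnegtri_gt0 j Ux, wnegtri_gt0 j Uy).
  rewrite !mxE (_ : _ + _ = t * y ord0 j + (1 - t) * x ord0 j); last by ring.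
  have [->|tn1] := eqVneq t 1; first by rewrite subrr mul0r addr0 mul1r.
  apply: ltr_wpDl; first by rewrite mulr_ge0// ltW.
  by rewrite mulr_gt0// subr_gt0 lt_neqAle tn1.
exact: (conj (pos ord0) (pos ord_max)).
Qed.

Let invH x : U x -> invmx (HT x)
  = \matrix_(i, j) ((i == j)%:R * x ord0 j + x ord0 i * x ord0 j).
Proof.
move=> Ux; have x0 j := lt0r_neq0 (wnegtri_gt0 j Ux).
have S0 := lt0r_neq0 (wnegtri_s_gt0 Ux).
apply: invmx_eq; rewrite hessian_WNegTri//; apply/matrixP => a c.
move: S0; rewrite entry_mul sum2 !mxE /S => S0.
by case: (I2P a) => ->; case: (I2P c) => -> /=; field; rewrite S0 ?x0.
Qed.

Lemma gamma_trace_WNegTri k x : U x ->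
  gamma_trace T k x = - 2^-1 * ((x ord0 k)^-1 + (S x)^-1).
Proof.
move=> Ux; have x0 j := lt0r_neq0 (wnegtri_gt0 j Ux).
have S0 := lt0r_neq0 (wnegtri_s_gt0 Ux).
have H1 := partial_mx_eqP WNegTri_open hessian_WNegTri (fun k l y Uy =>
  gradientD (gradientM (gradient_cst (k == l)%:R y) (gradient_coordV l Uy))
    (gradientN (gradient_SV Uy))).
move: S0; rewrite gamma_traceE !sum2 !H1// invH// !mxE /S => S0.
by case: (I2P k) => -> /=; field; rewrite S0 !x0.
Qed.

Lemma scalar_curvature_WNegTri z : tube_domain T z ->
  scalar_curvature (tube_metric T) z
  = - (3 + (re2 z ord0 ord0)^-1 + (re2 z ord0 ord_max)^-1 - (S (re2 z))^-1).
Proof.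
move=> Dz; rewrite (scalar_curvature_tube WNegTri_open WNegTri_smooth)//; last first.
  by move=> x Ux; apply: posdef_unitmx; exact: WNegTri_posdef.
have Ux : U (re2 z) by []; move: (re2 z) Ux => x Ux.
have x0 j := lt0r_neq0 (wnegtri_gt0 j Ux).
have S0 := lt0r_neq0 (wnegtri_s_gt0 Ux).
have dt j k : partial j (gamma_trace T k) x
    = 2^-1 * ((j == k)%:R * ((x ord0 k)^-1 * (x ord0 k)^-1) + (S x)^-1 * (S x)^-1).
  transitivity (partial j (fun y => - 2^-1 * ((y ord0 k)^-1 + (S y)^-1)) x).
    by apply: (eq_partial j WNegTri_open Ux) => y; exact: gamma_trace_WNegTri.
  have [_ ->] := gradientM (gradient_cst (- 2^-1) x)
    (gradientD (gradient_coordV k Ux) (gradient_SV Ux)).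
  by ring.
move: S0; rewrite !sum2 !dt invH// !mxE /S /= => S0; field.
by rewrite S0 !x0.
Qed.

(** As a function of the first coordinate [a] of the base alone, the scalar
    curvature is the sum of a constant and of [1 / (1 + a + b) - 1 / a], which is
    strictly increasing. *)
Lemma scalar_curvature_WNegTri_nonconstant (A : set 'C2[R]) (s : R) :
  open A -> A !=set0 -> A `<=` tube_domain T ->
  ~ (forall z, A z -> scalar_curvature (tube_metric T) z = s).
Proof.
move=> oA [z Az] AD As.
pose e : 'C2[R] := delta_mx ord0 (lshift 2 ord0).
have : \forall w \near z, A w by exact: open_nbhs_nbhs.
have cvg : (fun t : R => t *: e + z) @ (0 : R) --> z.
  have : (fun t : R => t *: e + z) @ (0 : R) --> 0 *: e + z.
    by apply: cvgD; [exact: scalel_continuous|exact: cvg_cst].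
  by rewrite scale0r add0r.
move=> /cvg nA; have [r /= r0 rA] := (nbhs_normP _ _).1 nA.
pose h := r / 2.
have h0 : 0 < h by rewrite divr_gt0.
have Ah : A (h *: e + z).
  by apply: rA; rewrite /= sub0r normrN gtr0_norm// ltr_pdivrMr// ltr_pMr// ltr1n.
have reh : re2 (h *: e + z) = h *: delta_mx ord0 ord0 + re2 z.
  by rewrite -(re2_delta_l R ord0) /re2 linearP.
have := As _ Ah; rewrite -(As _ Az) !scalar_curvature_WNegTri; [|exact: AD|exact: AD].
move/oppr_inj; have : U (re2 z) := AD _ Az.
rewrite reh; move: (re2 z) => x Ux; rewrite /S !mxE /= !mulr0 !add0r !mulr1.
move: (wnegtri_gt0 ord0 Ux) (wnegtri_gt0 ord_max Ux).
move: (x ord0 ord0) (x ord0 ord_max) => a b a0 b0.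
have ha : 0 < h + a by rewrite addr_gt0.
have s1 : 0 < 1 + (h + a) + b by rewrite !addr_gt0.
have s2 : 0 < 1 + a + b by rewrite !addr_gt0.
move=> /eqP; rewrite -subr_eq0.
rewrite (_ : _ - _ = - (h * (1 + b) * (1 + a + b + (h + a))
  / ((h + a) * a * (1 + (h + a) + b) * (1 + a + b)))); last first.
  by field; rewrite !lt0r_neq0.
rewrite oppr_eq0 mulf_eq0 invr_eq0 !mulf_eq0 !(gt_eqF ha, gt_eqF a0, gt_eqF s1, gt_eqF s2).
by rewrite !gt_eqF// !addr_gt0.
Qed.

End WNegTriTube.

Section Rescaling.
Variables (R : realType) (n : nat) (A : set 'rV[R]_n).
Variables (g : 'rV[R]_n -> 'M[R]_n) (c : R).
Hypotheses (oA : open A) (gA : metric_on A g) (c0 : c != 0).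

Let cg x := c *: g x.

Lemma metric_on_rescale : metric_on A cg.
Proof.
have [gs gsym gU] := gA; split=> [|x Ax|x Ax].
- by apply: smooth_mxZ => //; exact: smooth_cst.
- by rewrite /cg linearZ /= gsym.
- by rewrite unitmxZ ?unitfE// gU.
Qed.

(** The connection of [g] is torsion-free and metric for the rescaled metric. *)
Lemma connection_rescale x i : A x -> connection cg i x = connection g i x.
Proof.
move=> Ax; have [gs _ _] := gA; have [cs csym cU] := metric_on_rescale.
move: i; apply: connection_unique; [exact: csym|exact: cU| |].
  move=> i; rewrite (partial_mxZ _ _ gs Ax) (connection_metric i oA gA Ax).
  by rewrite -scalemxAr linearZ /= scalerDr.
by move=> i j k; exact: (connection_torsion_free i j k oA gA Ax).
Qed.

Lemma scalar_curvature_rescale x : A x ->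
  scalar_curvature cg x = c^-1 * scalar_curvature g x.
Proof.
move=> Ax; rewrite !scalar_curvatureE.
have curvE i j : curvature_mx cg i j x = curvature_mx g i j x.
  rewrite !curvature_structure !connection_rescale//.
  by congr (_ - _ + _); apply: (eq_partial_mx _ oA Ax) => y; exact: connection_rescale.
have -> : ricci_mx cg x = ricci_mx g x.
  apply/matrixP => j k; rewrite !ricci_mxE.
  by apply: eq_bigr => i _; rewrite curvE.
by rewrite invmxZ ?unitmxZ ?unitfE//; last case: gA => _ _; [rewrite -scalemxAl linearZ|apply].
Qed.

End Rescaling.

(** An isometry would transport a constant scalar curvature to an open set where
    it is not constant. *)
Lemma no_local_isometry (R : realType) (c : R) (A : set 'C2[R])
    (f : 'C2[R] -> 'C2[R]) :
  0 < c -> open A -> A !=set0 -> A `<=` tube_domain (WNegTri R) ->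
  smooth_map_on A f -> (forall z, A z -> tube_domain (MNormal R) (f z)) ->
  ~ isometric_on (tube_metric (WNegTri R))
      (fun z => c *: tube_metric (MNormal R) z) A f.
Proof.
move=> c0 oA A0 AD fA fD isom; have cn0 := lt0r_neq0 c0.
have HN x : base (MNormal R) x -> hessian (potential (MNormal R)) x \in unitmx.
  by move=> Ux; apply: posdef_unitmx; exact: MNormal_posdef.
have HW x : base (WNegTri R) x -> hessian (potential (WNegTri R)) x \in unitmx.
  by move=> Ux; apply: posdef_unitmx; exact: WNegTri_posdef.
have mN := tube_metric_on (@MNormal_open R) (@MNormal_smooth R) HN.
have [Ws Wsym WU] := tube_metric_on (@WNegTri_open R) (@WNegTri_smooth R) HW.
have oN := tube_domain_open (@MNormal_open R).
have mW : metric_on A (tube_metric (WNegTri R)).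
  split=> [a b|z Az|z Az]; last 2 first.
  - by apply: Wsym; exact: AD.
  - by apply: WU; exact: AD.
  - exact: smooth_on_sub AD (Ws a b).
apply: (@scalar_curvature_WNegTri_nonconstant R A (c^-1 * - 6)) => // z Az.
have mNc := metric_on_rescale oN mN cn0.
rewrite (scalar_curvature_isometry oA oN fA fD mW mNc _ Az).
  rewrite (scalar_curvature_rescale oN mN cn0 (fD _ Az)).
  by rewrite scalar_curvature_MNormal//; exact: fD.
move=> w Aw; rewrite -(isom w Aw) jacobianE//.
exact: smooth_map_differentiable fA Aw.
Qed.

(** * Legendre duality *)

Lemma sup_attained (R : realType) (S : set R) (v : R) :
  S v -> (forall y, S y -> y <= v) -> has_sup S /\ sup S = v.
Proof.
move=> Sv vub; have hS : has_sup S by split; [exists v|exists v; exact: vub].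
split=> //; apply/eqP; rewrite eq_le; apply/andP; split.
  by apply: ge_sup => //; exists v.
by apply: ub_le_sup => //; case: hS.
Qed.

Lemma ln_le_subr1 (R : realType) (y : R) : 0 < y -> ln y <= y - 1.
Proof.
by move=> y0; have := @le_ln1Dx R (y - 1); rewrite subrKC; apply; rewrite ltrBrDr addNr.
Qed.

Lemma dot2 (R : realType) (x u : 'rV[R]_2) :
  dot x u = x ord0 ord0 * u ord0 ord0 + x ord0 ord_max * u ord0 ord_max.
Proof. exact: sum2. Qed.

Section NegTriLegendre.
Variable R : realType.
Local Notation M := (MNegTri R).
Local Notation W := (WNegTri R).

(** Gibbs' inequality: at the point where the odds are [u] the value is the dual
    potential, and the tangent bound on the logarithm, applied to the three ratios
    of probabilities, shows that no value is larger. *)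
Lemma legendre_MNegTri (u : 'rV[R]_2) : base W u ->
  has_sup (legendre_values M u) /\ sup (legendre_values M u) = potential W u.
Proof.
move=> Wu; have S0 := wnegtri_s_gt0 Wu.
have u0 j := wnegtri_gt0 j Wu.
pose S := wnegtri_s u.
have SE : 1 + u ord0 ord0 + u ord0 ord_max = S by [].
apply: sup_attained.
  pose x : 'rV[R]_2 := \row_j (ln (u ord0 j) - ln S).
  have ex j : expR (x ord0 j) = u ord0 j / S.
    by rewrite mxE -ln_div ?posrE// lnK// posrE divr_gt0.
  have rS : 1 - u ord0 ord0 / S - u ord0 ord_max / S = S^-1.
    by rewrite -SE; field; rewrite SE lt0r_neq0.
  exists x.
    by rewrite /= /crd1 /crd2 !ex -subr_gt0 opprD addrA rS invr_gt0.
  rewrite dot2 /= /crd1 /crd2 !ex rS lnV ?posrE// !mxE SE -SE.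
  by rewrite SE; move: (ln S) => l; rewrite -SE; ring.
move=> _ [x Ux <-]; rewrite dot2 /= opprK /crd1 /crd2 SE.
have r0 := negtri_r_gt0 Ux; rewrite -/(negtri_r x).
have gibbs j : u ord0 j * (x ord0 j + ln S - ln (u ord0 j))
    <= expR (x ord0 j) * S - u ord0 j.
  have y0 : 0 < expR (x ord0 j) * S / u ord0 j by rewrite divr_gt0// mulr_gt0 ?expR_gt0.
  have -> : x ord0 j + ln S - ln (u ord0 j) = ln (expR (x ord0 j) * S / u ord0 j).
    rewrite ln_div ?posrE//; last by rewrite mulr_gt0 ?expR_gt0.
    by rewrite lnM ?posrE ?expR_gt0// expRK.
  have -> : expR (x ord0 j) * S - u ord0 j
      = u ord0 j * (expR (x ord0 j) * S / u ord0 j - 1).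
    by field; rewrite lt0r_neq0.
  by rewrite ler_wpM2l ?ln_le_subr1// ltW.
have gibbsr : ln (negtri_r x) + ln S <= negtri_r x * S - 1.
  by rewrite -lnM ?posrE// ln_le_subr1// mulr_gt0.
rewrite -subr_ge0.
have := lerD (lerD (gibbs ord0) (gibbs ord_max)) gibbsr.
rewrite -subr_ge0; congr (0 <= _).
rewrite /negtri_r -SE; move: (ln (1 + _ + _)) (ln (1 - _ - _)) => lS lr; ring.
Qed.

(** If the [j]-th coordinate of [u] is negative, the values are unbounded when the
    [j]-th coordinate of the argument tends to minus infinity, where the potential
    stays bounded. *)
Lemma legendre_MNegTri_ge0 (u : 'rV[R]_2) j :
  has_sup (legendre_values M u) -> 0 <= u ord0 j.
Proof.
move=> [_ [B uB]]; rewrite leNgt; apply/negP => uj.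
pose l : R := ln 4^-1.
have el : expR l = 4^-1 by rewrite lnK// posrE.
pose C := l * (u ord0 ord0 + u ord0 ord_max) + ln 2^-1.
pose t := (`|B - C| + 1) / - u ord0 j.
have tu : t * u ord0 j = - (`|B - C| + 1).
  by rewrite /t; field; rewrite lt_eqF.
have t0 : 0 <= t by rewrite divr_ge0 ?addr_ge0// oppr_ge0 ltW.
pose x : 'rV[R]_2 := \row_k (l - (k == j)%:R * t).
have ex k : expR (x ord0 k) <= 4^-1.
  by rewrite mxE -el ler_expR gerBl mulr_ge0.
have rx : 2^-1 <= negtri_r x.
  by have := lerD (ex ord0) (ex ord_max); rewrite /negtri_r; lra.
have Ux : base M x.
  by have := lerD (ex ord0) (ex ord_max); rewrite /= /crd1 /crd2; lra.
have := uB _ (ex_intro2 _ _ x Ux erefl).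
rewrite dot2 /= opprK /crd1 /crd2 -/(negtri_r x).
have -> : x ord0 ord0 * u ord0 ord0 + x ord0 ord_max * u ord0 ord_max
    = l * (u ord0 ord0 + u ord0 ord_max) - t * u ord0 j.
  by rewrite !mxE; case: (I2P j) => -> /=; ring.
have lnr : ln 2^-1 <= ln (negtri_r x).
  by rewrite ler_ln ?posrE ?invr_gt0// negtri_r_gt0.
have := ler_norm (B - C); rewrite tu /C; move: (`|_|) => n.
move: (l * _) (ln (negtri_r x)) lnr => p q lnr; clear -lnr.
by move: (ln 2^-1) lnr => h; lra.
Qed.

Lemma mirror_NegTri : statistical_mirror M W.
Proof.
split; last first.
  exists 0 => u Wu; have [_ ->] := legendre_MNegTri Wu.
  by rewrite addr0.
apply/seteqP; split=> [|u].
  rewrite -(open_subsetE _ (@WNegTri_open R)).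
  by move=> u /legendre_MNegTri[].
have gt0 j : interior [set u | has_sup (legendre_values M u)] u -> 0 < u ord0 j.
  move=> uI; have cvg : (fun t : R => t *: delta_mx ord0 j + u) @ (0 : R) --> u.
    have : (fun t : R => t *: delta_mx ord0 j + u) @ (0 : R)
        --> 0 *: delta_mx ord0 j + u.
      by apply: cvgD; [exact: scalel_continuous|exact: cvg_cst].
    by rewrite scale0r add0r.
  have [r /= r0 rA] := (nbhs_normP _ _).1 (cvg _ uI).
  have : has_sup (legendre_values M (- (r / 2) *: delta_mx ord0 j + u)).
    apply: rA; rewrite /= sub0r opprK gtr0_norm ?divr_gt0//.
    by rewrite ltr_pdivrMr// ltr_pMr// ltr1n.
  move=> /legendre_MNegTri_ge0 => /(_ j); rewrite !mxE !eqxx /= mulr1.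
  rewrite addrC subr_ge0; apply: lt_le_trans.
  by rewrite divr_gt0.
by move=> uI; split; exact: gt0.
Qed.

End NegTriLegendre.

Section NormalLegendre.
Variable R : realType.
Local Notation M := (MNormal R).
Local Notation W := (WNormal R).

Let p0 : 0 < pi :> R. Proof. exact: pi_gt0. Qed.

Let value (u : 'rV[R]_2) (s y : R) :=
  y * u ord0 ord0 - s * u ord0 ord_max - y ^+ 2 / (4 * s) + 2^-1 * ln (s / pi).

Let valueE (u x : 'rV[R]_2) : base M x ->
  dot x u - potential M x = value u (- x ord0 ord_max) (x ord0 ord0).
Proof.
rewrite /= => x0; have xn0 : x ord0 ord_max != 0 by rewrite lt_eqF.
rewrite dot2 /value /crd1 /crd2 [- x ord0 ord_max / pi]mulNr; move: (ln _) => l.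
by field; rewrite ?oppr_eq0 xn0.
Qed.

Let value_mem u s y : 0 < s -> legendre_values M u (value u s y).
Proof.
move=> s0; exists (\row_j if j == ord0 then y else - s).
  by rewrite /= /crd2 mxE /= oppr_lt0.
by rewrite valueE ?mxE /= ?opprK// /crd2 mxE /= oppr_lt0.
Qed.

(** For fixed second coordinate the quadratic in the first is maximized by
    completing the square; what remains is the one-variable Legendre transform
    of the logarithm. *)
Lemma legendre_MNormal (u : 'rV[R]_2) : base W u ->
  has_sup (legendre_values M u) /\
  sup (legendre_values M u) = potential W u - 2^-1 * (1 + ln (2 * pi)).
Proof.
move=> Wu; have D0 := wnormal_d_gt0 Wu.
set D := wnormal_d u in D0.
have -> : potential W u = - (2^-1 * ln D) by [].
have Dn0 := lt0r_neq0 D0.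
have u1 : u ord0 ord_max = D + u ord0 ord0 ^+ 2 by rewrite /D /wnormal_d subrK.
have lnE s : 0 < s -> ln (s / pi) = ln (2 * s * D) - ln (2 * pi) - ln D.
  move=> s0; have pn0 := lt0r_neq0 p0.
  have -> : s / pi = 2 * s * D / (2 * pi) / D.
    by move: (@pi R) pn0 => P pn0; field; rewrite Dn0.
  by rewrite !ln_div ?posrE ?divr_gt0 ?mulr_gt0.
apply: sup_attained.
  pose s := (2 * D)^-1; have s0 : 0 < s by rewrite invr_gt0 mulr_gt0.
  have := value_mem u (2 * s * u ord0 ord0) s0; congr (legendre_values M u _).
  rewrite /value lnE// u1 (_ : 2 * s * D = 1); last by rewrite /s; field.
  by rewrite ln1 /s; move: (ln _) (ln _) => a b; field.
move=> _ [x Ux <-]; rewrite valueE//.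
have s0 : 0 < - x ord0 ord_max by rewrite oppr_gt0.
move: (- x ord0 ord_max) (x ord0 ord0) s0 => s y s0.
rewrite /value lnE// u1.
have l1 : ln (2 * s * D) <= 2 * s * D - 1.
  by rewrite ln_le_subr1// !mulr_gt0.
have sq : y * u ord0 ord0 - s * u ord0 ord0 ^+ 2 - y ^+ 2 / (4 * s) <= 0.
  rewrite (_ : _ - _ = - ((y - 2 * s * u ord0 ord0) ^+ 2 / (4 * s))); last first.
    by field; rewrite lt0r_neq0.
  by rewrite oppr_le0 divr_ge0 ?sqr_ge0// mulr_ge0// ltW.
move: l1 sq; move: (y ^+ 2 / (4 * s)) (ln (2 * s * D)) (ln D) (ln (2 * pi)).
by move: (u ord0 ord0); clear => v q l1 l2 l3; lra.
Qed.

(** On and below the parabola, along the points where the completed square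
    vanishes, the values grow at least as half the logarithm of the opposite of
    the second coordinate. *)
Lemma legendre_MNormal_finite (u : 'rV[R]_2) :
  has_sup (legendre_values M u) -> base W u.
Proof.
move=> [_ [B uB]]; rewrite /= /crd1 /crd2 ltNge; apply/negP => u1.
pose s : R := pi * expR (2 * (B + 1)).
have s0 : 0 < s by rewrite mulr_gt0 ?expR_gt0.
have := uB _ (value_mem u (2 * s * u ord0 ord0) s0).
have sp : s / pi = expR (2 * (B + 1)) by rewrite /s mulrAC mulfV ?mul1r// lt0r_neq0.
rewrite /value sp expRK.
have -> : 2 * s * u ord0 ord0 * u ord0 ord0 - s * u ord0 ord_max
    - (2 * s * u ord0 ord0) ^+ 2 / (4 * s) + 2^-1 * (2 * (B + 1))
  = s * (u ord0 ord0 ^+ 2 - u ord0 ord_max) + (B + 1).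
  by field; rewrite lt0r_neq0.
apply/negP; rewrite -ltNge ltr_wpDl ?ltrDl//.
by rewrite mulr_ge0 ?subr_ge0// ltW.
Qed.

Lemma mirror_Normal : statistical_mirror M W.
Proof.
split; last first.
  exists (2^-1 * (1 + ln (2 * pi))) => u Wu.
  by have [_ ->] := legendre_MNormal Wu; rewrite subrK.
apply/seteqP; split=> [|u].
  rewrite -(open_subsetE _ (@WNormal_open R)).
  by move=> u /legendre_MNormal[].
by move=> /interior_subset/legendre_MNormal_finite.
Qed.

End NormalLegendre.

(** * Complex-valued functions on the plane of two complex variables *)

Section ComplexFunctions.
Variable R : realType.
Local Notation C := R[i].
Local Notation Re := (@complex.Re R).
Local Notation Im := (@complex.Im R).
Local Notation "x %:C" := (real_complex R x).
Local Notation "x ^c" := (conjc x) : ring_scope.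
Implicit Types (c e : 'C2[R] -> C) (z : 'C2[R]).

Lemma complex_eqP (x y : C) : Re x = Re y -> Im x = Im y -> x = y.
Proof. by case: x y => [a b] [a' b'] /= -> ->. Qed.

Lemma cReD (x y : C) : Re (x + y) = Re x + Re y. Proof. by case: x y => [? ?] []. Qed.
Lemma cImD (x y : C) : Im (x + y) = Im x + Im y. Proof. by case: x y => [? ?] []. Qed.
Lemma cReN (x : C) : Re (- x) = - Re x. Proof. by case: x. Qed.
Lemma cImN (x : C) : Im (- x) = - Im x. Proof. by case: x. Qed.
Lemma cReM (x y : C) : Re (x * y) = Re x * Re y - Im x * Im y.
Proof. by case: x y => [? ?] []. Qed.
Lemma cImM (x y : C) : Im (x * y) = Re x * Im y + Im x * Re y.
Proof. by case: x y => [? ?] [? ?] /=. Qed.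
Lemma cReV (x : C) : Re x^-1 = Re x * (Re x ^+ 2 + Im x ^+ 2)^-1.
Proof. by case: x. Qed.
Lemma cImV (x : C) : Im x^-1 = - (Im x * (Re x ^+ 2 + Im x ^+ 2)^-1).
Proof. by case: x. Qed.

Lemma normsq_gt0 (x : C) : x != 0 -> 0 < Re x ^+ 2 + Im x ^+ 2.
Proof.
case: x => a b; rewrite eq_complex /= negb_and => /orP[a0|b0].
  by rewrite ltr_pwDl ?sqr_ge0// exprn_even_gt0.
by rewrite ltr_wpDl ?sqr_ge0// exprn_even_gt0.
Qed.

Lemma mul_conjc (x : C) : x * x^c = (Re x ^+ 2 + Im x ^+ 2)%:C.
Proof. by case: x => a b; apply: complex_eqP => /=; ring. Qed.

(** ** The complex exponential and a branch of the logarithm *)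

Definition cexp (x : C) : C :=
  Complex (expR (Re x) * cos (Im x)) (expR (Re x) * sin (Im x)).

(** The principal branch, on the right half-plane. *)
Definition clog (x : C) : C :=
  Complex (2^-1 * ln (Re x ^+ 2 + Im x ^+ 2)) (atan (Im x / Re x)).

Lemma cexpD (x y : C) : cexp (x + y) = cexp x * cexp y.
Proof.
by apply: complex_eqP; rewrite ?cReM ?cImM /= cReD cImD expRD ?cosD ?sinD; ring.
Qed.

Lemma cexp_normsq (x : C) :
  Re (cexp x) ^+ 2 + Im (cexp x) ^+ 2 = expR (Re x) ^+ 2.
Proof. by rewrite /= !exprMn -mulrDr cos2Dsin2 mulr1. Qed.

Lemma cexp_neq0 (x : C) : cexp x != 0.
Proof.
apply/negP => /eqP x0; have := cexp_normsq x; rewrite x0 /= expr0n addr0.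
by move/eqP; rewrite eq_sym sqrf_eq0 gt_eqF// expR_gt0.
Qed.

Lemma cexpK (x : C) : - (pi / 2) < Im x < pi / 2 -> clog (cexp x) = x.
Proof.
move=> xpi; have c0 := cos_gt0_pihalf xpi.
apply: complex_eqP; rewrite [LHS]/=.
  by rewrite -[X in ln X]/(Re (cexp x) ^+ 2 + Im (cexp x) ^+ 2) cexp_normsq
    lnXn ?expR_gt0// expRK mulr2n; field.
have -> : expR (Re x) * sin (Im x) / (expR (Re x) * cos (Im x)) = tan (Im x).
  by rewrite /tan; field; rewrite !gt_eqF// expR_gt0.
by rewrite tanK// in_itv.
Qed.

Lemma clogK (x : C) : 0 < Re x -> cexp (clog x) = x.
Proof.
case: x => a b /= a0; have a_neq0 := lt0r_neq0 a0.
have n0 : 0 < a ^+ 2 + b ^+ 2 by rewrite ltr_pwDl ?sqr_ge0// exprn_gt0.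
have c0 : 0 < cos (atan (b / a)).
  by apply: cos_gt0_pihalf; rewrite atan_gtNpi2 atan_ltpi2.
have sE : sin (atan (b / a)) = b / a * cos (atan (b / a)).
  exact: (canRL (divfK (lt0r_neq0 c0)) (atanK (b / a))).
have := cos2Dsin2 (atan (b / a)); rewrite sE.
rewrite /cexp /clog /= sE; move: (cos _) c0 => k k0 kE.
set e := expR _; have e0 : 0 < e by exact: expR_gt0.
have e2 : e * e = a ^+ 2 + b ^+ 2.
  rewrite /e -expRD -[RHS]lnK ?posrE//; congr expR.
  by move: (ln _) => l; field.
have ek : e * k = a.
  apply/eqP; rewrite -(@eqrXn2 _ 2) ?mulr_ge0 ?(ltW e0) ?(ltW k0) ?(ltW a0)//.
  apply/eqP; rewrite exprMn [e ^+ 2]expr2 e2.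
  have -> : (a ^+ 2 + b ^+ 2) * k ^+ 2 = a ^+ 2 * (k ^+ 2 + (b / a * k) ^+ 2) by field.
  by rewrite kE mulr1.
by apply: complex_eqP; rewrite /= ?ek// mulrCA ek divfK.
Qed.

(** ** Complex gradients *)

(** The derivatives of a complex-valued function in the four real directions. *)
Definition cgradient c z (D : 'I_(2 + 2) -> C) :=
  has_gradient (fun w => Re (c w)) z (fun k => Re (D k)) /\
  has_gradient (fun w => Im (c w)) z (fun k => Im (D k)).

Lemma cgradient_ext c z D E :
  (forall k, D k = E k) -> cgradient c z D -> cgradient c z E.
Proof.
by move=> DE [cr ci]; split;
  [apply: has_gradient_ext cr => k|apply: has_gradient_ext ci => k]; rewrite DE.
Qed.

Lemma cgradient_cst (a : C) z : cgradient (fun=> a) z (fun=> 0).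
Proof. by split; exact: gradient_cst. Qed.

Let eq_gradient_fun (f g : 'C2[R] -> R) z d : f =1 g ->
  has_gradient f z d -> has_gradient g z d.
Proof. by move=> /funext ->. Qed.

Lemma cgradientD c e z D E : cgradient c z D -> cgradient e z E ->
  cgradient (fun w => c w + e w) z (fun k => D k + E k).
Proof.
move=> [cr ci] [er ei]; split.
  apply: eq_gradient_fun (has_gradient_ext _ (gradientD cr er)) => [w|k];
  by rewrite cReD.
apply: eq_gradient_fun (has_gradient_ext _ (gradientD ci ei)) => [w|k];
by rewrite cImD.
Qed.

Lemma cgradientM c e z D E : cgradient c z D -> cgradient e z E ->
  cgradient (fun w => c w * e w) z (fun k => D k * e z + c z * E k).
Proof.
move=> [cr ci] [er ei]; split.
  apply: eq_gradient_fun (has_gradient_ext _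
    (gradientD (gradientM cr er) (gradientN (gradientM ci ei)))) => [w|k].
    by rewrite cReM.
  by rewrite cReD !cReM; ring.
apply: eq_gradient_fun (has_gradient_ext _
  (gradientD (gradientM cr ei) (gradientM ci er))) => [w|k].
  by rewrite cImM.
by rewrite cImD !cImM; ring.
Qed.

Lemma cgradientV c z D : c z != 0 -> cgradient c z D ->
  cgradient (fun w => (c w)^-1) z (fun k => - (c z)^-1 ^+ 2 * D k).
Proof.
move=> c0 [cr ci]; have n0 := lt0r_neq0 (normsq_gt0 c0).
have nV := gradientV n0 (gradientD (gradientX 2 cr) (gradientX 2 ci)).
split.
  apply: eq_gradient_fun (has_gradient_ext _ (gradientM cr nV)) => [w|k].
    by rewrite cReV.
  rewrite cReM cReN cImN expr2 cReM cImM cReV cImV.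
  by move: n0; move: (Re (c z)) (Im (c z)) => x y n0; field.
apply: eq_gradient_fun (has_gradient_ext _ (gradientN (gradientM ci nV))) => [w|k].
  by rewrite cImV.
rewrite cImM cReN cImN expr2 cReM cImM cReV cImV.
by move: n0; move: (Re (c z)) (Im (c z)) => x y n0; field.
Qed.

Lemma cgradient_cexp c z D : cgradient c z D ->
  cgradient (fun w => cexp (c w)) z (fun k => cexp (c z) * D k).
Proof.
move=> [cr ci]; split.
  apply: has_gradient_ext (gradientM (gradient_expR cr) (gradient_cos ci)) => k.
  by rewrite cReM /=; ring.
apply: has_gradient_ext (gradientM (gradient_expR cr) (gradient_sin ci)) => k.
by rewrite cImM /=; ring.
Qed.

(** The real derivatives of a function with complex derivatives [d]: the
    directions of the fiber are multiplied by the imaginary unit. *)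
Definition holomorphic_gradient (d : 'I_2 -> C) (k : 'I_(2 + 2)) : C :=
  match fintype.split k with inl i => d i | inr i => Complex 0 1 * d i end.

Lemma holomorphic_gradient_l d i : holomorphic_gradient d (lshift 2 i) = d i.
Proof. by rewrite /holomorphic_gradient (unsplitK (inl i)). Qed.

Lemma holomorphic_gradient_r d i :
  holomorphic_gradient d (rshift 2 i) = Complex 0 1 * d i.
Proof. by rewrite /holomorphic_gradient (unsplitK (inr i)). Qed.

Lemma cgradient_dz j z :
  cgradient (dz j) z (holomorphic_gradient (fun i => (i == j)%:R)).
Proof.
split.
  apply: eq_gradient_fun (has_gradient_ext _ (gradient_coord (lshift 2 j) z)).
    by move=> w; rewrite /dz /re2 /= mxE.
  move=> k; case: (split_ordP k) => i ->.
    by rewrite holomorphic_gradient_l eq_lshift; case: eqP.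
  by rewrite holomorphic_gradient_r eq_rlshift; case: eqP => _ /=; ring.
apply: eq_gradient_fun (has_gradient_ext _ (gradient_coord (rshift 2 j) z)).
  by move=> w; rewrite /dz /im2 /= mxE.
move=> k; case: (split_ordP k) => i ->.
  by rewrite holomorphic_gradient_l eq_lrshift; case: eqP.
by rewrite holomorphic_gradient_r eq_rshift; case: eqP => _ /=; ring.
Qed.

(** ** Smooth complex-valued functions *)

Section ComplexSmooth.
Variable A : set 'C2[R].
Hypothesis oA : open A.

Definition csmooth c :=
  smooth_on A (fun w => Re (c w)) /\ smooth_on A (fun w => Im (c w)).

Let eq_smooth_fun (f g : 'C2[R] -> R) : f =1 g -> smooth_on A f -> smooth_on A g.
Proof. by move=> /funext ->. Qed.

Lemma csmooth_cst (a : C) : csmooth (fun=> a).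
Proof. by split; exact: smooth_cst. Qed.

Lemma csmooth_dz j : csmooth (dz j).
Proof.
split.
  apply: eq_smooth_fun (smooth_coord oA (lshift 2 j)) => w.
  by rewrite /dz /re2 /= mxE.
apply: eq_smooth_fun (smooth_coord oA (rshift 2 j)) => w.
by rewrite /dz /im2 /= mxE.
Qed.

Lemma csmoothD c e : csmooth c -> csmooth e -> csmooth (fun w => c w + e w).
Proof.
move=> [cr ci] [er ei]; split.
  by apply: eq_smooth_fun (smoothD oA cr er) => w; rewrite cReD.
by apply: eq_smooth_fun (smoothD oA ci ei) => w; rewrite cImD.
Qed.

Lemma csmoothN c : csmooth c -> csmooth (fun w => - c w).
Proof.
move=> [cr ci]; split.
  by apply: eq_smooth_fun (smoothN oA cr) => w; rewrite cReN.
by apply: eq_smooth_fun (smoothN oA ci) => w; rewrite cImN.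
Qed.

Lemma csmoothM c e : csmooth c -> csmooth e -> csmooth (fun w => c w * e w).
Proof.
move=> [cr ci] [er ei]; split.
  apply: eq_smooth_fun (smoothD oA (smoothM oA cr er)
    (smoothN oA (smoothM oA ci ei))) => w.
  by rewrite cReM.
apply: eq_smooth_fun (smoothD oA (smoothM oA cr ei) (smoothM oA ci er)) => w.
by rewrite cImM.
Qed.

Lemma csmoothX c n : csmooth c -> csmooth (fun w => c w ^+ n).
Proof.
move=> cA; elim: n => [|n IHn]; first exact: csmooth_cst.
by have := csmoothM cA IHn; congr csmooth; apply/funext => w; rewrite exprS.
Qed.

Let smooth_normsq c : csmooth c ->
  smooth_on A (fun w => Re (c w) ^+ 2 + Im (c w) ^+ 2).
Proof. by move=> [cr ci]; apply: smoothD => //; exact: smoothX. Qed.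

Lemma csmoothV c : (forall w, A w -> c w != 0) -> csmooth c ->
  csmooth (fun w => (c w)^-1).
Proof.
move=> c0 cA; have [cr ci] := cA.
have nV : smooth_on A (fun w => (Re (c w) ^+ 2 + Im (c w) ^+ 2)^-1).
  apply: smoothV => //; last exact: smooth_normsq.
  by move=> w Aw; apply/lt0r_neq0/normsq_gt0/c0.
split; first by apply: eq_smooth_fun (smoothM oA cr nV) => w; rewrite cReV.
by apply: eq_smooth_fun (smoothN oA (smoothM oA ci nV)) => w; rewrite cImV.
Qed.

Lemma csmooth_cexp c : csmooth c -> csmooth (fun w => cexp (c w)).
Proof.
move=> [cr ci]; have [cc cs] := smooth_cos_sin oA ci.
by split; apply: smoothM => //; exact: smooth_expR.
Qed.

Lemma csmooth_clog c : (forall w, A w -> 0 < Re (c w)) -> csmooth c ->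
  csmooth (fun w => clog (c w)).
Proof.
move=> c0 cA; have [cr ci] := cA; split.
  apply: smoothM => //; first exact: smooth_cst.
  apply: smooth_ln => //; last exact: smooth_normsq.
  by move=> w Aw; rewrite ltr_pwDl ?sqr_ge0// exprn_gt0// c0.
apply: smooth_atan => //; apply: smoothM => //; apply: smoothV => // w Aw.
exact/lt0r_neq0/c0.
Qed.

Lemma csmooth_open (I : finType) (c : I -> 'C2[R] -> C) :
  (forall i, csmooth (c i)) -> open (A `&` [set w | forall i, 0 < Re (c i w)]).
Proof.
move=> cA; rewrite openE => w [Aw cw].
have nA : \forall y \near w, A y by exact: open_nbhs_nbhs.
suff pos : \forall y \near w, forall i, 0 < Re (c i y) by exact: filterI nA pos.
apply: (@filter_forall _ _ (fun i => [set y | 0 < Re (c i y)]) (nbhs w)) => i; have [cr _] := cA i.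
have cont : {for w, continuous (fun w => Re (c i w))}.
  exact/differentiable_continuous/(smooth_on_differentiable cr Aw).
apply: (cont [set t | 0 < t]); apply: open_nbhs_nbhs.
by split; [exact: open_gt|exact: cw].
Qed.

Lemma csmooth_strip_open (I : finType) (c : I -> 'C2[R] -> C) (h : R) :
  (forall i, csmooth (c i)) ->
  open (A `&` [set w | forall i, - h < Im (c i w) < h]).
Proof.
move=> cA; have k (a : C) := csmooth_cst a.
(* A quarter turn either way makes the imaginary part, or its opposite, real. *)
pose e (i : I * bool) w : C :=
  (if i.2 then Complex 0 1 else Complex 0 (- 1)) * c i.1 w + real_complex R h.
have eE i w : Re (e (i, true) w) = - Im (c i w) + h /\
    Re (e (i, false) w) = Im (c i w) + h.
  by rewrite /e /=; case: (c i w) => x y /=; split; ring.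
rewrite (_ : _ `&` _ = A `&` [set w | forall i, 0 < Re (e i w)]).
  by apply: csmooth_open => i; exact: (csmoothD (csmoothM (k _) (cA _)) (k _)).
apply/seteqP; split=> w [Aw cw]; split=> // i.
  have /andP[lo hi] := cw i.1; have [e1 e2] := eE i.1 w.
  case: i lo hi e1 e2 => i [] /= lo hi e1 e2.
    by rewrite e1 addrC subr_gt0.
  by rewrite e2 -ltrBlDr sub0r.
have [e1 e2] := eE i w; have := cw (i, true); have := cw (i, false).
by rewrite /= e1 e2 -!ltrBlDr !sub0r ltrN2 => -> ->.
Qed.

End ComplexSmooth.

(** ** Maps given by two complex components *)

Definition of_dz (c : 'I_2 -> C) : 'C2[R] :=
  row_mx (\row_j Re (c j)) (\row_j Im (c j)).

Lemma dz_of_dz (c : 'I_2 -> C) j : dz j (of_dz c) = c j.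
Proof.
by rewrite /dz /of_dz /re2 /im2 row_mxKl row_mxKr !mxE; case: (c j).
Qed.

Lemma of_dzK z : of_dz (fun j => dz j z) = z.
Proof.
rewrite -[RHS]hsubmxK; congr row_mx; apply/rowP => j; first by rewrite mxE.
by rewrite mxE.
Qed.

Lemma dz_inj z w : (forall j, dz j z = dz j w) -> z = w.
Proof. by move=> zw; rewrite -[z]of_dzK -[w]of_dzK; congr of_dz; apply/funext. Qed.

Lemma re2E z j : re2 z ord0 j = Re (dz j z). Proof. by []. Qed.
Lemma im2E z j : im2 z ord0 j = Im (dz j z). Proof. by []. Qed.

Lemma of_dz_smooth A (c : 'I_2 -> 'C2[R] -> C) : (forall j, csmooth A (c j)) ->
  smooth_map_on A (fun z => of_dz (c^~ z)).
Proof.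
move=> cA k; case: (split_ordP k) => j ->; have [cr ci] := cA j.
  by move: cr; congr smooth_on; apply/funext => z; rewrite row_mxEl mxE.
by move: ci; congr smooth_on; apply/funext => z; rewrite row_mxEr mxE.
Qed.

Section HolomorphicMap.
Variables (c : 'I_2 -> 'C2[R] -> C) (z : 'C2[R]) (d : 'I_2 -> 'I_2 -> C).
Hypothesis cd : forall a, cgradient (c a) z (holomorphic_gradient (d ^~ a)).

Let f w := of_dz (c^~ w).
Let P : 'M[R]_2 := \matrix_(i, a) Re (d i a).
Let Q : 'M[R]_2 := \matrix_(i, a) Im (d i a).

Let gradient_f (k : 'I_(2 + 2)) : has_gradient (fun w => f w ord0 k) z
  (fun l => block_mx P Q (- Q) P l k).
Proof.
case: (split_ordP k) => a ->; have [cr ci] := cd a.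
  have -> : (fun w => f w ord0 (lshift 2 a)) = fun w => Re (c a w).
    by apply/funext => w; rewrite row_mxEl mxE.
  apply: has_gradient_ext cr => l; case: (split_ordP l) => i ->.
    by rewrite holomorphic_gradient_l block_mxEul mxE.
  by rewrite holomorphic_gradient_r block_mxEdl !mxE cReM /=; ring.
have -> : (fun w => f w ord0 (rshift 2 a)) = fun w => Im (c a w).
  by apply/funext => w; rewrite row_mxEr mxE.
apply: has_gradient_ext ci => l; case: (split_ordP l) => i ->.
  by rewrite holomorphic_gradient_l block_mxEur mxE.
by rewrite holomorphic_gradient_r block_mxEdr !mxE cImM /=; ring.
Qed.

Lemma of_dz_differentiable : differentiable f z.
Proof. by apply: differentiable_rV => k; case: (gradient_f k). Qed.

Lemma of_dz_frame : frame_mx f z = block_mx P Q (- Q) P.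
Proof.
by apply/matrixP => l k; rewrite frame_mxE; case: (gradient_f k) => _ ->.
Qed.

Lemma of_dz_holomorphic v : 'd f z (cplxJ v) = cplxJ ('d f z v).
Proof.
have df := of_dz_differentiable.
rewrite -!(deriveE _ df) !deriveEjacobian// jacobianE// of_dz_frame.
have -> : v *m block_mx P Q (- Q) P
    = row_mx (re2 v *m P - im2 v *m Q) (re2 v *m Q + im2 v *m P).
  by rewrite -{1}[v]hsubmxK mul_row_block mulmxN.
have re2K (a b : 'rV[R]_2) : re2 (row_mx a b) = a by exact: row_mxKl.
have im2K (a b : 'rV[R]_2) : im2 (row_mx a b) = b by exact: row_mxKr.
rewrite /cplxJ re2K im2K mul_row_block.
by rewrite !mulNmx !mulmxN opprD; congr row_mx; rewrite addrC.
Qed.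

(** A holomorphic map pulls a metric with real matrix [H] on the complex tangent
    space back to its Hermitian pull-back. *)
Lemma of_dz_isometric (H K : 'M[R]_2) :
  (forall i j, \sum_a \sum_b (H a b)%:C * (d i a * (d j b)^c) = (K i j)%:C) ->
  frame_mx f z *m block_mx H 0 0 H *m (frame_mx f z)^T = block_mx K 0 0 K.
Proof.
move=> HK; rewrite of_dz_frame tr_block_mx mulmx_block mulmx_block.
rewrite !mulmx0 !addr0 !add0r.
have trN (M : 'M[R]_2) : (- M)^T = - M^T by apply/matrixP => i j; rewrite !mxE.
have quad (M N : 'M[R]_2) i j : (M *m H *m N^T) i j
    = \sum_a \sum_b H a b * (M i a * N j b).
  rewrite -mulmxA mxE; apply: eq_bigr => a _.
  by rewrite mxE mulr_sumr; apply: eq_bigr => b _; rewrite mxE; ring.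
have ReC (x : R) (y : C) : Re (x%:C * y) = x * Re y by rewrite cReM /= mul0r subr0.
have ImC (x : R) (y : C) : Im (x%:C * y) = x * Im y by rewrite cImM /= mul0r addr0.
have KE : P *m H *m P^T + Q *m H *m Q^T = K.
  apply/matrixP => i j; have := congr1 Re (HK i j).
  rewrite (big_morph _ cReD (erefl : Re 0 = 0)) /= => <-.
  rewrite entry_add !quad -big_split; apply: eq_bigr => a _ /=.
  rewrite (big_morph _ cReD (erefl : Re 0 = 0)) -big_split; apply: eq_bigr => b _ /=.
  rewrite ReC cReM ![P _ _]mxE ![Q _ _]mxE.
  by case: (d j b) => ? ? /=; ring.
have ZE : Q *m H *m P^T - P *m H *m Q^T = 0.
  apply/matrixP => i j; rewrite [RHS]mxE; have := congr1 Im (HK i j).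
  rewrite (big_morph _ cImD (erefl : Im 0 = 0)) /= => <-.
  rewrite entry_sub !quad -sumrB; apply: eq_bigr => a _ /=.
  rewrite (big_morph _ cImD (erefl : Im 0 = 0)) -sumrB; apply: eq_bigr => b _ /=.
  rewrite ImC cImM ![P _ _]mxE ![Q _ _]mxE.
  by case: (d j b) => ? ? /=; ring.
rewrite trN !mulNmx !mulmxN; congr block_mx.
- exact: KE.
- by rewrite addrC.
- by rewrite addrC -oppr0 -ZE opprB.
- by rewrite opprK addrC.
Qed.

End HolomorphicMap.

End ComplexFunctions.

(** * The local isometry *)

Section HolomorphicGradients.
Variable R : realType.
Local Notation C := R[i].
Implicit Types (c e : 'C2[R] -> C) (d b : 'I_2 -> C).

Definition hgradient c z d := cgradient c z (holomorphic_gradient d).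

Let hol_linear d b (x y : C) k :
  holomorphic_gradient (fun i => x * d i + y * b i) k
  = x * holomorphic_gradient d k + y * holomorphic_gradient b k.
Proof.
case: (split_ordP k) => i ->; rewrite ?holomorphic_gradient_l//.
by rewrite !holomorphic_gradient_r; ring.
Qed.

Lemma hgradient_ext c z d b : (forall i, d i = b i) -> hgradient c z d ->
  hgradient c z b.
Proof. by move=> /funext ->. Qed.

Lemma hgradient_cst (a : C) z : hgradient (fun=> a) z (fun=> 0).
Proof.
apply: cgradient_ext (cgradient_cst a z) => k.
case: (split_ordP k) => i ->; rewrite ?holomorphic_gradient_l//.
by rewrite holomorphic_gradient_r mulr0.
Qed.

Lemma hgradientD c e z d b : hgradient c z d -> hgradient e z b ->
  hgradient (fun w => c w + e w) z (fun i => d i + b i).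
Proof.
move=> cd eb; apply: cgradient_ext (cgradientD cd eb) => k.
rewrite -[holomorphic_gradient d k]mul1r -[holomorphic_gradient b k]mul1r.
rewrite -hol_linear; congr holomorphic_gradient; apply/funext => i.
by rewrite !mul1r.
Qed.

Lemma hgradientM c e z d b : hgradient c z d -> hgradient e z b ->
  hgradient (fun w => c w * e w) z (fun i => d i * e z + c z * b i).
Proof.
move=> cd eb; apply: cgradient_ext (cgradientM cd eb) => k.
rewrite [_ * e z]mulrC -hol_linear; congr holomorphic_gradient.
by apply/funext => i; rewrite [_ * e z]mulrC.
Qed.

Let hol_scale d (x : C) k : holomorphic_gradient (fun i => x * d i) k
  = x * holomorphic_gradient d k.
Proof.
rewrite -[RHS]addr0 -(mul0r (holomorphic_gradient d k)) -hol_linear.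
by congr holomorphic_gradient; apply/funext => i; rewrite mul0r addr0.
Qed.

Lemma hgradientV c z d : c z != 0 -> hgradient c z d ->
  hgradient (fun w => (c w)^-1) z (fun i => - (c z)^-1 ^+ 2 * d i).
Proof.
by move=> c0 cd; apply: cgradient_ext (cgradientV c0 cd) => k; rewrite hol_scale.
Qed.

Lemma hgradient_cexp c z d : hgradient c z d ->
  hgradient (fun w => cexp (c w)) z (fun i => cexp (c z) * d i).
Proof.
by move=> cd; apply: cgradient_ext (cgradient_cexp cd) => k; rewrite hol_scale.
Qed.

End HolomorphicGradients.

(** The identity behind the isometry.  [Z i] stands for the exponential of half
    the [i]-th coordinate and [X i] for its conjugate; [du] and [ds] are the
    derivatives of [Z_0 / (1 + Z_1)] and of [(1 - Z_1) / (1 + Z_1)], and [dv], [dt]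
    their conjugates; [b] is the inverse of the height above the parabola.  The
    left-hand side is the Hermitian form of twice the tube over the parabola, the
    right-hand side that of the negative trinomial tube. *)
Lemma pullback_hermitian (F : numFieldType) (Z X : 'I_2 -> F) (al : F) (i j : 'I_2) :
  let n := 1 + Z ord_max in let m := 1 + X ord_max in
  let r := 1 - Z ord0 * X ord0 - Z ord_max * X ord_max in
  let b := 2 * (n * m) / (al ^+ 2 * r) in
  let u := Z ord0 / n in let v := X ord0 / m in
  let du (k : 'I_2) := (if k == ord0 then 2^-1 * Z ord0 / n
                       else - (2^-1 * Z ord0 * Z ord_max / n ^+ 2)) in
  let dv (k : 'I_2) := (if k == ord0 then 2^-1 * X ord0 / m
                       else - (2^-1 * X ord0 * X ord_max / m ^+ 2)) in
  let ds (k : 'I_2) := (if k == ord0 then 0 else - (Z ord_max / n ^+ 2)) in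
  let dt (k : 'I_2) := (if k == ord0 then 0 else - (X ord_max / m ^+ 2)) in
  al != 0 -> n != 0 -> m != 0 -> r != 0 ->
  2 * b * al ^+ 2 * du i * dv j
  + b ^+ 2 * (4^-1 * al ^+ 4) * (ds i - 2 * v * du i) * (dt j - 2 * u * dv j)
  = (i == j)%:R * (Z j * X j / r) + Z i * X i / r * (Z j * X j / r).
Proof.
move=> n m r b u v du dv ds dt a0 n0 m0 r0.
rewrite /b /du /dv /ds /dt /u /v; move: n0 m0 r0; rewrite /n /m /r => n0 m0 r0.
by case: (I2P i) => ->; case: (I2P j) => -> /=; field; rewrite a0 n0 m0 r0.
Qed.

Section LocalIsometry.
Variable R : realType.
Local Notation C := R[i].
Local Notation Re := (@complex.Re R).
Local Notation Im := (@complex.Im R).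
Local Notation "x %:C" := (real_complex R x).
Local Notation "x ^c" := (conjc x) : ring_scope.
Local Notation M := (MNegTri R).
Local Notation W := (WNormal R).
Implicit Types z w : 'C2[R].

Let conjD (x y : C) : (x + y)^c = x^c + y^c. Proof. exact: rmorphD. Qed.
Let conjM (x y : C) : (x * y)^c = x^c * y^c. Proof. exact: rmorphM. Qed.
Let conjN (x : C) : (- x)^c = - x^c. Proof. exact: rmorphN. Qed.
Let conjX (x : C) n : (x ^+ n)^c = x^c ^+ n. Proof. exact: rmorphXn. Qed.
Let conj1 : (1 : C)^c = 1. Proof. exact: rmorph1. Qed.
Let conj_nat n : (n%:R : C)^c = n%:R. Proof. exact: rmorph_nat. Qed.

Let conjE := (conjc_inv, conj1, conj_nat, conjX, conjN, conjM, conjD).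

(** The exponential coordinates map the negative trinomial tube to the unit
    ball, with potential [- log (1 - |Z_0|^2 - |Z_1|^2)]. *)
Definition ball_coord (j : 'I_2) z : C := cexp (dz j z * 2^-1).
Local Notation Z := ball_coord.

Lemma half_Re (x : C) : Re (x * 2^-1) = Re x / 2 /\ Im (x * 2^-1) = Im x / 2.
Proof.
have -> : (2^-1 : C) = (2^-1 : R)%:C by rewrite rmorphV ?unitfE ?pnatr_eq0// rmorph_nat.
split; first by rewrite cReM mulr0 subr0.
by rewrite cImM mulr0 add0r.
Qed.

Lemma ball_coord_normsq j z :
  Re (Z j z) ^+ 2 + Im (Z j z) ^+ 2 = expR (re2 z ord0 j).
Proof.
rewrite cexp_normsq (half_Re _).1 re2E expr2 -expRD; congr expR.
by rewrite -splitr.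
Qed.

Lemma ball_coord_mul_conj j z : Z j z * (Z j z)^c = (expR (re2 z ord0 j))%:C.
Proof. by rewrite mul_conjc ball_coord_normsq. Qed.

Lemma ball_coord_den z : tube_domain M z -> 1 + Z ord_max z != 0.
Proof.
rewrite /tube_domain /= /crd1 /crd2 => Mz; apply/negP => /eqP n0.
have := ball_coord_normsq ord_max z.
have -> : Z ord_max z = -1 by apply/eqP; rewrite -subr_eq0 opprK addrC n0.
rewrite cReN cImN /= oppr0 expr0n addr0 sqrrN expr1n => e1; move: Mz.
by rewrite -e1 -ltrBrDr subrr ltNge expR_ge0.
Qed.

Variables (al t k1 k2 : R).
Hypothesis al_gt0 : 0 < al.

Let a_neq0 : al%:C != 0.
Proof. by rewrite fmorph_eq0 lt0r_neq0. Qed.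

Let tau : C := Complex t k1.
Let kappa : C := Complex (t ^+ 2) k2.

Let conj_real (x : R) : (x%:C)^c = x%:C. Proof. exact: conjc_real. Qed.
Let conj_tau : tau^c = 2 * t%:C - tau.
Proof. by apply: complex_eqP => /=; ring. Qed.
Let conj_kappa : kappa^c = 2 * t%:C ^+ 2 - kappa.
Proof. by apply: complex_eqP => /=; rewrite ?expr2 /=; ring. Qed.

(** The Cayley transform from the ball to the Siegel domain, the shear to the
    tube over the parabola, and an affine automorphism of that tube with four
    real parameters. *)
Definition cayley (j : 'I_2) (x y : C) : C :=
  if j == ord0 then al%:C * (x * (1 + y)^-1) + tau
  else 2^-1 * al%:C ^+ 2 *
         ((1 + -1 * y) * (1 + y)^-1 + x * (1 + y)^-1 * (x * (1 + y)^-1))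
       + 2 * t%:C * al%:C * (x * (1 + y)^-1) + kappa.

Definition height (x y : C) : R := Re y - Re x ^+ 2.

(** The height above the parabola is, up to a positive factor, the defining
    function of the ball. *)
Lemma cayley_height (x y : C) : 1 + y != 0 ->
  (height (cayley ord0 x y) (cayley ord_max x y))%:C
  = 2^-1 * al%:C ^+ 2 * (1 - x * x^c - y * y^c ) / ((1 + y) * (1 + y)^c).
Proof.
move=> n0; have m0 : 1 + y^c != 0.
  have e : (1 + y)^c = 1 + y^c.
    by rewrite conjD conj1.
  by rewrite -e conjc_eq0.
rewrite /height rmorphB rmorphXn /= !ReJ_add /cayley /=.
rewrite !(conjE, conj_real, conj_tau, conj_kappa).
by field; rewrite n0 m0.
Qed.

(** The inverse affine automorphism, to the Siegel domain. *)
Let shift (x : C) : C := (x - tau) / al%:C.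
Let siegel (x y : C) : C :=
  (y - kappa - 2 * t%:C * al%:C * shift x) * (2 / al%:C ^+ 2) - shift x ^+ 2.

Definition cayley_inv (j : 'I_2) (x y : C) : C :=
  if j == ord0 then 2 * shift x / (1 + siegel x y)
  else (1 - siegel x y) / (1 + siegel x y).

Lemma siegel_den (x y : C) : 0 < height x y -> 1 + siegel x y != 0.
Proof.
move=> h0; have E : (Re (siegel x y))%:C
    = 2 / al%:C ^+ 2 * (height x y)%:C + shift x * (shift x)^c.
  rewrite /height rmorphB rmorphXn /= !ReJ_add /siegel /shift.
  rewrite !(conjE, conj_real, conj_tau, conj_kappa).
  by field.
have S0 : 0 < Re (siegel x y).
  have E' : Re (siegel x y) = 2 / al ^+ 2 * height x y
      + (Re (shift x) ^+ 2 + Im (shift x) ^+ 2).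
    have e : 2 / al%:C ^+ 2 = (2 / al ^+ 2)%:C.
      by rewrite [RHS]rmorphM fmorphV rmorphXn rmorph_nat.
    by apply: (@complexI R); rewrite E mul_conjc e -rmorphM -rmorphD.
  rewrite E' ltr_pwDl//; last by rewrite addr_ge0 ?sqr_ge0.
  by rewrite mulr_gt0// divr_gt0// exprn_gt0.
apply/negP => /eqP s0; have := congr1 Re s0; rewrite cReD /= => /eqP.
by rewrite gt_eqF// addr_gt0.
Qed.

Lemma cayleyK (x y : C) j : 1 + y != 0 ->
  cayley_inv j (cayley ord0 x y) (cayley ord_max x y) = if j == ord0 then x else y.
Proof.
move=> n0; have E : siegel (cayley ord0 x y) (cayley ord_max x y) = (1 - y) / (1 + y).
  by rewrite /siegel /shift /cayley /=; field; rewrite a_neq0 n0.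
have S2 : 1 + (1 - y) / (1 + y) = 2 / (1 + y) by field.
rewrite /cayley_inv E S2 /shift /cayley /=.
case: ifP => _; field; rewrite ?n0 ?a_neq0 ?pnatr_eq0//.
Qed.

Lemma cayley_inv_den (x y : C) : 1 + siegel x y != 0 ->
  1 + cayley_inv ord_max x y = 2 / (1 + siegel x y).
Proof. by move=> s0; rewrite /cayley_inv /=; field. Qed.

Lemma cayley_invK (x y : C) j : 1 + siegel x y != 0 ->
  cayley j (cayley_inv ord0 x y) (cayley_inv ord_max x y) = if j == ord0 then x else y.
Proof.
move=> s0; have two0 : (2 : C) != 0 by rewrite pnatr_eq0.
have xE : cayley_inv ord0 x y * (1 + cayley_inv ord_max x y)^-1 = shift x.
  by rewrite cayley_inv_den// /cayley_inv /=; field; rewrite ?s0 ?two0.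
have sE : (1 + -1 * cayley_inv ord_max x y) * (1 + cayley_inv ord_max x y)^-1
    = siegel x y.
  by rewrite cayley_inv_den// /cayley_inv /=; field; rewrite ?s0 ?two0.
rewrite /cayley xE sE; case: ifP => _; first by rewrite /shift; field.
by rewrite /siegel; field.
Qed.

Lemma cayley_heightE (x y : C) : 1 + y != 0 ->
  height (cayley ord0 x y) (cayley ord_max x y)
  = al ^+ 2 / 2 / (Re (1 + y) ^+ 2 + Im (1 + y) ^+ 2)
    * (1 - (Re x ^+ 2 + Im x ^+ 2 + (Re y ^+ 2 + Im y ^+ 2))).
Proof.
move=> n0; have N0 := normsq_gt0 n0.
apply: (@complexI R); rewrite cayley_height// !mul_conjc [2^-1 * _]mulrC.
rewrite -rmorphXn -[1 in LHS](rmorph1 (real_complex R)).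
have -> : (2^-1 : C) = (2^-1)%:C by rewrite fmorphV rmorph_nat.
rewrite -rmorphM -!rmorphB -rmorphM -fmorphV -rmorphM; congr (_%:C).
by move: N0; move: (Re (1 + y)) (Im (1 + y)) => p q N0; field; rewrite lt0r_neq0.
Qed.

Lemma cayley_height_gt0 (x y : C) : 1 + y != 0 ->
  (0 < height (cayley ord0 x y) (cayley ord_max x y))
  = (Re x ^+ 2 + Im x ^+ 2 + (Re y ^+ 2 + Im y ^+ 2) < 1).
Proof.
move=> n0; have N0 := normsq_gt0 n0; rewrite cayley_heightE// pmulr_rgt0 ?subr_gt0//.
by rewrite divr_gt0// divr_gt0// exprn_gt0.
Qed.

Definition ball_map z : 'C2[R] :=
  of_dz (fun j => cayley j (Z ord0 z) (Z ord_max z)).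

Lemma tube_WNormalE z : tube_domain W z <-> 0 < height (dz ord0 z) (dz ord_max z).
Proof. by rewrite /height subr_gt0. Qed.

Lemma ball_map_tube z : tube_domain M z -> tube_domain W (ball_map z).
Proof.
move=> Mz; apply/tube_WNormalE; rewrite !dz_of_dz.
by rewrite cayley_height_gt0 ?ball_coord_den// !ball_coord_normsq.
Qed.

Let hgradient_Z j z : hgradient (Z j) z (fun i => (i == j)%:R * (2^-1 * Z j z)).
Proof.
apply: hgradient_ext (hgradient_cexp (hgradientM (cgradient_dz j z)
  (hgradient_cst 2^-1 z))) => i.
by rewrite mulr0 addr0 mulrCA [Z j z * _]mulrC.
Qed.

Let n z := 1 + Z ord_max z.
Let u z := Z ord0 z / n z.
Let du z (k : 'I_2) : C := if k == ord0 then 2^-1 * Z ord0 z / n z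
                   else - (2^-1 * Z ord0 z * Z ord_max z / n z ^+ 2).
Let ds z (k : 'I_2) : C := if k == ord0 then 0 else - (Z ord_max z / n z ^+ 2).
Let dball z (i a : 'I_2) : C :=
  if a == ord0 then al%:C * du z i
  else 2^-1 * al%:C ^+ 2 * (ds z i + 2 * u z * du z i) + 2 * t%:C * al%:C * du z i.

Let hgradient_ball_map a z : tube_domain M z ->
  hgradient (fun w => cayley a (Z ord0 w) (Z ord_max w)) z (fun i => dball z i a).
Proof.
move=> Mz; have n0 := ball_coord_den Mz.
have gz j := hgradient_Z j z; have gc (c : C) := hgradient_cst c z.
have gn := hgradientV n0 (hgradientD (gc 1) (gz ord_max)).
have gu := hgradientM (gz ord0) gn.
have gs := hgradientM (hgradientD (gc 1) (hgradientM (gc (-1)) (gz ord_max))) gn.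
have two0 : (2 : C) != 0 by rewrite pnatr_eq0.
rewrite /cayley /dball; case: (I2P a) => -> /=.
  apply: hgradient_ext (hgradientD (hgradientM (gc al%:C) gu) (gc tau)) => i.
  by case: (I2P i) => ->; rewrite /du /n /=; field; rewrite n0.
apply: hgradient_ext (hgradientD (hgradientD
   (hgradientM (gc (2^-1 * al%:C ^+ 2)) (hgradientD gs (hgradientM gu gu)))
   (hgradientM (gc (2 * t%:C * al%:C)) gu)) (gc kappa)) => i.
by case: (I2P i) => ->; rewrite /du /ds /u /n /=; field; rewrite n0.
Qed.

(** Read in the coordinates [u], [s] of the Siegel domain, the pull-back does not
    depend on the affine automorphism: [L] and its conjugate [dual] absorb the
    shear and the translations. *)
Let hermitian z i j : tube_domain M z ->
  \sum_a \sum_b ((2 *: hessian (potential W) (re2 (ball_map z))) a b)%:C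
     * (dball z i a * (dball z j b)^c)
  = (hessian (potential M) (re2 z) i j)%:C.
Proof.
move=> Mz; have Wz := ball_map_tube Mz; have n0 := ball_coord_den Mz.
rewrite hessian_WNormal// hessian_MNegTri//.
pose h := height (cayley ord0 (Z ord0 z) (Z ord_max z))
  (cayley ord_max (Z ord0 z) (Z ord_max z)).
have bE : wnormal_b (re2 (ball_map z)) = h^-1.
  by rewrite /wnormal_b /wnormal_d !re2E !dz_of_dz.
pose b := (h^-1)%:C; pose q := (- 2 * Re (cayley ord0 (Z ord0 z) (Z ord_max z)))%:C.
have -> : \sum_a \sum_c ((2 *: (\matrix_(i, j) (2^-1 *
      (wnormal_b (re2 (ball_map z)) * wnormal_b (re2 (ball_map z))
       * wnormal_q i (re2 (ball_map z)) * wnormal_q j (re2 (ball_map z))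
       - wnormal_b (re2 (ball_map z)) * wnormal_e R i j)) : 'M[R]_2)) a c)%:C
     * (dball z i a * (dball z j c)^c)
   = 2 * b * (dball z i ord0 * (dball z j ord0)^c)
     + b ^+ 2 * (q * dball z i ord0 + dball z i ord_max)
              * (q * (dball z j ord0)^c + (dball z j ord_max)^c).
  rewrite !sum2 !mxE bE /wnormal_q /wnormal_e /= re2E dz_of_dz.
  rewrite /q /b; move: (h^-1) (- 2 * Re _) => B Q.
  have e00 : 2 * (2^-1 * (B * B * Q * Q - B * -2)) = B * B * Q * Q + 2 * B by field.
  have e01 : 2 * (2^-1 * (B * B * Q * 1 - B * 0)) = B * B * Q by field.
  have e10 : 2 * (2^-1 * (B * B * 1 * Q - B * 0)) = B * B * Q by field.
  have e11 : 2 * (2^-1 * (B * B * 1 * 1 - B * 0)) = B * B by field.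
  by rewrite e00 e01 e10 e11 rmorphD !rmorphM rmorph_nat; ring.
have uE : cayley ord0 (Z ord0 z) (Z ord_max z) = al%:C * u z + tau by [].
have qE : q = - (al%:C * (u z + (u z)^c) + 2 * t%:C).
  have -> : q = - 2 * (Re (cayley ord0 (Z ord0 z) (Z ord_max z)))%:C.
    by rewrite /q rmorphM rmorphN rmorph_nat.
  rewrite ReJ_add uE.
  by rewrite conjD conjM conj_real conj_tau; field.
have L k : q * dball z k ord0 + dball z k ord_max
    = 2^-1 * al%:C ^+ 2 * (ds z k - 2 * (u z)^c * du z k).
  by rewrite qE /dball /=; field.
have dual : q * (dball z j ord0)^c + (dball z j ord_max)^c
    = 2^-1 * al%:C ^+ 2 * ((ds z j)^c - 2 * u z * (du z j)^c).
  have qr : q^c = q by exact: conj_real.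
  clear qE; have := congr1 conjc (L j).
  move: (dball z j ord0) (dball z j ord_max) (ds z j) (du z j) (u z) => P P' S V V'.
  clearbody q.
  rewrite !conjE.
  by rewrite conj_real qr conjcK.
have d0 k : dball z k ord0 = al%:C * du z k by [].
rewrite L dual !d0 [(al%:C * _)^c]conjM conj_real.
pose X k := (Z k z)^c.
have nc : (1 + Z ord_max z)^c = 1 + X ord_max by rewrite conjD conj1.
have m0 : 1 + X ord_max != 0 by rewrite -nc conjc_eq0.
have r0 : 1 - Z ord0 z * X ord0 - Z ord_max z * X ord_max
    = (negtri_r (re2 z))%:C.
  by rewrite /X !ball_coord_mul_conj /negtri_r !rmorphB rmorph1.
have rn0 : 1 - Z ord0 z * X ord0 - Z ord_max z * X ord_max != 0.
  by rewrite r0 fmorph_eq0 lt0r_neq0// negtri_r_gt0.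
have bX : b = 2 * ((1 + Z ord_max z) * (1 + X ord_max))
    / (al%:C ^+ 2 * (1 - Z ord0 z * X ord0 - Z ord_max z * X ord_max)).
  have -> : b = (h%:C)^-1 by rewrite /b fmorphV.
  have -> : h%:C = 2^-1 * al%:C ^+ 2
      * (1 - Z ord0 z * X ord0 - Z ord_max z * X ord_max)
      / ((1 + Z ord_max z) * (1 + X ord_max)).
    by rewrite -nc; exact: cayley_height.
  by field; rewrite n0 m0 rn0 a_neq0.
have duc : (du z j)^c = if j == ord0 then 2^-1 * X ord0 / (1 + X ord_max)
    else - (2^-1 * X ord0 * X ord_max / (1 + X ord_max) ^+ 2).
  rewrite /du /n; case: ifP => _;
  by rewrite !conjE.
have dsc : (ds z j)^c = if j == ord0 then 0
    else - (X ord_max / (1 + X ord_max) ^+ 2).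
  rewrite /ds /n; case: ifP => _; first exact: conjc0.
  by rewrite !conjE.
have uc : (u z)^c = X ord0 / (1 + X ord_max).
  by rewrite /u /n !conjE.
have := pullback_hermitian (Z := Z^~ z) (X := X) i j a_neq0 n0 m0 rn0.
rewrite -bX -duc -dsc -uc -/(u z) -/(du z i) -/(ds z i) r0.
have pE k : Z k z * X k / (negtri_r (re2 z))%:C = (negtri_p k (re2 z))%:C.
  by rewrite /X ball_coord_mul_conj /negtri_p rmorphM fmorphV.
rewrite mxE !pE rmorphD !rmorphM rmorph_nat => <-.
have gen (A B D1 D2 S1 S2 V1 V2 : C) : 2 * B * (A * D1 * (A * D2))
    + B ^+ 2 * (2^-1 * A ^+ 2 * (S1 - 2 * V2 * D1))
    * (2^-1 * A ^+ 2 * (S2 - 2 * V1 * D2))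
    = 2 * B * A ^+ 2 * D1 * D2
      + B ^+ 2 * (4^-1 * A ^+ 4) * (S1 - 2 * V2 * D1) * (S2 - 2 * V1 * D2) by field.
exact: gen.
Qed.

Lemma ball_map_holomorphic z : tube_domain M z ->
  differentiable ball_map z /\
  forall v, 'd ball_map z (cplxJ v) = cplxJ ('d ball_map z v).
Proof.
move=> Mz; have hd a := hgradient_ball_map a Mz.
by split; [exact: of_dz_differentiable hd|exact: of_dz_holomorphic hd].
Qed.

Lemma ball_map_isometric z : tube_domain M z ->
  jacobian ball_map z *m (2 *: tube_metric W (ball_map z)) *m (jacobian ball_map z)^T
  = tube_metric M z.
Proof.
move=> Mz; have [df _] := ball_map_holomorphic Mz.
rewrite jacobianE// (tube_metricE (@WNormal_open R) (@WNormal_smooth R))//; last first.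
  exact: ball_map_tube.
rewrite (tube_metricE (@MNegTri_open R) (@MNegTri_smooth R))// scale_block_mx !scaler0.
apply: (of_dz_isometric (d := dball z)) => [a|i j].
  exact: hgradient_ball_map.
exact: hermitian.
Qed.

Lemma ball_coord_smooth A j : open A -> csmooth A (Z j).
Proof.
move=> oA; apply: csmooth_cexp => //.
exact: (csmoothM oA (csmooth_dz oA j) (csmooth_cst oA _)).
Qed.

Lemma ball_map_smooth A : open A -> A `<=` tube_domain M ->
  smooth_map_on A ball_map.
Proof.
move=> oA AM; apply: of_dz_smooth => j.
have k (c : C) := csmooth_cst oA c; have sZ i := ball_coord_smooth i oA.
have sn : csmooth A (fun z => (1 + Z ord_max z)^-1).
  apply: csmoothV (csmoothD oA (k 1) (sZ ord_max)) => // z /AM.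
  exact: ball_coord_den.
have su := csmoothM oA (sZ ord0) sn.
rewrite /cayley; case: (I2P j) => -> /=.
  exact: (csmoothD oA (csmoothM oA (k _) su) (k _)).
exact: (csmoothD oA (csmoothD oA (csmoothM oA (k _) (csmoothD oA
  (csmoothM oA (csmoothD oA (k 1) (csmoothM oA (k (-1)) (sZ ord_max))) sn)
  (csmoothM oA su su))) (csmoothM oA (k _) su)) (k _)).
Qed.

Lemma cayley_inv_smooth A j : open A -> A `<=` tube_domain W ->
  csmooth A (fun z => cayley_inv j (dz ord0 z) (dz ord_max z)).
Proof.
move=> oA AW; have k (c : C) := csmooth_cst oA c; have c i := csmooth_dz oA i.
have sh := csmoothM oA (csmoothD oA (c ord0) (k (- tau))) (k (al%:C)^-1).
have ss : csmooth A (fun z => siegel (dz ord0 z) (dz ord_max z)).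
  exact: (csmoothD oA (csmoothM oA (csmoothD oA (csmoothD oA (c ord_max) (k (- kappa)))
    (csmoothN oA (csmoothM oA (k (2 * t%:C * al%:C)) sh))) (k _))
    (csmoothN oA (csmoothX oA 2 sh))).
have sn : csmooth A (fun z => (1 + siegel (dz ord0 z) (dz ord_max z))^-1).
  apply: csmoothV (csmoothD oA (k 1) ss) => // z /AW/tube_WNormalE.
  exact: siegel_den.
rewrite /cayley_inv; case: (I2P j) => -> /=.
  exact: (csmoothM oA (csmoothM oA (k 2) sh) sn).
exact: (csmoothM oA (csmoothD oA (k 1) (csmoothN oA ss)) sn).
Qed.

(** ** The inverse, near the image of a point *)

Variable p : 'C2[R].

Definition ball_log (j : 'I_2) (w : 'C2[R]) : C :=
  cayley_inv j (dz ord0 w) (dz ord_max w) / Z j p.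

(** The exponential is inverted by the branch of the logarithm around the values
    of the coordinates at [p]. *)
Definition ball_map_inv (w : 'C2[R]) : 'C2[R] :=
  of_dz (fun j => dz j p + 2 * clog (ball_log j w)).

Definition ball_map_src : set 'C2[R] := tube_domain M `&`
  [set z | forall j, - (pi / 2) < Im ((dz j z - dz j p) * 2^-1) < pi / 2].

Definition ball_map_tgt : set 'C2[R] := tube_domain W `&`
  [set w | forall j, 0 < Re (ball_log j w)].

Let ball_coord_quot j z : Z j z / Z j p = cexp ((dz j z - dz j p) * 2^-1).
Proof.
apply: (canLR (mulfK (cexp_neq0 _))); rewrite -cexpD; congr cexp.
by ring.
Qed.

Let ball_log_ball_map j z : tube_domain M z ->
  ball_log j (ball_map z) = cexp ((dz j z - dz j p) * 2^-1).
Proof.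
move=> Mz; rewrite -ball_coord_quot /ball_log !dz_of_dz cayleyK ?ball_coord_den//.
by case: (I2P j) => ->.
Qed.

Lemma ball_map_src_tgt z : ball_map_src z ->
  ball_map_tgt (ball_map z) /\ ball_map_inv (ball_map z) = z.
Proof.
move=> [Mz zp]; split.
  split=> [|j]; first exact: ball_map_tube.
  rewrite ball_log_ball_map//= mulr_gt0 ?expR_gt0//.
  by apply: cos_gt0_pihalf; exact: zp.
apply: dz_inj => j; rewrite dz_of_dz ball_log_ball_map// cexpK//.
by field.
Qed.

Lemma ball_map_tgt_src w : ball_map_tgt w ->
  tube_domain M (ball_map_inv w) /\ ball_map (ball_map_inv w) = w.
Proof.
move=> [Ww wp]; have s0 := siegel_den (iffLR (tube_WNormalE w) Ww).
pose x j := cayley_inv j (dz ord0 w) (dz ord_max w).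
have ZE j : Z j (ball_map_inv w) = x j.
  rewrite /Z dz_of_dz mulrDl cexpD -/(Z j p).
  have -> : 2 * clog (ball_log j w) * 2^-1 = clog (ball_log j w) by field.
  by rewrite clogK// /ball_log mulrC divfK// cexp_neq0.
have n0 : 1 + x ord_max != 0.
  by rewrite cayley_inv_den// mulf_neq0 ?pnatr_eq0 ?invr_neq0.
split.
  rewrite /tube_domain /= /crd1 /crd2 -!ball_coord_normsq !ZE.
  rewrite -cayley_height_gt0//.
  have E j : cayley j (x ord0) (x ord_max) = dz j w.
    by rewrite cayley_invK//; case: (I2P j) => ->.
  by rewrite !E; exact/tube_WNormalE.
apply: dz_inj => j; rewrite dz_of_dz !ZE cayley_invK//.
by case: (I2P j) => ->.
Qed.

Lemma ball_map_src_open : open ball_map_src.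
Proof.
have oM := tube_domain_open (@MNegTri_open R); have k (a : C) := csmooth_cst oM a.
apply: csmooth_strip_open => // j.
exact: (csmoothM oM (csmoothD oM (csmooth_dz oM j) (k _)) (k _)).
Qed.

Let ball_log_smooth A j : open A -> A `<=` tube_domain W -> csmooth A (ball_log j).
Proof.
move=> oA AW; exact: (csmoothM oA (cayley_inv_smooth _ oA AW) (csmooth_cst oA _)).
Qed.

Lemma ball_map_tgt_open : open ball_map_tgt.
Proof.
have oW := tube_domain_open (@WNormal_open R).
by apply: csmooth_open => // j; exact: ball_log_smooth.
Qed.

Lemma ball_map_inv_smooth : smooth_map_on ball_map_tgt ball_map_inv.
Proof.
have oT := ball_map_tgt_open; apply: of_dz_smooth => j.
have k (a : C) := csmooth_cst oT a.
have sl : csmooth ball_map_tgt (fun w => clog (ball_log j w)).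
  apply: csmooth_clog => // [w [_]|]; first exact.
  by apply: ball_log_smooth => // w [].
exact: (csmoothD oT (k _) (csmoothM oT (k _) sl)).
Qed.

Lemma ball_map_src_center : tube_domain M p -> ball_map_src p.
Proof.
move=> Mp; split=> // j; rewrite subrr mul0r /=.
by rewrite oppr_lt0 divr_gt0// pi_gt0.
Qed.

End LocalIsometry.

(** The affine automorphisms of the tube over the parabola are transitive: the
    height of the target point fixes the dilation, its abscissa the shear, and
    the translations of the fiber adjust the imaginary parts. *)
Lemma ball_map_transitive (R : realType) (p q : 'C2[R]) :
  tube_domain (MNegTri R) p -> tube_domain (WNormal R) q ->
  exists al t k1 k2, 0 < al /\ ball_map al t k1 k2 p = q.
Proof.
move=> Mp /tube_WNormalE; set h := height _ _ => h0.
have n0 := ball_coord_den Mp; have N0 := normsq_gt0 n0.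
pose x := ball_coord ord0 p; pose y := ball_coord ord_max p.
pose N := complex.Re (1 + y) ^+ 2 + complex.Im (1 + y) ^+ 2.
pose r := 1 - (complex.Re x ^+ 2 + complex.Im x ^+ 2
  + (complex.Re y ^+ 2 + complex.Im y ^+ 2)).
have r0 : 0 < r by rewrite subr_gt0 !ball_coord_normsq.
pose al := Num.sqrt (2 * h * N / r).
have al2 : al ^+ 2 = 2 * h * N / r.
  by rewrite sqr_sqrtr// divr_ge0 ?mulr_ge0// ?(ltW h0) ?(ltW N0) ?(ltW r0).
have al0 : 0 < al by rewrite sqrtr_gt0 divr_gt0 ?mulr_gt0.
pose c := (real_complex R al) * (x * (1 + y)^-1).
pose t := complex.Re (dz ord0 q) - complex.Re c.
pose k1 := complex.Im (dz ord0 q) - complex.Im c.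
pose k2 := complex.Im (dz ord_max q) - complex.Im (cayley al t k1 0 ord_max x y).
exists al, t, k1, k2; split=> //; apply: dz_inj => j; rewrite dz_of_dz -/x -/y.
have e0 : cayley al t k1 k2 ord0 x y = dz ord0 q.
  rewrite /cayley /= -/c /t /k1; move: c {t k1 k2} (dz ord0 q) => [c1 c2] [q1 q2].
  by apply: complex_eqP => /=; ring.
case: (I2P j) => -> //; apply: complex_eqP; last first.
  have E k : complex.Im (cayley al t k1 k ord_max x y)
      = complex.Im (cayley al t k1 0 ord_max x y) + k.
    have gen (w : R[i]) (s : R) : complex.Im (w + Complex s k)
      = complex.Im (w + Complex s 0) + k by case: w => a b /=; rewrite addr0.
    exact: gen.
  by rewrite E /k2 addrC subrK.
have := cayley_heightE al t k1 k2 x n0; rewrite -/x -/y -/N -/r al2 e0.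
have -> : 2 * h * N / r / 2 / N * r = h.
  by field; rewrite (lt0r_neq0 N0) (lt0r_neq0 r0).
by rewrite /h /height => /addIr.
Qed.

(** * Gluing parametrizations *)

Section Gluing.
Variable R : realType.
Implicit Types X Y : kahler_surface R.

(** Parametrizations exist around every point of the domain. *)
Definition locally_injective X := forall p, kdom X p ->
  exists V, [/\ open V, V p & {in V &, injective (kproj X)}].

Lemma smooth_preimage_open (n p : nat) (O : set 'rV[R]_n) (f : 'rV[R]_n -> 'rV[R]_p) V :
  open O -> smooth_map_on O f -> open V -> open (O `&` f @^-1` V).
Proof.
move=> oO fO oV; rewrite openE => z [Oz Vfz].
have nO : \forall y \near z, O y by exact: open_nbhs_nbhs.
have cont := differentiable_continuous (smooth_map_differentiable fO Oz).
have nV : \forall y \near z, V (f y) by apply: (cont V); exact: open_nbhs_nbhs.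
exact: filterI nO nV.
Qed.

(** The isometry of domains is cut down to open sets on which both projections
    are injective, where it descends to the points of the surfaces. *)
Lemma locally_hol_isometric_at_proj X Y (O T : set 'C2[R]) f f' p :
  locally_injective X -> locally_injective Y ->
  open O -> O `<=` kdom X -> open T -> T `<=` kdom Y ->
  smooth_map_on O f -> smooth_map_on T f' ->
  (forall z, O z -> T (f z) /\ f' (f z) = z) -> (forall w, T w -> f (f' w) = w) ->
  holomorphic_on O f -> isometric_on (kmetric X) (kmetric Y) O f -> O p ->
  locally_hol_isometric_at (kproj X p) (kproj Y (f p)).
Proof.
move=> iX iY oO OX oT TY fO f'T fK f'K hol isom Op.
have [V [oV Vp injV]] := iX p (OX _ Op).
have [V' [oV' Vp' injV']] := iY (f p) (TY _ (fK p Op).1).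
pose A := (O `&` f @^-1` V') `&` V.
pose B := (T `&` f' @^-1` (O `&` V)) `&` V'.
have Ap : A p by [].
(* The preimage of [s] in [A] is unique, since [kproj X] is injective on [V]. *)
pose F s := kproj Y (f (xget p [set z | A z /\ kproj X z = s])).
have FE z : A z -> F (kproj X z) = kproj Y (f z).
  move=> Az; rewrite /F; have [] := xgetPex p (P := [set w | A w /\ kproj X w = kproj X z]).
    by exists z.
  set y := xget _ _ => Ay e; congr (kproj Y (f _)).
  by apply: injV => //; rewrite inE; [case: Ay|case: Az].
exists F; split; first exact: FE.
have AO : A `<=` O by move=> z [[]].
have BT : B `<=` T by move=> z [[]].
exists A, B, f, f'; split; last 2 first.
- by move=> z /AO; exact: hol.
- by move=> z /AO; exact: isom.
split; last first.
- by split; [exists p|exact: FE].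
- split=> [z [[Oz V'z] Vz]|w [[Tw [Ow Vw]] V'w]].
    by have [Tz zK] := fK z Oz; split=> //; split=> //; split=> //=; rewrite zK.
  have wK := f'K w Tw; split=> //; split=> //; split=> //=.
  by rewrite wK.
- by split=> k; [apply: smooth_on_sub AO (fO k)|apply: smooth_on_sub BT (f'T k)].
- split; last 2 first.
  + exact: subset_trans BT TY.
  + by move=> z w; rewrite !inE => -[_ Vz] [_ Vw]; apply: injV'; rewrite inE.
  by apply: openI => //; apply: smooth_preimage_open => //; exact: openI.
- split; last 2 first.
  + exact: subset_trans AO OX.
  + by move=> z w; rewrite !inE => -[_ Vz] [_ Vw]; apply: injV; rewrite inE.
  by apply: openI => //; exact: smooth_preimage_open.
Qed.

Lemma tube_surface_locally_injective (T : tube R) : locally_injective (tube_surface T).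
Proof. by move=> p _; exists setT; split=> //; exact: openT. Qed.

(** Near a point, the coordinates of the fiber in a basis of the lattice vary by
    less than one, so that no nonzero lattice vector separates two points. *)
Lemma tube_quotient_locally_injective (T : tube R) L :
  cocompact_lattice L -> locally_injective (tube_quotient T L).
Proof.
move=> [B BU ->] p _.
pose l i z : R[i] := \sum_j (dz j z + - dz j p) * real_complex R (invmx B j i).
pose V := [set: 'C2[R]] `&`
  [set z | forall i, - 2^-1 < complex.Im (l i z) < (2^-1 : R)].
have lE i z : complex.Im (l i z) = ((im2 z - im2 p) *m invmx B) ord0 i.
  have E (x y : R[i]) (b c : R) : complex.Im (x * real_complex R b + y * real_complex R c)
      = complex.Im x * b + complex.Im y * c.
    by case: x => x1 x2; case: y => y1 y2 /=; ring.
  have D j : complex.Im (dz j z + - dz j p) = (im2 z - im2 p) ord0 j.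
    by rewrite cImD cImN [RHS]mxE [X in _ = _ + X]mxE !im2E.
  by rewrite /l sum2 E !D [RHS]mxE sum2.
exists V; split.
- apply: csmooth_strip_open => [|i]; first exact: openT.
  have k (a : R[i]) := csmooth_cst (@openT 'C2[R]) a.
  have s j := csmoothM openT (csmoothD openT (csmooth_dz openT j) (k (- dz j p)))
    (k (real_complex R (invmx B j i))).
  by have := csmoothD openT (s ord0) (s ord_max); congr csmooth; apply/funext => z;
    rewrite /l sum2.
- by split=> // i; rewrite lE subrr mul0mx mxE oppr_lt0 invr_gt0 ltr0n.
move=> z w; rewrite !inE => -[_ Vz] [_ Vw] /= zw.
have : fiber_coset [set map_mx intr a *m B | a in [set: 'rV[int]_2]] w z.
  rewrite -zw; split=> //; exists 0 => //.
  by rewrite subrr map_mx0 mul0mx.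
move=> [reE [a _ aE]].
have aE' : map_mx intr a = (im2 z - im2 w) *m invmx B.
  by rewrite -aE -mulmxA mulmxV// mulmx1.
have a0 : a = 0.
  apply/rowP => i; rewrite mxE.
  have ai : (a ord0 i)%:~R = complex.Im (l i z) - complex.Im (l i w).
    rewrite !lE; transitivity (((map_mx intr a) : 'rV[R]_2) ord0 i); first by rewrite mxE.
    rewrite aE'.
    have -> : im2 z - im2 w = (im2 z - im2 p) - (im2 w - im2 p).
      by rewrite opprB addrA subrK.
    by rewrite mulmxBl [LHS]mxE [X in _ + X]mxE.
  have /andP[z1 z2] := Vz i; have /andP[w1 w2] := Vw i.
  have lo : (-1)%:~R < (a ord0 i)%:~R :> R by rewrite ai; lra.
  have hi : (a ord0 i)%:~R < 1%:~R :> R by rewrite ai; lra.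
  by move: lo hi; rewrite !ltr_int; case: (a ord0 i) => [[|n]|[|n]].
have imE : im2 z = im2 w.
  by apply/eqP; rewrite -subr_eq0 -aE a0 map_mx0 mul0mx.
by rewrite -[z]hsubmxK -[w]hsubmxK; congr row_mx.
Qed.

End Gluing.

(** * The two mirror pairs *)

Section MirrorPairs.
Variable R : realType.

Lemma NegTri_Normal_locally_hol_isometric (S S' : Type)
    (pr : 'C2[R] -> S) (pr' : 'C2[R] -> S') :
  let X := KahlerSurface (tube_domain (MNegTri R)) (tube_metric (MNegTri R)) pr in
  let Y := KahlerSurface (tube_domain (WNormal R)) (tube_metric (WNormal R)) pr' in
  locally_injective X -> locally_injective Y -> locally_hol_isometric X (rescale 2 Y).
Proof.
move=> X Y iX iY _ _ [p Mp <-] [q Wq <-].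
have [al [t [k1 [k2 [al0 fp]]]]] := ball_map_transitive Mp Wq.
have sub : ball_map_src p `<=` tube_domain (MNegTri R) by move=> z [].
have oS : open (ball_map_src p) by exact: ball_map_src_open.
rewrite -fp; apply: (@locally_hol_isometric_at_proj _ X (rescale 2 Y) (ball_map_src p)
  (ball_map_tgt al t k1 k2 p) _ (ball_map_inv al t k1 k2 p)) => //.
- exact: ball_map_tgt_open.
- by move=> w [].
- exact: ball_map_smooth.
- exact: ball_map_inv_smooth.
- by move=> z Sz; exact: ball_map_src_tgt.
- by move=> w Tw; have [] := ball_map_tgt_src al0 Tw.
- by move=> z /sub; exact: ball_map_holomorphic.
- by move=> z /sub; exact: ball_map_isometric.
- exact: ball_map_src_center.
Qed.

Section Duals.
Variables (S S' : Type) (pr : 'C2[R] -> S) (pr' : 'C2[R] -> S') (c : R).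
Hypothesis c0 : 0 < c.

Let X := KahlerSurface (tube_domain (WNegTri R)) (tube_metric (WNegTri R)) pr.
Let Y := KahlerSurface (tube_domain (MNormal R)) (tube_metric (MNormal R)) pr'.

Lemma WNegTri_MNormal_nowhere : nowhere_locally_isometric X (rescale c Y).
Proof.
move=> p q _ _ [F [_ [A [B [f [f' [dF isom]]]]]]].
case: dF => -[oA AX _] [_ BY _] [fA _] [fAB _] [[z Az _] _].
apply: no_local_isometry isom => //; first by exists z.
by move=> w /fAB[/BY].
Qed.

Lemma WNegTri_MNormal_not_isomorphic : ~ kahler_isomorphic X (rescale c Y).
Proof.
move=> [F [[FY _ _] iso]].
have [p0 Wp0] : tube_domain (WNegTri R) !=set0.
  by exists (const_mx 1); rewrite /tube_domain /= /crd1 /crd2 !mxE ltr01.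
have Xp : kpoints X (pr p0) by exists p0.
have [A [B [f [f' [dF _ isom]]]]] := iso _ Xp.
apply: (WNegTri_MNormal_nowhere Xp (FY _ Xp)).
by exists F; split=> //; exists A, B, f, f'.
Qed.

End Duals.
End MirrorPairs.

Theorem mainTheorem5 (R : realType) :
  (* two mirror pairs of Kahler tube domains *)
  [/\ is_kahler_tube (MNegTri R), is_kahler_tube (WNegTri R),
      is_kahler_tube (MNormal R) & is_kahler_tube (WNormal R)] /\
  (statistical_mirror (MNegTri R) (WNegTri R) /\
   statistical_mirror (MNormal R) (WNormal R)) /\
  (* one side: complex space forms, locally holomorphically isometric after
     the constant rescaling by 2 that equates their curvatures *)
  [/\ constant_negative_hsc (tube_surface (MNegTri R)),
      constant_negative_hsc (tube_surface (WNormal R))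
    & locally_hol_isometric (tube_surface (MNegTri R))
        (rescale 2 (tube_surface (WNormal R)))] /\
  (* the dual side, for every rescaling (c = 1 being no rescaling) *)
  (forall c : R, 0 < c ->
     ~ kahler_isomorphic (tube_surface (WNegTri R))
         (rescale c (tube_surface (MNormal R))) /\
     nowhere_locally_isometric (tube_surface (WNegTri R))
       (rescale c (tube_surface (MNormal R)))) /\
  (constant_scalar_curvature (tube_surface (MNormal R)) /\
   ~ constant_scalar_curvature (tube_surface (WNegTri R))) /\
  (* quotients of the fibers by lattices, and by the dual lattices *)
  (forall L1 L2 : set 'rV[R]_2, cocompact_lattice L1 -> cocompact_lattice L2 ->
     locally_hol_isometric (tube_quotient (MNegTri R) L1)
       (rescale 2 (tube_quotient (WNormal R) L2)) /\
     forall c : R, 0 < c ->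
       ~ kahler_isomorphic (tube_quotient (WNegTri R) (dual_lattice L1))
           (rescale c (tube_quotient (MNormal R) (dual_lattice L2))) /\
       nowhere_locally_isometric (tube_quotient (WNegTri R) (dual_lattice L1))
         (rescale c (tube_quotient (MNormal R) (dual_lattice L2)))).
Proof.
split; [split|split; [split|split; [split|split; [|split]]]].
- exact: MNegTri_kahler.
- exact: WNegTri_kahler.
- exact: MNormal_kahler.
- exact: WNormal_kahler.
- exact: mirror_NegTri.
- exact: mirror_Normal.
- exact: MNegTri_constant_hsc.
- exact: WNormal_constant_hsc.
- by apply: NegTri_Normal_locally_hol_isometric; exact: tube_surface_locally_injective.
- move=> c c0; split; first exact: WNegTri_MNormal_not_isomorphic.
  exact: WNegTri_MNormal_nowhere.
- split; first by exists (- 6); exact: scalar_curvature_MNormal.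
  move=> [s]; apply: scalar_curvature_WNegTri_nonconstant => //.
    exact: tube_domain_open (@WNegTri_open R).
  by exists (const_mx 1); rewrite /tube_domain /= /crd1 /crd2 !mxE ltr01.
- move=> L1 L2 L1l L2l; split.
    by apply: NegTri_Normal_locally_hol_isometric; exact: tube_quotient_locally_injective.
  move=> c c0; split; first exact: WNegTri_MNormal_not_isomorphic.
  exact: WNegTri_MNormal_nowhere.
Qed.
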